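(* Let $n\ge1$. For every $\epsilon\in(0,1)$ there is a constant $c_\epsilon>0$ depending only on $(n,\epsilon)$ such that for every integer $k\ge1$ and every Fekete measure $\mu_k$ of order $k$ of the unit sphere $\mathbb{S}^n\subset\mathbb{R}^{n+1}$ one has $$\mathrm{dist}_1(\mu_k,\mu_{eq})\le c_\epsilon\,k^{-1/36+\epsilon},$$ where $\mu_{eq}$ is the equilibrium measure of $(\mathbb{S}^n,0)$.
   Context: **Fekete measures.** For $k\in\mathbb{N}$ let $\mathcal{P}_k(\mathbb{S}^n)$ be the real vector space of restrictions to $\mathbb{S}^n$ of real polynomials of degree at most $k$ in $n+1$ variables, and let $N_k$ be its dimension. For a basis $S=\{s_1,\dots,s_{N_k}\}$ put $\det S(x)=\det[s_j(x_l)]_{1\le j,l\le N_k}$ for $x=(x_1,\dots,x_{N_k})\in(\mathbb{S}^n)^{N_k}$. A Fekete point of order $k$ is a point $x\in(\mathbb{S}^n)^{N_k}$ maximizing $|\det S|$ (independent of the choice of $S$). The associated Fekete measure of order $k$ is $\frac1{N_k}\sum_{j=1}^{N_k}\delta_{x_j}$. **Distance.** For probability measures $\mu,\mu'$ on $\mathbb{S}^n$, $\mathrm{dist}_1(\mu,\mu')=\sup_{\|v\|_{\mathcal{C}^1}\le1}|\langle\mu-\mu',v\rangle|$, with $v$ smooth real-valued functions on $\mathbb{S}^n$ (round metric). **Equilibrium measure.** Let $X=\mathbb{S}^n_{\mathbb{C}}\subset\mathbb{P}^{n+1}$ be the hypersurface $z_0^2+\cdots+z_n^2=z_{n+1}^2$,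 which contains $\mathbb{S}^n$ via $\mathbb{R}^{n+1}\subset\mathbb{C}^{n+1}\subset\mathbb{P}^{n+1}$, and let $\omega_0$ be the restriction to $X$ of the Fubini–Study form (the first Chern form of $\mathcal{O}(1)|_X$ with the Fubini–Study metric). A function $\psi:X\to\mathbb{R}\cup\{-\infty\}$ is $\omega_0$-p.s.h. if it is locally the sum of a plurisubharmonic and a smooth function and $dd^c\psi+\omega_0\ge0$, with $dd^c=\frac{i}{\pi}\partial\bar\partial$. Let $\phi^*$ be the upper semicontinuous regularization of $\sup\{\psi:\ \psi\ \omega_0\text{-p.s.h.},\ \psi\le0\text{ on }\mathbb{S}^n\}$. Then $\mu_{eq}=(dd^c\phi^*+\omega_0)^n/\int_X\omega_0^n$. This measure is the normalized volume measure on $\mathbb{S}^n$ induced by the Euclidean metric of $\mathbb{R}^{n+1}$. *)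

(* Defs.v *)
From HB Require Import structures.
From mathcomp Require Import all_boot all_order all_algebra complex.
From mathcomp Require Import all_classical all_reals all_analysis.
From mathcomp Require Import -(notations) mpoly.

Set Implicit Arguments.
Unset Strict Implicit.
Unset Printing Implicit Defensive.

Import Order.TTheory GRing.Theory Num.Theory.
Import numFieldNormedType.Exports.

Local Open Scope classical_set_scope.
Local Open Scope complex_scope.
Local Open Scope ring_scope.

(* The complex numbers, packed as a numFieldType so that row vectors over them
   get their topology and their complex normed-module structure. *)
Definition cplx (R : realType) : numFieldType := R[i].

Section Smooth.
Context {R : realType} {m : nat}.

(* C^oo on U: every iterated directional derivative exists and is continuous
   at every point of U (U is meant to be open). *)
Definition smooth_on (U : set 'rV[R]_m) (f : 'rV[R]_m -> R) : Prop :=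
  forall vs : seq 'rV[R]_m,
    let g := foldr (fun v h => 'D_v h) f vs in
    forall x, U x -> {for x, continuous g} /\ forall v, derivable g x v.

End Smooth.

(* Integral over R^m with respect to Lebesgue measure, as an iterated
   integral; it is used below for continuous compactly supported integrands. *)
Fixpoint lebesgue_rV (R : realType) (m : nat) : ('rV[R]_m -> R) -> R :=
  match m with
  | 0 => fun f => f 0
  | m'.+1 => fun f : 'rV[R]_(1 + m') -> R =>
      \int[@lebesgue_measure R]_t lebesgue_rV (fun v => f (row_mx t%:M v))
  end.

Section Fekete.
Context {R : realType} {n : nat}.

Definition sphere : set 'rV[R]_n.+1 :=
  [set x | \sum_(i < n.+1) x 0 i ^+ 2 = 1].

(* P_k(S^n). An element is represented by any function on R^(n+1) with the same
   restriction to the sphere; msize is 1 + the total degree. *)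
Definition sphere_poly (k : nat) (f : 'rV[R]_n.+1 -> R) : Prop :=
  exists2 p : mpoly n.+1 R, (msize p <= k.+1)%N &
    forall x, sphere x -> f x = meval (fun i => x 0 i) p.

Definition sphere_poly_basis (k N : nat) (s : 'I_N -> 'rV[R]_n.+1 -> R) : Prop :=
  [/\ forall j, sphere_poly k (s j),
      forall c : 'I_N -> R,
        (forall x, sphere x -> \sum_(j < N) c j * s j x = 0) ->
        forall j, c j = 0
    & forall f, sphere_poly k f -> exists c : 'I_N -> R,
        forall x, sphere x -> f x = \sum_(j < N) c j * s j x].

Definition detS (N : nat) (s : 'I_N -> 'rV[R]_n.+1 -> R)
    (x : 'I_N -> 'rV[R]_n.+1) : R :=
  \det (\matrix_(j < N, l < N) s j (x l)).

(* The existence of a basis indexed by 'I_N forces N = N_k. *)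
Definition fekete_point (k N : nat) (x : 'I_N -> 'rV[R]_n.+1) : Prop :=
  (forall l, sphere (x l)) /\
  exists2 s : 'I_N -> 'rV[R]_n.+1 -> R, sphere_poly_basis k s &
    forall y : 'I_N -> 'rV[R]_n.+1, (forall l, sphere (y l)) ->
      `|detS s y| <= `|detS s x|.

Definition borel_rV := g_sigma_algebraType (@open 'rV[R]_n.+1).

Definition fekete_measure (k : nat) (mu : probability borel_rV R) : Prop :=
  exists (N : nat) (x : 'I_N -> 'rV[R]_n.+1), fekete_point k x /\
    forall A : set borel_rV, measurable A ->
      mu A = ((N%:R^-1)%:E * \sum_(j < N) \d_(x j : borel_rV) A)%E.

(* C^1 norm of v|S^n for the round metric: sup |v| + sup |d(v|S^n)|. The second
   supremum only involves derivatives along unit tangent vectors, hence only the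
   values of v on the sphere. *)
Definition C1norm (v : 'rV[R]_n.+1 -> R) : \bar R :=
  let tangent (x t : 'rV[R]_n.+1) := \sum_(i < n.+1) x 0 i * t 0 i = 0 in
  let slopes := [set a : R | exists x t : 'rV[R]_n.+1,
    [/\ sphere x, sphere t, tangent x t & a = `|'D_t v x|]] in
  (ereal_sup [set `|v x|%:E | x in sphere] +
   ereal_sup [set a%:E | a in slopes])%E.

(* The smooth functions on S^n are the restrictions of the smooth functions
   on R^(n+1). *)
Definition dist1 (mu mu' : probability borel_rV R) : \bar R :=
  ereal_sup [set `|\int[mu]_(x in (sphere : set borel_rV)) v x
                   - \int[mu']_(x in (sphere : set borel_rV)) v x|%:E
            | v in [set v : 'rV[R]_n.+1 -> R |
                     smooth_on setT v /\ (C1norm v <= 1)%E]].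

End Fekete.

Arguments borel_rV : clear implicits.

Section ComplexAnalysis.
Context {R : realType} {n : nat}.
Local Notation Cn := 'rV[cplx R]_n.

Definition toC (w : 'rV[R]_(n + n)) : Cn :=
  \row_j (lsubmx w 0 j +i* rsubmx w 0 j : cplx R).

Definition csmooth_on (U : set Cn) (u : Cn -> R) : Prop :=
  smooth_on (toC @^-1` U) (u \o toC).

Definition expi (theta : R) : cplx R := cos theta +i* sin theta.

(* Plurisubharmonic: upper semicontinuous, < +oo, and satisfying the sub-mean
   value inequality on every closed complex disc a + D b contained in U. The
   function -oo is allowed; this affects no supremum below. *)
Definition psh (U : set Cn) (u : Cn -> \bar R) : Prop :=
  [/\ forall w, U w -> (u w < +oo)%E,
      forall w (t : R), U w -> (u w < t%:E)%E ->
        \forall w' \near w, (u w' < t%:E)%E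
    & forall a b : Cn,
        (forall zeta : cplx R, `|zeta| <= 1 -> U (a + zeta *: b)) ->
        ((2 * pi)%:E * u a <=
         \int[@lebesgue_measure R]_(theta in `[0%R, (2 * pi)%R])
           u (a + expi theta *: b)%R)%E].

(* d^2 u / dz_j dzbar_k, with d/dz_j = (d/dx_j - i d/dy_j) / 2. *)
Definition complex_hessian (u : Cn -> R) (w : 'rV[R]_(n + n)) : 'M[cplx R]_n :=
  let f := u \o toC in
  let ex (j : 'I_n) : 'rV[R]_(n + n) := delta_mx 0 (lshift n j) in
  let ey (j : 'I_n) : 'rV[R]_(n + n) := delta_mx 0 (rshift n j) in
  \matrix_(j, k)
    ((4^-1 * ('D_(ex j) ('D_(ex k) f) w + 'D_(ey j) ('D_(ey k) f) w)) +i*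
     (4^-1 * ('D_(ex j) ('D_(ey k) f) w - 'D_(ey j) ('D_(ex k) f) w)) : cplx R).

(* Density of (dd^c u)^n with respect to Lebesgue measure, u smooth: with
   dd^c = (i/pi) d dbar and i dz /\ dzbar = 2 dx /\ dy one has
   (dd^c u)^n = n! (2/pi)^n det(d^2 u / dz_j dzbar_k) dx dy. *)
Definition monge_ampere_density (u : Cn -> R) (w : 'rV[R]_(n + n)) : R :=
  n`!%:R * (2 / pi) ^+ n * complex.Re (\det (complex_hessian u w) : R[i]).

End ComplexAnalysis.

(* Geometry on X in P^(n+1), in homogeneous coordinates: a point of X is the
   C^*-line of a point of the punctured cone over X, subsets of X are saturated
   subsets of that cone, and functions on X are C^*-invariant functions. *)
Section Quadric.
Context {R : realType} {n : nat}.
Local Notation C := (cplx R).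
Local Notation Cn := 'rV[C]_n.
Local Notation V := 'rV[C]_(n.+1 + 1).

Definition quadric : set V :=
  [set z | z != 0 /\ \sum_(i < n.+1) lsubmx z 0 i ^+ 2 = rsubmx z 0 0 ^+ 2].

Definition embed (x : 'rV[R]_n.+1) : V :=
  row_mx (map_mx (fun t : R => t%:C : C) x) (const_mx 1).

Definition same_point (z z' : V) : Prop :=
  exists2 lambda : C, lambda != 0 & z' = lambda *: z.

Definition function_on_quadric T (f : V -> T) : Prop :=
  forall z z', quadric z -> same_point z z' -> f z' = f z.

(* The sigma-algebra generated by the C^*-saturated open sets; its trace on the
   cone is the Borel sigma-algebra of X. *)
Definition saturated_open : set (set V) :=
  [set A | open A /\ forall z z', A z -> same_point z z' -> A z'].

Definition borel_proj := g_sigma_algebraType saturated_open.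

(* Local holomorphic coordinates on X, given by their inverse: s is a
   holomorphic map from U to the cone whose class is an injective immersion
   into X. *)
Definition chart (U : set Cn) (s : Cn -> V) : Prop :=
  [/\ open U,
      forall w, U w -> quadric (s w) /\ differentiable s w,
      forall w, U w -> row_free (col_mx (s w) ('J s w))
    & forall w w', U w -> U w' -> same_point (s w) (s w') -> w = w'].

Definition log_norm (z : V) : R :=
  ln (Num.sqrt (\sum_(i < n.+1 + 1)
    (complex.Re (z 0 i : R[i]) ^+ 2 + complex.Im (z 0 i : R[i]) ^+ 2))).

(* In a chart, log |s| is a local potential of omega_0 = dd^c log |z|, so that
   dd^c psi + omega_0 = dd^c (psi o s + log |s|). *)
Definition local_potential (psi : V -> \bar R) (s : Cn -> V) (w : Cn) : \bar R :=
  (psi (s w) + (log_norm (s w))%:E)%E.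

Definition omega0_psh (psi : V -> \bar R) : Prop :=
  function_on_quadric psi /\
  forall U s, chart U s -> psh U (local_potential psi s).

Definition phi_sup (z : V) : \bar R :=
  ereal_sup [set psi z | psi in [set psi : V -> \bar R |
    omega0_psh psi /\ forall x, sphere x -> (psi (embed x) <= 0)%E]].

(* Upper semicontinuous regularization on X. *)
Definition phi_star (z : V) : \bar R :=
  limf_esup phi_sup (within quadric (nbhs z)).

Definition test_function (U : set Cn) (s : Cn -> V) (chi : V -> R) : Prop :=
  [/\ function_on_quadric chi, {within quadric, continuous chi}
    & exists K : set Cn, [/\ compact K, K `<=` U
      & forall z, quadric z -> chi z != 0 ->
          exists2 w, K w & same_point (s w) z]].

(* mu is the Bedford-Taylor measure (dd^c phi + omega_0)^n of a bounded
   omega_0-p.s.h. function phi: in every chart it is the weak limit of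
   (dd^c u_j)^n for every sequence of smooth p.s.h. functions u_j decreasing to
   the local potential of dd^c phi + omega_0. *)
Definition monge_ampere (phi : V -> \bar R) (mu : {measure set borel_proj -> \bar R}) :
    Prop :=
  forall U s, chart U s ->
  forall u_ : nat -> Cn -> R,
    (forall j, csmooth_on U (u_ j)) ->
    (forall j, psh U (EFin \o u_ j)) ->
    (forall j w, U w -> u_ j.+1 w <= u_ j w) ->
    (forall w, U w -> (u_ j w)%:E @[j --> \oo] --> local_potential phi s w) ->
  forall chi, test_function U s chi ->
    lebesgue_rV (fun w => \1_U (toC w) * chi (s (toC w)) *
                          monge_ampere_density (u_ j) w) @[j --> \oo] -->
    \int[mu]_(z in (quadric : set borel_proj)) chi z.

(* mu_eq = (dd^c phi^* + omega_0)^n / int_X omega_0^n, seen as a probability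
   measure on S^n through the embedding of S^n in X; omega_0^n is the
   Monge-Ampere measure of the function 0. *)
Definition equilibrium_measure (mueq : probability (borel_rV R n) R) : Prop :=
  mueq sphere = 1%E /\
  exists mu nu : {finite_measure set borel_proj -> \bar R},
    [/\ monge_ampere phi_star mu, monge_ampere (cst 0%E) nu
      & forall A : set borel_proj, measurable A -> A `<=` quadric ->
          mueq (sphere `&` embed @^-1` A) =
          (mu A * ((fine (nu quadric))^-1)%:E)%E].

End Quadric.

(* Main.v *)
From HB Require Import structures.
From mathcomp Require Import all_boot all_order all_algebra complex.
From mathcomp Require Import all_classical all_reals all_analysis.
From mathcomp Require Import -(notations) mpoly.
From mathcomp Require Import measurable_realfun ring lra.
Require Import Defs.
Set Implicit Arguments.
Unset Strict Implicit.
Unset Printing Implicit Defensive.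
Import Order.TTheory GRing.Theory Num.Theory.
Import numFieldNormedType.Exports.
Local Open Scope classical_set_scope.
Local Open Scope ring_scope.

(** Write [n = m + 1], so that the sphere lies in [R^(m + 2)].

    The equilibrium measure enters only through its invariance under rotations.
    Let [L] be the Lie norm of [C^(m + 2)], the norm for which the square of the
    norm of [z] is [|z|^2 + sqrt (|z|^4 - |z.z|^2)]. It is a maximum of moduli of
    linear forms, so [log L] of a holomorphic vector is subharmonic by Jensen's
    inequality ([lnlie_submean]); the latter is derived here from Goursat's theorem
    and the maximum modulus principle. Hence [log L - log_norm], up to a constant,
    competes in the definition of the extremal function. Conversely every point
    of the quadric lies on a disc inside a complexified great circle whose
    boundary consists of real points ([quadric_on_line]), and the maximum
    principle on that disc bounds all the competitors. So the extremal function
    is explicit ([phi_starE]) and invariant under rotations. In polynomial charts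
    that differ by a rotation its potential has literally the same smooth
    plurisubharmonic approximations, so the Monge-Ampere measure integrates
    rotated functions equally ([monge_ampere_rotation]); a partition of unity
    gives the invariance for all continuous functions ([equilibrium_invariance]).

    Let now [I] be the invariant integral, [f] a function of C^1 norm at most [1],
    and [x_1, ..., x_N] Fekete points of order [k]. By maximality of the
    determinant the Lagrange polynomials are bounded by [1] on the sphere
    ([lagrange_poly]). Multiplying the [j]-th one by [((1 + x.x_j) / 2)^m] localizes
    it near [x_j] at the price of raising the degree to [k + m]. Orthonormalize
    these products in the order of increasing [f (x_j)], and complete them to an
    orthonormal basis [e_i] of the polynomials of degree [k + m]. The reproducing
    kernel being invariant, the sum of the [e_i^2] is the constant [M], the
    dimension, so [M I(f)] is the sum of the [I(f e_i^2)]. For the [j]-th of the first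
    [N] elements this is at most [f (x_j) + eps] up to a tiny error, because the
    element is a combination of functions localized at nodes where [f] is at most
    [f (x_j)] ([flag_bound], [flag_gs]); each of the other [M - N] terms is at most
    [1]. As [1 - N / M] is at most [n m / k], this bounds [I(f)] by the Fekete mean
    of [f] plus an error ([mean_upper]), and [- f] gives the opposite bound. For
    [eps = 1 / a] and [m] of order [a^3], where [a^36 <= k < (a + 1)^36], the error
    is of order [1 / a] ([error_bound]). *)

(** * Goursat's theorem on rectangles *)
Section IntervalIntegral.
Context {R : realType}.
Implicit Types (a b c : R) (f g : R -> R).

Definition iint a b f : R := \int[@lebesgue_measure R]_(x in `[a, b]) f x.

Definition cont_on a b f := forall x, a <= x <= b -> {for x, continuous f}.

Lemma cont_on_sub a b c d f : a <= c -> d <= b -> cont_on a b f -> cont_on c d f.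
Proof.
move=> ac db cf x /andP[cx xd]; apply: cf; apply/andP; split.
  exact: le_trans ac cx.
exact: le_trans xd db.
Qed.

Lemma cont_on_integrable a b f : cont_on a b f ->
  (@lebesgue_measure R).-integrable `[a, b] (EFin \o f).
Proof.
move=> cf; apply: continuous_compact_integrable; first exact: segment_compact.
apply: continuous_in_subspaceT => x /set_mem/=; rewrite in_itv/=.
exact: cf.
Qed.

Lemma iint_split a b c f : a <= c <= b -> cont_on a b f ->
  iint a b f = iint a c f + iint c b f.
Proof.
move=> /andP[ac cb] cf; rewrite /iint.
have cfcb : cont_on c b f by apply: cont_on_sub cf.
have := @Rintegral_itvB R f (BLeft a) (BRight b) c (cont_on_integrable cf).
rewrite !bnd_simp => /(_ ac cb) /eqP.
rewrite subr_eq => /eqP ->; rewrite addrC; congr (_ + _).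
apply: Rintegral_itv_obnd_cbnd.
apply: integrableS (cont_on_integrable cfcb) => //.
by apply: subset_itvr; rewrite bnd_simp.
Qed.

Lemma iintD a b f g : cont_on a b f -> cont_on a b g ->
  iint a b (fun x => f x + g x) = iint a b f + iint a b g.
Proof. by move=> cf cg; rewrite /iint RintegralD//; exact: cont_on_integrable. Qed.

Lemma iintB a b f g : cont_on a b f -> cont_on a b g ->
  iint a b (fun x => f x - g x) = iint a b f - iint a b g.
Proof. by move=> cf cg; rewrite /iint RintegralB//; exact: cont_on_integrable. Qed.

Lemma iint_cst a b c : a <= b -> iint a b (fun=> c) = c * (b - a).
Proof.
move=> ab; rewrite /iint Rintegral_cst//= lebesgue_measure_itv/= lte_fin.
case: ltP => //= ba; have -> : a = b by apply/eqP; rewrite eq_le ab.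
by rewrite subrr.
Qed.

Lemma le_iint a b f g : cont_on a b f -> cont_on a b g ->
  (forall x, a <= x <= b -> f x <= g x) -> iint a b f <= iint a b g.
Proof.
move=> cf cg fg; rewrite /iint; apply: le_Rintegral => //; exact: cont_on_integrable.
Qed.

Lemma cont_on_cst a b c : cont_on a b (fun=> c).
Proof. by move=> x _; exact: cst_continuous. Qed.

Lemma iint_near_cst a b c e f : a <= b -> cont_on a b f ->
  (forall x, a <= x <= b -> `|f x - c| <= e) ->
  `|iint a b f - c * (b - a)| <= e * (b - a).
Proof.
move=> ab cf fe; rewrite ler_distl -mulrBl -mulrDl -!iint_cst//.
apply/andP; split; apply: le_iint => //; try exact: cont_on_cst.
- by move=> x /fe; rewrite ler_distl => /andP[].
- by move=> x /fe; rewrite ler_distl => /andP[].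
Qed.

End IntervalIntegral.

Section Goursat.
Context {R : realType}.
Implicit Types (P Q : R -> R -> R) (a b c d s t h k e : R).

(** Frechet differentiability at [(s, t)] with partial derivatives [p1] and
    [p2]. *)
Definition fdiff P s t p1 p2 := forall e, 0 < e -> exists2 r, 0 < r &
  forall s' t', `|s' - s| < r -> `|t' - t| < r ->
  `|P s' t' - P s t - (p1 * (s' - s) + p2 * (t' - t))| <=
    e * (`|s' - s| + `|t' - t|).

Lemma fdiff_cont1 P s t p1 p2 : fdiff P s t p1 p2 ->
  {for s, continuous (P^~ t)}.
Proof.
move=> /(_ 1 ltr01)[r r0 H]; apply/cvgrPdist_lt => e e0.
have q0 : 0 < 1 + `|p1| by rewrite ltr_wpDr.
near=> s'.
have hs : `|s' - s| < r.
  by rewrite distrC; near: s'; apply: cvgr_dist_lt => //; exact: cvg_id.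
have := H s' t hs; rewrite subrr normr0 mulr0 !addr0 mul1r => /(_ r0) h.
rewrite distrC.
have -> : P s' t - P s t = (P s' t - P s t - p1 * (s' - s)) + p1 * (s' - s) by ring.
apply: le_lt_trans (ler_normD _ _) _.
apply: (@le_lt_trans _ _ ((1 + `|p1|) * `|s' - s|)).
  by rewrite normrM mulrDl mul1r lerD2r.
rewrite -ltr_pdivlMl// mulrC distrC; near: s'.
by apply: cvgr_dist_lt; [exact: cvg_id|rewrite divr_gt0].
Unshelve. all: by end_near. Qed.

Lemma fdiff_swap P s t p1 p2 : fdiff P s t p1 p2 ->
  fdiff (fun t s => P s t) t s p2 p1.
Proof.
move=> H e /H[r r0 K]; exists r => // s' t' hs ht.
by rewrite [p2 * _ + _]addrC [`|s' - _| + _]addrC; exact: K.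
Qed.

Lemma fdiff_cont2 P s t p1 p2 : fdiff P s t p1 p2 -> {for t, continuous (P s)}.
Proof. by move=> /fdiff_swap/fdiff_cont1. Qed.

(** The circulation of [P ds + Q dt] along the boundary of the rectangle with
    corner [(a, c)] and sides [h], [k]. *)
Definition circ P Q a c h k : R :=
  iint c (c + k) (fun t => Q (a + h) t - Q a t) -
  iint a (a + h) (fun s => P s (c + k) - P s c).

(** Goursat's hypothesis: pointwise differentiability with equal mixed
    derivatives [w]. *)
Definition closed_form P Q a c h k := forall s t,
  a <= s <= a + h -> c <= t <= c + k ->
  exists p1 q2 w, fdiff P s t p1 w /\ fdiff Q s t w q2.

Lemma closed_form_sub P Q a c h k a' c' h' k' :
  a <= a' -> a' + h' <= a + h -> c <= c' -> c' + k' <= c + k ->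
  closed_form P Q a c h k -> closed_form P Q a' c' h' k'.
Proof. move=> h1 h2 h3 h4 H s t /andP[? ?] /andP[? ?]; apply: H; lra. Qed.

Lemma closed_form_P P Q a c h k t : closed_form P Q a c h k -> c <= t <= c + k ->
  cont_on a (a + h) (P^~ t).
Proof.
move=> H ht s hs; have [p1 [q2 [w [H1 _]]]] := H s t hs ht.
exact: fdiff_cont1 H1.
Qed.

Lemma closed_form_Q P Q a c h k s : closed_form P Q a c h k -> a <= s <= a + h ->
  cont_on c (c + k) (Q s).
Proof.
move=> H hs t ht; have [p1 [q2 [w [_ H1]]]] := H s t hs ht.
exact: fdiff_cont2 H1.
Qed.

Lemma half_bounds (x y l : R) : 0 <= l -> y = x \/ y = x + l / 2 ->
  x <= y /\ y + l / 2 <= x + l.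
Proof. by move=> l0 [] ->; split; lra. Qed.

Lemma contB f g (x : R) : {for x, continuous f} -> {for x, continuous g} ->
  {for x, continuous (fun y : R => f y - g y : R)}.
Proof. by move=> cf cg; exact: cvgB. Qed.

Lemma circ_split P Q a c h k : 0 <= h -> 0 <= k -> closed_form P Q a c h k ->
  circ P Q a c h k =
  (circ P Q a c (h / 2) (k / 2) + circ P Q a (c + k / 2) (h / 2) (k / 2)) +
  (circ P Q (a + h / 2) c (h / 2) (k / 2) +
   circ P Q (a + h / 2) (c + k / 2) (h / 2) (k / 2)).
Proof.
move=> h0 k0 H; rewrite /circ.
have Ea : a + h / 2 + h / 2 = a + h by lra.
have Ec : c + k / 2 + k / 2 = c + k by lra.
rewrite !Ea !Ec.
have Q1 (s x y : R) : a <= s <= a + h -> c <= x -> y <= c + k -> cont_on x y (Q s).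
  by move=> hs hx hy; apply: cont_on_sub (closed_form_Q H hs).
have P1 (t x y : R) : c <= t <= c + k -> a <= x -> y <= a + h -> cont_on x y (P^~ t).
  by move=> hs hx hy; apply: cont_on_sub (closed_form_P H hs).
have [ha hah] := half_bounds h0 (or_intror (erefl (a + h / 2))).
have [hc hck] := half_bounds k0 (or_intror (erefl (c + k / 2))).
rewrite Ea in hah; rewrite Ec in hck.
have ha' : a + h / 2 <= a + h by rewrite -[leRHS]Ea lerDl divr_ge0.
have hc' : c + k / 2 <= c + k by rewrite -[leRHS]Ec lerDl divr_ge0.
have [ah ck] : a <= a + h /\ c <= c + k by rewrite !lerDl.
rewrite !iintB; try (by apply: Q1; rewrite ?lexx ?ha ?ha' ?ah ?hc ?hc' ?ck);
  try (by apply: P1; rewrite ?lexx ?ha ?ha' ?ah ?hc ?hc' ?ck).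
have SQ s : a <= s <= a + h -> iint c (c + k) (Q s) =
    iint c (c + k / 2) (Q s) + iint (c + k / 2) (c + k) (Q s).
  by move=> hs; apply: iint_split; [rewrite hc hc'|apply: Q1].
have SP t : c <= t <= c + k -> iint a (a + h) (P^~ t) =
    iint a (a + h / 2) (P^~ t) + iint (a + h / 2) (a + h) (P^~ t).
  by move=> hs; apply: iint_split; [rewrite ha ha'|apply: P1].
rewrite !SQ ?lexx ?ha ?ha' ?ah// !SP ?lexx ?hc ?hc' ?ck//; ring.
Qed.

(** Near [(s, t)] the form differs from the affine closed form given by its
    derivatives by at most [e] times the distance, and affine closed forms
    have no circulation. *)
Lemma circ_small P Q a c h k s t p1 q2 w e r : 0 <= h -> 0 <= k ->
  closed_form P Q a c h k -> 0 <= e ->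
  a <= s <= a + h -> c <= t <= c + k -> h < r -> k < r ->
  (forall s' t', `|s' - s| < r -> `|t' - t| < r ->
    `|P s' t' - P s t - (p1 * (s' - s) + w * (t' - t))| <=
    e * (`|s' - s| + `|t' - t|)) ->
  (forall s' t', `|s' - s| < r -> `|t' - t| < r ->
    `|Q s' t' - Q s t - (w * (s' - s) + q2 * (t' - t))| <=
    e * (`|s' - s| + `|t' - t|)) ->
  `|circ P Q a c h k| <= 2 * e * (h + k) ^+ 2.
Proof.
move=> h0 k0 H e0 /andP[as1 sa] /andP[ct tc] hr kr HP HQ.
have ns s' : a <= s' <= a + h -> `|s' - s| <= h.
  by move=> ?; rewrite ler_distl; lra.
have nt t' : c <= t' <= c + k -> `|t' - t| <= k.
  by move=> ?; rewrite ler_distl; lra.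
have bnd s' t' : a <= s' <= a + h -> c <= t' <= c + k ->
    [/\ `|s' - s| < r, `|t' - t| < r &
      e * (`|s' - s| + `|t' - t|) <= e * (h + k)].
  move=> /ns hs /nt ht; split; [lra|lra|].
  by apply: ler_wpM2l => //; lra.
have A1 x : c <= x <= c + k ->
    `|(Q (a + h) x - Q a x) - w * h| <= 2 * e * (h + k).
  move=> hx.
  have [||u1 v1 w1] := bnd (a + h) x; [lra|lra|].
  have [||u2 v2 w2] := bnd a x; [lra|lra|].
  have := HQ _ _ u1 v1; have := HQ _ _ u2 v2.
  rewrite !ler_norml => /andP[? ?] /andP[? ?]; apply/andP; split; lra.
have A2 x : a <= x <= a + h ->
    `|(P x (c + k) - P x c) - w * k| <= 2 * e * (h + k).
  move=> hx.
  have [||u1 v1 w1] := bnd x (c + k); [lra|lra|].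
  have [||u2 v2 w2] := bnd x c; [lra|lra|].
  have := HP _ _ u1 v1; have := HP _ _ u2 v2.
  rewrite !ler_norml => /andP[? ?] /andP[? ?]; apply/andP; split; lra.
have B1 := @iint_near_cst R c (c + k) (w * h) (2 * e * (h + k)) _ _ _ A1.
have B2 := @iint_near_cst R a (a + h) (w * k) (2 * e * (h + k)) _ _ _ A2.
have {}B1 := B1 ltac:(lra).
have {}B2 := B2 ltac:(lra).
have /B1 : cont_on c (c + k) (fun x => Q (a + h) x - Q a x).
  by move=> x hx; apply: contB; apply: (closed_form_Q H) => //; lra.
have /B2 : cont_on a (a + h) (fun x => P x (c + k) - P x c).
  by move=> x hx; apply: contB;
   [apply: (@closed_form_P _ _ _ _ _ _ (c + k) H)|
    apply: (@closed_form_P _ _ _ _ _ _ c H)] => //; lra.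
rewrite /circ; set X := iint _ _ _; set Y := iint _ _ _.
have -> : c + k - c = k by lra.
have -> : a + h - a = h by lra.
rewrite !ler_norml => /andP[? ?] /andP[? ?].
have -> : 2 * e * (h + k) ^+ 2 = 2 * e * (h + k) * h + 2 * e * (h + k) * k by ring.
apply/andP; split; lra.
Qed.

(** Goursat's bisection: a circulation that exceeds [e] times the square of the
    size of the rectangle does so on some quarter of it, hence on arbitrarily
    small rectangles around some point, where differentiability forbids it. *)
Lemma circ_eq0 P Q a c h k : 0 <= h -> 0 <= k -> closed_form P Q a c h k ->
  circ P Q a c h k = 0.
Proof.
move=> h0 k0 H.
suff K e : 0 < e -> `|circ P Q a c h k| <= e * (h + k) ^+ 2.
  apply/eqP; rewrite -normr_le0; apply/ler_addgt0Pl => e e0; rewrite addr0.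
  have q0 : 0 < (h + k) ^+ 2 + 1 by rewrite ltr_wpDl// sqr_ge0.
  apply: le_trans (K (e / ((h + k) ^+ 2 + 1)) _) _; first by rewrite divr_gt0.
  by rewrite mulrAC -mulrA ler_piMr ?(ltW e0)// ler_pdivrMr// mul1r lerDl.
move=> e0; rewrite leNgt; apply/negP => bad.
pose sz n := 2^-1 ^+ n : R.
have sz0 n : 0 < sz n by rewrite exprn_gt0.
have szS n : sz n.+1 = sz n / 2 by rewrite /sz exprSr.
pose good n (p : R * R) := [/\ a <= p.1, p.1 + h * sz n <= a + h, c <= p.2,
   p.2 + k * sz n <= c + k &
   e * (h * sz n + k * sz n) ^+ 2 < `|circ P Q p.1 p.2 (h * sz n) (k * sz n)| ].
have step n p : good n p -> exists q : R * R, good n.+1 q /\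
    [/\ p.1 <= q.1, q.1 + h * sz n.+1 <= p.1 + h * sz n, p.2 <= q.2 &
        q.2 + k * sz n.+1 <= p.2 + k * sz n].
  case: p => x y [/= g1 g2 g3 g4 g5].
  have hs : 0 <= h * sz n by rewrite mulr_ge0// ltW.
  have ks : 0 <= k * sz n by rewrite mulr_ge0// ltW.
  have Hn : closed_form P Q x y (h * sz n) (k * sz n) by apply: closed_form_sub H.
  move: g5; rewrite (circ_split hs ks Hn).
  have eh : h * sz n.+1 = h * sz n / 2 by rewrite szS mulrA.
  have ek : k * sz n.+1 = k * sz n / 2 by rewrite szS mulrA.
  rewrite /good/= !eh !ek.
  set A := h * sz n in hs g2 eh *; set B := k * sz n in ks g4 ek *.
  move=> g5; apply: contrapT => /forallNP no.
  suff K x' y' : (x' = x \/ x' = x + A / 2) -> (y' = y \/ y' = y + B / 2) ->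
      `|circ P Q x' y' (A / 2) (B / 2)| <= e * (A / 2 + B / 2) ^+ 2.
    have := K x y (or_introl erefl) (or_introl erefl).
    have := K x _ (or_introl erefl) (or_intror erefl).
    have := K _ y (or_intror erefl) (or_introl erefl).
    have := K _ _ (or_intror erefl) (or_intror erefl).
    move=> K1 K2 K3 K4; move: g5; apply/negP; rewrite -leNgt.
    have -> : e * (A + B) ^+ 2 = (e * (A / 2 + B / 2) ^+ 2 + e * (A / 2 + B / 2) ^+ 2)
       + (e * (A / 2 + B / 2) ^+ 2 + e * (A / 2 + B / 2) ^+ 2) by field.
    by do 2 (apply: le_trans (ler_normD _ _) _; apply: lerD => //);
      apply: le_trans (ler_normD _ _) _; apply: lerD.
  move=> hx hy; rewrite leNgt; apply/negP => bd; apply: (no (x', y')) => /=.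
  have [hx1 hx2] := half_bounds hs hx; have [hy1 hy2] := half_bounds ks hy.
  split; split => //; [exact: le_trans g1 hx1|exact: le_trans hx2 g2
    |exact: le_trans g3 hy1|exact: le_trans hy2 g4].
have g0 : good 0 (a, c).
  by rewrite /good/= /sz expr0 !mulr1; split.
pose nxt n (p : R * R) := if pselect (good n p) is left g
  then projT1 (cid (step n p g)) else p.
have nxtP n p : good n p -> good n.+1 (nxt n p) /\
    [/\ p.1 <= (nxt n p).1, (nxt n p).1 + h * sz n.+1 <= p.1 + h * sz n,
      p.2 <= (nxt n p).2 & (nxt n p).2 + k * sz n.+1 <= p.2 + k * sz n].
  by rewrite /nxt; case: pselect => // g _; exact: (projT2 (cid (step n p g))).
pose u := fix u n := if n is m.+1 then nxt m (u m) else (a, c).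
have ug n : good n (u n) by elim: n => // n /nxtP[].
have inc n m : (n <= m)%N -> [/\ (u n).1 <= (u m).1,
    (u m).1 + h * sz m <= (u n).1 + h * sz n, (u n).2 <= (u m).2 &
    (u m).2 + k * sz m <= (u n).2 + k * sz n].
  elim: m => [|m IH]; first by rewrite leqn0 => /eqP->.
  rewrite leq_eqVlt => /predU1P[->//|]; rewrite ltnS => /IH[i1 i2 i3 i4].
  have [_ [/= j1 j2 j3 j4]] := nxtP m _ (ug m).
  by split; [exact: le_trans i1 j1|exact: le_trans j2 i2|exact: le_trans i3 j3
    |exact: le_trans j4 i4].
have cross n m : (u n).1 <= (u m).1 + h * sz m /\ (u n).2 <= (u m).2 + k * sz m.
  have hm q : 0 <= h * sz q /\ 0 <= k * sz q by rewrite !mulr_ge0// ltW.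
  have [hm1 hm2] := hm m; have [hn1 hn2] := hm n.
  have [nm|/ltnW nm] := leqP n m; have [i1 i2 i3 i4] := inc _ _ nm; split.
  - by apply: le_trans i1 _; rewrite lerDl.
  - by apply: le_trans i3 _; rewrite lerDl.
  - by apply: le_trans i2; rewrite lerDl.
  - by apply: le_trans i4; rewrite lerDl.
have lim (f : nat -> R) (g : nat -> R) : (forall n m, f n <= g m) ->
    exists x, forall n, f n <= x <= g n.
  move=> fg; exists (sup (range f)) => n; apply/andP; split.
    apply: ub_le_sup; last by exists n.
    by exists (g 0) => _ [m _ <-].
  by apply: ge_sup; [exists (f 0); exists 0|move=> _ [m _ <-]].
have [x hx] := lim (fun n => (u n).1) (fun n => (u n).1 + h * sz n)
  (fun n m => (cross n m).1).
have [y hy] := lim (fun n => (u n).2) (fun n => (u n).2 + k * sz n)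
  (fun n m => (cross n m).2).
have ax : a <= x <= a + h by have := hx 0; rewrite /= /sz expr0 mulr1.
have cy : c <= y <= c + k by have := hy 0; rewrite /= /sz expr0 mulr1.
have [p1 [q2 [w [DP DQ]]]] := H x y ax cy.
have e20 : 0 < e / 2 by rewrite divr_gt0.
have [r1 r10 F1] := DP _ e20; have [r2 r20 F2] := DQ _ e20.
pose r := Num.min r1 r2.
have r0 : 0 < r by rewrite lt_min r10.
have [n hn] : exists n, (h + k) * sz n < r.
  have : (fun n => (h + k) * sz n) @ \oo --> (h + k) * 0.
    apply: cvgM; first exact: cvg_cst.
    by apply: cvg_expr; rewrite ger0_norm ?invf_lt1 ?ltr1n.
  rewrite mulr0 => /cvgrPdist_lt/(_ _ r0)[N _ /(_ N (leqnn N))].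
  rewrite sub0r normrN ger0_norm => [?|]; first by exists N.
  by rewrite mulr_ge0 ?addr_ge0// ltW.
have [g1 g2 g3 g4 g5] := ug n.
have hs : 0 <= h * sz n by rewrite mulr_ge0// ltW.
have ks : 0 <= k * sz n by rewrite mulr_ge0// ltW.
have hk : h * sz n + k * sz n < r by rewrite -mulrDl.
have := @circ_small P Q (u n).1 (u n).2 (h * sz n) (k * sz n) x y p1 q2 w (e / 2) r
  hs ks (closed_form_sub g1 g2 g3 g4 H) (ltW e20) (hx n) (hy n).
have hr : h * sz n < r by apply: le_lt_trans hk; rewrite lerDl.
have kr : k * sz n < r by apply: le_lt_trans hk; rewrite lerDr.
move=> /(_ hr kr).
have -> : 2 * (e / 2) = e by field.
move=> K; move: g5; apply/negP; rewrite -leNgt; apply: K.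
  by move=> s' t'; rewrite !lt_min => /andP[? ?] /andP[? ?]; exact: F1.
by move=> s' t'; rewrite !lt_min => /andP[? ?] /andP[? ?]; exact: F2.
Qed.

End Goursat.

(** * Complex modulus and complex differentiability *)
Section ComplexModulus.
Context {R : realType}.
Local Notation C := (cplx R).
Implicit Types (z w : C) (F G : C -> C).

Definition cabs z : R := complex.Re (`|z| : R[i]).

Lemma cabsE z : `|z| = ((cabs z)%:C : R[i])%C :> C.
Proof. by rewrite /cabs normc_def. Qed.

Lemma cabs_def z : cabs z =
  Num.sqrt (complex.Re (z : R[i]) ^+ 2 + complex.Im (z : R[i]) ^+ 2).
Proof. by rewrite /cabs normc_def. Qed.

Lemma cabs_ge0 z : 0 <= cabs z.
Proof. by rewrite cabs_def sqrtr_ge0. Qed.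

Lemma cabsM z w : cabs (z * w) = cabs z * cabs w.
Proof.
apply: (@complexI R); rewrite -cabsE normrM !cabsE.
by rewrite rmorphM.
Qed.

Lemma cabsD z w : cabs (z + w) <= cabs z + cabs w.
Proof.
have := ler_normD z w; rewrite !cabsE -rmorphD.
by rewrite lecR.
Qed.

Lemma cabsN z : cabs (- z) = cabs z.
Proof. by rewrite /cabs normrN. Qed.

Lemma cabs0 : cabs 0 = 0. Proof. by rewrite /cabs normr0. Qed.
Lemma cabs1 : cabs 1 = 1. Proof. by rewrite /cabs normr1. Qed.

Lemma cabs_eq0 z : (cabs z == 0) = (z == 0).
Proof.
apply/eqP/eqP => [h|->]; last exact: cabs0.
by apply/eqP; rewrite -normr_eq0 cabsE h.
Qed.

Lemma cabs_gt0 z : (0 < cabs z) = (z != 0).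
Proof. by rewrite lt_def cabs_ge0 andbT cabs_eq0. Qed.

Lemma sqr_cabs z : cabs z ^+ 2 =
  complex.Re (z : R[i]) ^+ 2 + complex.Im (z : R[i]) ^+ 2.
Proof. by rewrite cabs_def sqr_sqrtr// addr_ge0// sqr_ge0. Qed.

Lemma Re_le_cabs z : `|complex.Re (z : R[i])| <= cabs z.
Proof. by rewrite cabs_def -sqrtr_sqr ler_wsqrtr// lerDl sqr_ge0. Qed.

Lemma Im_le_cabs z : `|complex.Im (z : R[i])| <= cabs z.
Proof. by rewrite cabs_def -sqrtr_sqr ler_wsqrtr// lerDr sqr_ge0. Qed.

Lemma cabs_le_ReIm z :
  cabs z <= `|complex.Re (z : R[i])| + `|complex.Im (z : R[i])|.
Proof.
rewrite -(@ler_pXn2r _ 2) ?nnegrE ?cabs_ge0 ?addr_ge0// sqr_cabs.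
rewrite sqrrD !real_normK ?num_real// -addrA lerD2l lerDr.
by rewrite mulrn_wge0// mulr_ge0.
Qed.

Lemma cabs_prod (I : Type) (r : seq I) (f : I -> C) :
  cabs (\prod_(i <- r) f i) = \prod_(i <- r) cabs (f i).
Proof. by elim/big_rec2: _ => [|i x y _ <-]; rewrite ?cabs1 ?cabsM. Qed.

Lemma cabs_le1 z : (`|z| <= 1) = (cabs z <= 1).
Proof. by rewrite cabsE -[1 : C]/((1%:C)%C : R[i]) lecR. Qed.

Lemma cabs_expi t : cabs (expi t) = 1.
Proof. by rewrite cabs_def/= cos2Dsin2 sqrtr1. Qed.

Lemma expiD s t : expi (s + t) = expi s * expi t :> C.
Proof.
apply/eqP; rewrite eq_complex/=; apply/andP; split; apply/eqP.
  by rewrite cosD.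
by rewrite sinD; ring.
Qed.

Lemma expi_2pi : expi (2 * pi) = 1 :> C.
Proof. by rewrite /expi mulr_natl cos2pi sin2pi. Qed.

Lemma expi0 : expi 0 = 1 :> C.
Proof. by rewrite /expi cos0 sin0. Qed.

(** The modulus is taken in [R] so that all the estimates are between real
    numbers. *)
Definition cdiff F z w := forall e : R, 0 < e -> exists2 r : R, 0 < r &
  forall z', cabs (z' - z) < r ->
    cabs (F z' - F z - w * (z' - z)) <= e * cabs (z' - z).

Definition cderivable F z := exists w, cdiff F z w.

Lemma cdiff_lip F z w : cdiff F z w -> exists2 r : R, 0 < r &
  forall z', cabs (z' - z) < r -> cabs (F z' - F z) <= (1 + cabs w) * cabs (z' - z).
Proof.
move=> /(_ 1 ltr01)[r r0 H]; exists r => // z' /H h.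
have -> : F z' - F z = (F z' - F z - w * (z' - z)) + w * (z' - z) by rewrite subrK.
by apply: le_trans (cabsD _ _) _; rewrite cabsM mulrDl lerD2r.
Qed.

Lemma cderivableM F G z : cderivable F z -> cderivable G z ->
  cderivable (fun x => F x * G x) z.
Proof.
move=> [w1 D1] [w2 D2]; exists (w1 * G z + F z * w2) => e e0.
pose K := 1 + cabs (G z) + cabs (F z) + (1 + cabs w1) * (1 + cabs w2).
have K0 : 0 < K.
  by rewrite /K -!addrA ltr_pwDl// !addr_ge0 ?mulr_ge0 ?addr_ge0 ?cabs_ge0.
have [r1 r10 L1] := cdiff_lip D1; have [r2 r20 L2] := cdiff_lip D2.
have eK : 0 < e / K by rewrite divr_gt0.
have [r3 r30 E1] := D1 _ eK; have [r4 r40 E2] := D2 _ eK.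
pose r := Num.min (Num.min r1 r2) (Num.min (Num.min r3 r4) (e / K)).
exists r; first by rewrite !lt_min r10 r20 r30 r40 eK.
move=> z'; rewrite !lt_min => /and3P[/andP[a1 a2] /andP[a3 a4] a5].
set d := cabs (z' - z) in a1 a2 a3 a4 a5 *.
have d0 : 0 <= d by exact: cabs_ge0.
have -> : F z' * G z' - F z * G z - (w1 * G z + F z * w2) * (z' - z) =
  (F z' - F z - w1 * (z' - z)) * G z + F z * (G z' - G z - w2 * (z' - z))
  + (F z' - F z) * (G z' - G z) by ring.
apply: le_trans (cabsD _ _) _; apply: le_trans (lerD (cabsD _ _) (lexx _)) _.
rewrite !cabsM.
have {}E1 := E1 _ a3; have {}E2 := E2 _ a4.
have {}L1 := L1 _ a1; have {}L2 := L2 _ a2.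
apply: (@le_trans _ _ ((e / K * d) * cabs (G z) + cabs (F z) * (e / K * d) +
   (1 + cabs w1) * d * ((1 + cabs w2) * (e / K)))).
  apply: lerD; first apply: lerD.
  - by apply: ler_wpM2r => //; exact: cabs_ge0.
  - by apply: ler_wpM2l => //; exact: cabs_ge0.
  - apply: ler_pM; rewrite ?cabs_ge0//.
    apply: le_trans L2 _; apply: ler_wpM2l; last exact: ltW.
    by rewrite addr_ge0// cabs_ge0.
have -> : e * d = (e / K * d) * K.
  by rewrite mulrAC divfK// gt_eqF.
rewrite /K; set u := e / K * d; have u0 : 0 <= u by rewrite mulr_ge0// ltW.
have -> : (1 + cabs w1) * d * ((1 + cabs w2) * (e / K)) =
   u * ((1 + cabs w1) * (1 + cabs w2)) by rewrite /u; ring.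
by nra.
Qed.

Lemma cderivable_rot F z u : cabs u = 1 -> cderivable F (u * z) ->
  cderivable (fun x => F (u * x)) z.
Proof.
move=> u1 [w D]; exists (w * u) => e /D[r r0 H]; exists r => // z' hz.
have := H (u * z'); rewrite -mulrBr cabsM u1 mul1r => /(_ hz).
by rewrite mulrA.
Qed.

Lemma cderivable_cst w z : cderivable (fun=> w) z.
Proof.
exists 0 => e e0; exists 1 => // z' _.
by rewrite mul0r !subrr cabs0 mulr_ge0 ?cabs_ge0// ltW.
Qed.

Lemma cderivable_prod (I : Type) (r : seq I) (f : I -> C -> C) z :
  (forall i, cderivable (f i) z) -> cderivable (fun x => \prod_(i <- r) f i x) z.
Proof.
move=> H; elim: r => [|i r IH].
  by under eq_fun do rewrite big_nil; exact: cderivable_cst.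
by under eq_fun do rewrite big_cons; exact: cderivableM.
Qed.

End ComplexModulus.

Section PlaneDifferentials.
Context {R : realType}.
Implicit Types (P : R -> R -> R).

Lemma fdiff_lip P s t p1 p2 : fdiff P s t p1 p2 -> exists2 r : R, 0 < r &
  forall s' t', `|s' - s| < r -> `|t' - t| < r ->
  `|P s' t' - P s t| <= (1 + `|p1| + `|p2|) * (`|s' - s| + `|t' - t|).
Proof.
move=> /(_ 1 ltr01)[r r0 H]; exists r => // s' t' hs ht.
have {}H := H s' t' hs ht.
have -> : P s' t' - P s t = (P s' t' - P s t - (p1 * (s' - s) + p2 * (t' - t)))
  + (p1 * (s' - s) + p2 * (t' - t)) by ring.
apply: le_trans (ler_normD _ _) _.
apply: le_trans (lerD H (ler_normD _ _)) _; rewrite !normrM.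
have := normr_ge0 (s' - s); have := normr_ge0 (t' - t).
have := normr_ge0 p1; have := normr_ge0 p2.
move: `|s' - s| `|t' - t| `|p1| `|p2| => ????; nra.
Qed.

Lemma fdiff_comp (A X Y : R -> R -> R) s t a1 a2 x1 x2 y1 y2 :
  fdiff A (X s t) (Y s t) a1 a2 -> fdiff X s t x1 x2 -> fdiff Y s t y1 y2 ->
  fdiff (fun s t => A (X s t) (Y s t)) s t
    (a1 * x1 + a2 * y1) (a1 * x2 + a2 * y2).
Proof.
move=> DA DX DY e e0.
pose LX := 1 + `|x1| + `|x2|; pose LY := 1 + `|y1| + `|y2|.
have LX0 : 0 < LX by rewrite /LX -!addrA ltr_pwDl// addr_ge0.
have LY0 : 0 < LY by rewrite /LY -!addrA ltr_pwDl// addr_ge0.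
pose K := LX + LY + `|a1| + `|a2|.
have K0 : 0 < K by rewrite /K -!addrA ltr_pwDl// !addr_ge0// ltW.
have eK : 0 < e / K by rewrite divr_gt0.
have [r1 r10 L1] := fdiff_lip DX; have [r2 r20 L2] := fdiff_lip DY.
have [r3 r30 E1] := DX _ eK; have [r4 r40 E2] := DY _ eK.
have [r5 r50 E3] := DA _ eK.
pose q := r5 / (LX + LY) / 2.
have q0 : 0 < q by apply: divr_gt0 => //; apply: divr_gt0 => //; exact: addr_gt0.
exists (Num.min (Num.min r1 r2) (Num.min (Num.min r3 r4) q)).
  by rewrite !lt_min r10 r20 r30 r40 q0.
move=> s' t'; rewrite !lt_min => /and3P[/andP[s1 s2] /andP[s3 s4] s5].
move=> /and3P[/andP[t1 t2] /andP[t3 t4] t5].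
set d := `|s' - s| + `|t' - t|.
have d0 : 0 <= d by rewrite addr_ge0.
have dq : (LX + LY) * d < r5.
  have LXY : 0 < LX + LY by rewrite addr_gt0.
  rewrite mulrC -ltr_pdivlMr//.
  have -> : r5 / (LX + LY) = q + q by rewrite /q; field; rewrite gt_eqF.
  exact: ltrD.
have {}L1 := L1 _ _ s1 t1; have {}L2 := L2 _ _ s2 t2.
have {}E1 := E1 _ _ s3 t3; have {}E2 := E2 _ _ s4 t4.
rewrite -/d -/LX -/LY in L1 L2 E1 E2.
have bX : `|X s' t' - X s t| < r5.
  by apply: le_lt_trans L1 _; apply: le_lt_trans dq; rewrite [(LX + LY) * d]mulrDl lerDl mulr_ge0// ltW.
have bY : `|Y s' t' - Y s t| < r5.
  by apply: le_lt_trans L2 _; apply: le_lt_trans dq; rewrite [(LX + LY) * d]mulrDl lerDr mulr_ge0// ltW.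
have {}E3 := E3 _ _ bX bY.
set dA := A _ _ - A _ _ in E3 *.
set dX := X _ _ - X _ _ in L1 E1 E3 bX; set dY := Y _ _ - Y _ _ in L2 E2 E3 bY.
have -> : dA - ((a1 * x1 + a2 * y1) * (s' - s) + (a1 * x2 + a2 * y2) * (t' - t)) =
  (dA - (a1 * dX + a2 * dY)) + (a1 * (dX - (x1 * (s' - s) + x2 * (t' - t))) +
   a2 * (dY - (y1 * (s' - s) + y2 * (t' - t)))) by ring.
apply: le_trans (ler_normD _ _) _.
apply: le_trans (lerD E3 (ler_normD _ _)) _; rewrite !normrM.
apply: (@le_trans _ _ (e / K * (LX * d + LY * d) +
   (`|a1| * (e / K * d) + `|a2| * (e / K * d)))).
  apply: lerD; first by apply: ler_wpM2l; [exact: ltW|exact: lerD].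
  by apply: lerD; apply: ler_wpM2l.
suff -> : e * d = e / K * (LX * d + LY * d) +
   (`|a1| * (e / K * d) + `|a2| * (e / K * d)) by [].
have -> : e / K * (LX * d + LY * d) + (`|a1| * (e / K * d) + `|a2| * (e / K * d))
  = e / K * K * d by rewrite /K; ring.
by rewrite divfK// gt_eqF.
Qed.

Lemma fdiff_mul x y : fdiff (fun a b : R => a * b) x y y x.
Proof.
move=> e e0; exists e => // x' y' hx hy.
have -> : x' * y' - x * y - (y * (x' - x) + x * (y' - y)) = (x' - x) * (y' - y).
  by ring.
rewrite normrM mulrDr; apply: (@le_trans _ _ (e * `|y' - y|)).
  by apply: ler_wpM2r => //; exact: ltW.
by rewrite lerDr mulr_ge0// ltW.
Qed.

Lemma fdiff_fst (f : R -> R) (s t f' : R) : is_derive s 1 f f' ->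
  fdiff (fun s _ => f s) s t f' 0.
Proof.
move=> [df <-] e e0.
have H : (fun h => h^-1 *: ((f \o shift s) (h *: 1) - f s)) @ 0^' --> 'D_1 f s.
  exact: df.
move: H => /cvgrPdist_le/(_ _ e0).
rewrite near_withinE => /nbhs_ballP[r /= r0 H].
exists r => // s' t' hs _; rewrite mul0r addr0.
have [->|ss] := eqVneq s' s; first by rewrite !subrr mulr0 subrr !normr0 add0r mulr_ge0// ltW.
have := H (s' - s); rewrite /ball/= sub0r normrN => /(_ hs).
rewrite subr_eq0 => /(_ ss).
rewrite /= [(s' - s) *: 1]mulr1 subrK; set L := 'D_1 f s => K.
have s0 : s' - s != 0 by rewrite subr_eq0.
have -> : f s' - f s - L * (s' - s) = - ((L - (s' - s)^-1 *: (f s' - f s)) * (s' - s)).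
  by rewrite /GRing.scale/=; field.
rewrite normrN normrM; apply: (@le_trans _ _ (e * `|s' - s|)).
  exact: ler_wpM2r.
by rewrite ler_wpM2l ?lerDl// ltW.
Qed.

End PlaneDifferentials.

(** * The maximum principle and Jensen's inequality *)
Section MaximumModulus.
Context {R : realType}.
Local Notation C := (cplx R).
Implicit Types (F G : C -> C).

Let cx (x y : R) : C := (x +i* y)%C.
Let Rp (z : C) : R := complex.Re (z : R[i]).
Let Ip (z : C) : R := complex.Im (z : R[i]).

Lemma ReIm_mul (z w : C) : Rp (z * w) = Rp z * Rp w - Ip z * Ip w /\
  Ip (z * w) = Rp z * Ip w + Ip z * Rp w.
Proof. by case: z => a b; case: w => c d. Qed.

Lemma cdiff_ReIm F x y w : cdiff F (cx x y) w ->
  fdiff (fun x y => Rp (F (cx x y))) x y (Rp w) (- Ip w) /\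
  fdiff (fun x y => Ip (F (cx x y))) x y (Ip w) (Rp w).
Proof.
move=> D; split => e e0; have e20 : 0 < e / 2 by rewrite divr_gt0.
- have [r r0 H] := D _ e0.
  exists (r / 2); first by rewrite divr_gt0.
  move=> x' y' hx hy.
  have hr : `|x' - x| + `|y' - y| < r by rewrite [r]splitr ltrD.
  have bd : cabs (cx x' y' - cx x y) <= `|x' - x| + `|y' - y| by exact: cabs_le_ReIm.
  have {}H := H (cx x' y') (le_lt_trans bd hr).
  apply: le_trans (ler_wpM2l (ltW e0) bd); apply: le_trans H.
  apply: le_trans (Re_le_cabs _).
  rewrite /Rp; case: (F _) => ? ?; case: (F _) => ? ?; case: w {D} => ? ?.
  by rewrite /= mulNr.
- have [r r0 H] := D _ e0.
  exists (r / 2); first by rewrite divr_gt0.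
  move=> x' y' hx hy.
  have hr : `|x' - x| + `|y' - y| < r by rewrite [r]splitr ltrD.
  have bd : cabs (cx x' y' - cx x y) <= `|x' - x| + `|y' - y| by exact: cabs_le_ReIm.
  have {}H := H (cx x' y') (le_lt_trans bd hr).
  apply: le_trans (ler_wpM2l (ltW e0) bd); apply: le_trans H.
  apply: le_trans (Im_le_cabs _).
  rewrite /Ip /Rp; case: (F _) => ? ?; case: (F _) => ? ?; case: w {D} => p q.
  by rewrite /= [p * _ + _]addrC.
Qed.

Lemma fdiff_polar (s t : R) :
  fdiff (fun s t => expR s * cos t) s t (expR s * cos t) (- (expR s * sin t)) /\
  fdiff (fun s t => expR s * sin t) s t (expR s * sin t) (expR s * cos t).
Proof.
have E := fdiff_fst t (is_derive_expR s).
have K := fdiff_swap (fdiff_fst s (is_derive_cos t)).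
have S := fdiff_swap (fdiff_fst s (is_derive_sin t)).
split.
  have := fdiff_comp (fdiff_mul (expR s) (cos t)) E K.
  by rewrite !mulr0 addr0 add0r mulrC mulrN.
have := fdiff_comp (fdiff_mul (expR s) (sin t)) E S.
by rewrite !mulr0 addr0 add0r mulrC.
Qed.

Definition polar (s t : R) : C := cx (expR s * cos t) (expR s * sin t).

Lemma cabs_polar s t : cabs (polar s t) = expR s.
Proof.
rewrite cabs_def/= !exprMn -mulrDr cos2Dsin2 mulr1 sqrtr_sqr ger0_norm// expR_ge0.
Qed.

Lemma polar0 t : polar 0 t = expi t.
Proof. by rewrite /polar expR0 !mul1r. Qed.

(** In the coordinates [z = exp (s + it)] the pair (imaginary part, real part)
    of a holomorphic function is a closed form by the Cauchy-Riemann equations,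
    so the circular means of the real part do not depend on the radius. *)
Lemma closed_form_holo F (a : R) : a <= 0 ->
  (forall z, cabs z <= 1 -> cderivable F z) ->
  closed_form (fun s t => Ip (F (polar s t))) (fun s t => Rp (F (polar s t)))
    a 0 (- a) (2 * pi).
Proof.
move=> a0 H s t hs ht.
have [w D] : cderivable F (polar s t).
  apply: H; rewrite cabs_polar -expR0 ler_expR.
  by move: hs; rewrite subrr => /andP[].
have [D1 D2] := cdiff_ReIm D; have [X Y] := fdiff_polar s t.
pose X0 := fun s t : R => expR s * cos t; pose Y0 := fun s t : R => expR s * sin t.
have := @fdiff_comp R _ X0 Y0 s t _ _ _ _ _ _ D1 X Y.
have := @fdiff_comp R _ X0 Y0 s t _ _ _ _ _ _ D2 X Y.
set p := Rp w; set q := Ip w; set u := expR s * cos t; set v := expR s * sin t.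
move=> P Q; exists (q * u + p * v), (p * - v + - q * u), (p * u - q * v).
split; last by rewrite -mulNr.
by have <- : q * - v + p * u = p * u - q * v by ring.
Qed.

(** The means of the real part over the unit circle and over a small circle
    agree, and the latter is close to the value at the centre. *)
Lemma mean_Re F (B : R) : (forall z, cabs z <= 1 -> cderivable F z) ->
  (forall t, 0 <= t <= 2 * pi -> Rp (F (expi t)) <= B) -> Rp (F 0) <= B.
Proof.
move=> H hB; apply/ler_addgt0Pl => e e0.
have [w D] : cderivable F 0 by apply: H; rewrite cabs0.
have [r r0 L] := cdiff_lip D.
pose q := Num.min 1 (Num.min r (e / (1 + cabs w)) / 2).
have w0 : 0 < 1 + cabs w by rewrite ltr_pwDl// cabs_ge0.
have q0 : 0 < q by rewrite lt_min ltr01/= divr_gt0// lt_min r0 divr_gt0.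
have a0 : ln q <= 0 by apply: ln_le0; rewrite ge_min lexx.
set a := ln q in a0.
have Ea : expR a = q by rewrite lnK// posrE.
have near t : `|Rp (F (polar a t)) - Rp (F 0)| <= e.
  have -> : Rp (F (polar a t)) - Rp (F 0) = Rp (F (polar a t) - F 0).
    by rewrite /Rp; case: (F _) => ? ?; case: (F _).
  apply: le_trans (Re_le_cabs _) _.
  have hq : cabs (polar a t) < Num.min r (e / (1 + cabs w)).
    rewrite cabs_polar Ea /q gt_min; apply/orP; right.
    have : 0 < Num.min r (e / (1 + cabs w)) by rewrite lt_min r0 divr_gt0.
    by move=> m0; rewrite ltr_pdivrMr// ltr_pMr// ltr1n.
  move: hq; rewrite lt_min => /andP[h1 h2].
  have := L (polar a t); rewrite subr0 => /(_ h1)/le_trans; apply.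
  by rewrite mulrC -ler_pdivlMr//; exact: ltW.
have pi20 : 0 <= 2 * pi :> R by rewrite mulr_ge0// pi_ge0.
have na : 0 <= - a by rewrite oppr_ge0.
have CF := closed_form_holo a0 H.
have := circ_eq0 na pi20 CF.
rewrite /circ subrr add0r.
have -> : (fun s => Ip (F (polar s (2 * pi))) - Ip (F (polar s 0))) = fun=> 0.
  apply/funext => s; rewrite /polar mulr_natl cos2pi sin2pi cos0 sin0.
  by rewrite subrr.
rewrite iint_cst// mul0r subr0.
have [c1 c2] : cont_on 0 (2 * pi) (fun t => Rp (F (polar 0 t))) /\
    cont_on 0 (2 * pi) (fun t => Rp (F (polar a t))).
  by split; have := closed_form_Q CF; rewrite subrr add0r; apply; rewrite ?lexx ?a0.
rewrite iintB// => /eqP; rewrite subr_eq0 => /eqP E.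
have U : iint 0 (2 * pi) (fun t => Rp (F (polar 0 t))) <= B * (2 * pi - 0).
  rewrite -(iint_cst B pi20); apply: (le_iint c1); first exact: cont_on_cst.
  by move=> t ht; rewrite polar0; exact: hB.
have V : `|iint 0 (2 * pi) (fun t => Rp (F (polar a t))) - Rp (F 0) * (2 * pi - 0)| <=
    e * (2 * pi - 0).
  by apply: (iint_near_cst pi20 c2) => t _; exact: near.
move: V; rewrite -E ler_distl => /andP[V _].
have pi0 : 0 < 2 * pi - 0 :> R by rewrite subr0; apply: mulr_gt0; [exact: ltr0n|exact: pi_gt0].
by rewrite -(ler_pM2r pi0) [leRHS]mulrDl -lerBlDl; exact: le_trans V U.
Qed.

(** Multiplication by the conjugate of [F 0] turns the modulus at the centre
    into a real part. *)
Lemma max_modulus F (B : R) : (forall z, cabs z <= 1 -> cderivable F z) ->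
  (forall t, 0 <= t <= 2 * pi -> cabs (F (expi t)) <= B) -> cabs (F 0) <= B.
Proof.
move=> H hB.
have [->|F0] := eqVneq (F 0) 0.
  rewrite cabs0; apply: le_trans (hB 0 _); first exact: cabs_ge0.
  by rewrite lexx/= mulr_ge0// pi_ge0.
pose u : C := ((F 0 : R[i])^*)%C.
have Eu : Rp (u * F 0) = cabs (F 0) ^+ 2.
  rewrite sqr_cabs /u /Rp; case: (F 0) => a b /=.
  by rewrite mulNr opprK !expr2.
have cu : cabs u = cabs (F 0).
  by rewrite !cabs_def /u; case: (F 0) => a b /=; rewrite sqrrN.
have c0 : 0 < cabs (F 0) by rewrite cabs_gt0.
have := @mean_Re (fun z => u * F z) (cabs (F 0) * B).
rewrite Eu expr2 ler_pM2l//; apply.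
  by move=> z /H; apply: cderivableM; exact: cderivable_cst.
move=> t ht; apply: le_trans (ler_norm _) _; apply: le_trans (Re_le_cabs _) _.
by rewrite cabsM cu ler_pM2l// hB.
Qed.

Lemma uniform_cont (a b e : R) (f : R -> R) : 0 < e -> cont_on a b f ->
  exists2 d : R, 0 < d & forall x y, a <= x <= b -> a <= y <= b ->
    `|x - y| < d -> `|f x - f y| < e.
Proof.
move=> e0 cf.
have /compact_near_coveringP K := @segment_compact R a b.
have {K}H : \forall d \near 0^'+, `[a, b]%classic `<=`
    (fun x => forall y, `|x - y| < d -> `|f x - f y| < e).
  apply: (K R 0^'+ (fun d x => forall y, `|x - y| < d -> `|f x - f y| < e)).
  move=> x /=; rewrite in_itv/= => /cf/cvgrPdist_lt/(_ (e / 2)).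
  rewrite divr_gt0// => /(_ isT)/nbhs_ballP[r /= r0 H].
  exists (ball x (r / 2), [set d | d < r / 2]) => /=.
    split; first by apply: nbhsx_ballx; rewrite divr_gt0.
    by apply: nbhs_right_lt; rewrite divr_gt0.
  move=> [x' d] [/= hx hd] y hy.
  have k1 := H x'; have k2 := H y.
  rewrite /ball/= in hx k1 k2.
  have r2 : r / 2 < r by rewrite ltr_pdivrMr// ltr_pMr// ltr1n.
  have {}k1 := k1 (lt_trans hx r2).
  have {}k2 : `|f x - f y| < e / 2.
    apply: k2; rewrite -(subrK x' x) -addrA; apply: le_lt_trans (ler_normD _ _) _.
    by rewrite [r]splitr ltrD// (lt_trans hy).
  rewrite -(subrK (f x) (f x')) -addrA; apply: le_lt_trans (ler_normD _ _) _.
  by rewrite [`|f x' - _|]distrC [e]splitr ltrD.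
have [d [K d0]] := filter_ex (filterI H (nbhs_right_gt (0 : R))).
exists d => // x y hx hy hxy.
by apply: K => //=; rewrite in_itv.
Qed.

Lemma prod_expR (I : Type) (r : seq I) (f : I -> R) :
  \prod_(i <- r) expR (f i) = expR (\sum_(i <- r) f i).
Proof. by elim/big_rec2: _ => [|i x y _ ->]; rewrite ?expR0 ?expRD. Qed.

(** Jensen's inequality: applying the maximum principle to the product of the
    rotations of [F] by the roots of unity of a large order bounds [ln |F 0|]
    by Riemann sums of [Phi]. *)
Lemma log_submean F (Phi : R -> R) : (forall z, cabs z <= 1 -> cderivable F z) ->
  F 0 != 0 -> continuous Phi -> (forall t, Phi (t + 2 * pi) = Phi t) ->
  (forall t, cabs (F (expi t)) <= expR (Phi t)) ->
  2 * pi * ln (cabs (F 0)) <= iint 0 (2 * pi) Phi.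
Proof.
move=> H F0 cP pP hP.
have pi0 : 0 < 2 * pi :> R by rewrite mulr_gt0// pi_gt0.
suff K (e : R) : 0 < e -> 2 * pi * ln (cabs (F 0)) <= iint 0 (2 * pi) Phi + e * (2 * pi).
  apply/ler_addgt0Pr => e e0; have := K (e / (2 * pi)).
  by rewrite divr_gt0// divfK ?gt_eqF//; apply.
move=> e0.
have cc a b : cont_on a b Phi by move=> x _; exact: cP.
have [d d0 U] := uniform_cont e0 (cc 0 (2 * pi)).
have [M hM] : exists M : nat, 2 * pi / M.+1%:R < d :> R.
  exists (Num.trunc (2 * pi / d)).
  by rewrite ltr_pdivrMr// [d * _]mulrC -ltr_pdivrMr// truncnS_gt.
pose h : R := 2 * pi / M.+1%:R.
have h0 : 0 < h by rewrite divr_gt0.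
have Mh : M.+1%:R * h = 2 * pi by rewrite /h mulrC divfK// pnatr_eq0.
pose S t := \sum_(j < M.+1) Phi (t + j%:R * h).
have Sper t : S (t + h) = S t.
  have e1 (j : nat) : t + h + j%:R * h = t + j.+1%:R * h.
    by rewrite -addn1 natrD; ring.
  rewrite /S big_ord_recr [RHS]big_ord_recl /= mul0r addr0 addrC; congr (_ + _).
    by rewrite e1 Mh pP.
  by apply: eq_bigr => i _; rewrite e1.
pose B := (iint 0 (2 * pi) Phi + e * (2 * pi)) / h.
have S0 t : 0 <= t <= h -> S t <= B.
  move=> /andP[t0 th]; rewrite ler_pdivlMr// /S.
  suff W m : (m <= M.+1)%N -> (\sum_(j < m) Phi (t + j%:R * h)) * h <=
      iint 0 (m%:R * h) Phi + e * (m%:R * h).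
    by rewrite -Mh; exact: W.
  elim: m => [|m IH] mM.
    rewrite big_ord0 !mul0r mulr0 addr0 /iint set_itv1 Rintegral_set1//.
  have mh : 0 <= m%:R * h by rewrite mulr_ge0// ltW.
  have sm : m.+1%:R * h = m%:R * h + h by rewrite -addn1 natrD mulrDl mul1r.
  have m1 : m%:R * h + h <= 2 * pi by rewrite -sm -Mh ler_wpM2r ?ler_nat// ltW.
  rewrite big_ord_recr/= mulrDl.
  have mhh : 0 <= m%:R * h <= m%:R * h + h by rewrite mh lerDl ltW.
  rewrite sm (iint_split mhh (cc _ _)).
  have {}IH := IH (ltnW mM).
  rewrite [e * (_ + _)]mulrDr addrACA; apply: lerD => //.
  have := @iint_near_cst _ (m%:R * h) (m%:R * h + h) (Phi (t + m%:R * h)) e Phi.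
  rewrite lerDl (ltW h0) => /(_ isT (cc _ _)).
  have -> : m%:R * h + h - m%:R * h = h by ring.
  rewrite ler_distl => X.
  suff /X/andP[]: forall x, m%:R * h <= x <= m%:R * h + h ->
      `|Phi x - Phi (t + m%:R * h)| <= e by rewrite lerBlDr.
  move=> x hx; apply/ltW/U; [lra|lra|].
  apply: le_lt_trans hM; rewrite -/h ler_distl; lra.
have Sall t : 0 <= t -> S t <= B.
  move=> t0; have [n hn] : exists n : nat, t <= n.+1%:R * h.
    exists (Num.trunc (t / h)); rewrite -ler_pdivrMr//; exact/ltW/truncnS_gt.
  elim: n t t0 hn => [|n IH] t t0; first by rewrite mul1r => ?; apply: S0; rewrite t0.
  have [th _|th hn] := leP t h; first by apply: S0; rewrite t0.
  rewrite -(subrK h t) Sper; apply: IH; first by rewrite subr_ge0 ltW.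
  by rewrite lerBlDr (le_trans hn)// -[n.+2]addn1 natrD mulrDl mul1r.
pose G (z : C) := \prod_(j < M.+1) F (expi (j%:R * h) * z).
have := @max_modulus G (expR B).
have -> : cabs (G 0) = cabs (F 0) ^+ M.+1.
  rewrite /G cabs_prod; under eq_bigr do rewrite mulr0.
  by rewrite prodr_const card_ord.
move=> K.
have {}K : cabs (F 0) ^+ M.+1 <= expR B.
  apply: K.
    move=> z hz; apply: cderivable_prod => j; apply: cderivable_rot.
      exact: cabs_expi.
    by apply: H; rewrite cabsM cabs_expi mul1r.
  move=> t /andP[t0 _]; rewrite /G cabs_prod.
  apply: (@le_trans _ _ (expR (S t))); last by rewrite ler_expR Sall.
  rewrite /S -prod_expR; apply: ler_prod => j _; rewrite cabs_ge0/=.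
  by rewrite -expiD addrC; exact: hP.
have c0 : 0 < cabs (F 0) by rewrite cabs_gt0.
have {}K : ln (cabs (F 0) ^+ M.+1) <= ln (expR B).
  by rewrite ler_ln ?posrE ?expR_gt0 ?exprn_gt0.
move: K; rewrite expRK lnXn// -[_ *+ M.+1]mulr_natl /B ler_pdivlMr//.
by rewrite mulrAC Mh.
Qed.

End MaximumModulus.

(** * Complex differentiability and topology *)
Section ComplexCalculus.
Context {R : realType}.
Local Notation C := (cplx R).
Local Notation Rp := (fun z : C => complex.Re (z : R[i])).
Local Notation Ip := (fun z : C => complex.Im (z : R[i])).

Lemma cderivableD (F G : C -> C) z : cderivable F z -> cderivable G z ->
  cderivable (fun x => F x + G x) z.
Proof.
move=> [w1 D1] [w2 D2]; exists (w1 + w2) => e e0.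
have e20 : 0 < e / 2 by rewrite divr_gt0.
have [r1 r10 E1] := D1 _ e20; have [r2 r20 E2] := D2 _ e20.
exists (Num.min r1 r2); first by rewrite lt_min r10.
move=> z'; rewrite lt_min => /andP[h1 h2].
have -> : F z' + G z' - (F z + G z) - (w1 + w2) * (z' - z) =
  (F z' - F z - w1 * (z' - z)) + (G z' - G z - w2 * (z' - z)) by ring.
apply: le_trans (cabsD _ _) _; rewrite [e]splitr mulrDl; apply: lerD.
  exact: E1.
exact: E2.
Qed.

Lemma cderivable_sum (I : Type) (r : seq I) (f : I -> C -> C) z :
  (forall i, cderivable (f i) z) -> cderivable (fun x => \sum_(i <- r) f i x) z.
Proof.
move=> H; elim: r => [|i r IH].
  by under eq_fun do rewrite big_nil; exact: cderivable_cst.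
by under eq_fun do rewrite big_cons; exact: cderivableD.
Qed.

Lemma continuous_expi_comp (F : C -> C) (t : R) : cderivable F (expi t) ->
  {for t, continuous (fun t => Rp (F (expi t)))} /\
  {for t, continuous (fun t => Ip (F (expi t)))}.
Proof.
move=> [w D].
have [D1 D2] := cdiff_ReIm D.
have aux (P : R -> R -> R) p q : fdiff P (cos t) (sin t) p q ->
    {for t, continuous (fun t => P (cos t) (sin t))}.
  move=> H.
  have K := @fdiff_comp R P (fun s t => cos t) (fun s t => sin t) 0 t _ _ _ _ _ _ H
    (fdiff_swap (fdiff_fst 0 (is_derive_cos t)))
    (fdiff_swap (fdiff_fst 0 (is_derive_sin t))).
  exact: fdiff_cont2 K.
by split; [exact: aux D1|exact: aux D2].
Qed.

Lemma Re_real (r : C) : 0 < r -> 0 < Rp r /\ r = ((Rp r)%:C)%C.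
Proof.
case: r => a b; rewrite ltcE/= => /andP[/eqP -> a0]; split => //.
Qed.

Lemma gt0_real (e : R) : 0 < e -> (0 : C) < ((e%:C)%C : C).
Proof. by move=> e0; rewrite ltcE/= eqxx. Qed.

(** Balls of [cplx R] have complex radii; this brings neighbourhoods back to
    real ones. *)
Lemma nbhs_cabsP (z : C) (P : set C) :
  nbhs z P <-> exists2 r : R, 0 < r & forall z', cabs (z' - z) < r -> P z'.
Proof.
split.
  move=> /nbhs_ballP[r /= /Re_real[r0 Er] H]; exists (Rp r) => // z' hz.
  apply: H; rewrite /ball/= distrC cabsE Er; rewrite [X in _ < X]/= .
  by rewrite ltcR.
move=> [r r0 H]; apply/nbhs_ballP; exists ((r%:C)%C : C) => /=.
  exact: gt0_real.
by move=> z'; rewrite /ball/= distrC cabsE ltcR => /H.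
Qed.

Lemma continuous_Re : continuous (Rp : C -> R).
Proof.
move=> z; apply/(@cvgrPdist_lt _ _ _ _ (nbhs_filter z)) => e e0; apply/nbhs_cabsP; exists e => // z' hz.
rewrite distrC; apply: le_lt_trans hz; apply: le_trans (Re_le_cabs _).
by case: z => ? ?; case: z'.
Qed.

Lemma continuous_Im : continuous (Ip : C -> R).
Proof.
move=> z; apply/(@cvgrPdist_lt _ _ _ _ (nbhs_filter z)) => e e0; apply/nbhs_cabsP; exists e => // z' hz.
rewrite distrC; apply: le_lt_trans hz; apply: le_trans (Im_le_cabs _).
by case: z => ? ?; case: z'.
Qed.

Lemma continuous_cplx (T : topologicalType) (f : T -> C) (p : T) :
  {for p, continuous (fun x => Rp (f x))} ->
  {for p, continuous (fun x => Ip (f x))} -> {for p, continuous f}.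
Proof.
move=> c1 c2 A /nbhs_cabsP[r r0 H].
have r20 : 0 < r / 2 by rewrite divr_gt0.
move/cvgrPdist_lt/(_ _ r20) : c1 => h1; move/cvgrPdist_lt/(_ _ r20) : c2 => h2.
suff: \forall x \near nbhs p, A (f x) by [].
apply: filterS2 h1 h2 => x n1 n2; apply: H.
apply: le_lt_trans (cabs_le_ReIm _) _.
rewrite [r]splitr; apply: le_lt_trans (ltrD n1 n2).
rewrite ![`|_ - _ (f x)|]distrC.
by case: (f x) => ? ?; case: (f p).
Qed.

Lemma derivable_cderivable (M n : nat) (s : 'rV[C]_n -> 'rV[C]_M) (a b : 'rV[C]_n)
  (z : C) (i : 'I_M) : derivable s (a + z *: b) b ->
  cderivable (fun x => s (a + x *: b) 0 i) z.
Proof.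
move=> D; set x := a + z *: b in D.
have H : (fun h => h^-1 *: ((s \o shift x) (h *: b) - s x)) @ 0^' --> 'D_b s x.
  exact: D.
have {}H : (fun h => (h^-1 *: ((s \o shift x) (h *: b) - s x)) 0 i) @ 0^' -->
    'D_b s x 0 i.
  apply: (@cvg_comp _ _ _ _ (fun A : 'rV[C]_M => A 0 i) _ _ _ H).
  exact: coord_continuous.
exists ('D_b s x 0 i) => e e0.
move: H => /cvgrPdist_le/(_ _ (gt0_real e0)).
rewrite near_withinE => /nbhs_cabsP[r r0 H]; exists r => // z' hz.
have [->|zz] := eqVneq z' z; first by rewrite !subrr mulr0 subrr cabs0 mulr0.
have zz0 : z' - z != 0 by rewrite subr_eq0.
have := H (z' - z); rewrite subr0 => /(_ hz zz0) /=.
have -> : (z' - z) *: b + x = a + z' *: b.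
  by rewrite /x scalerBl addrCA subrK.
set L := 'D_b s x; set u := s (a + z' *: b); set v := s x.
rewrite cabsE lecR !mxE => K.
have -> : u 0 i - v 0 i - L 0 i * (z' - z) =
  - ((L 0 i - (z' - z)^-1 * (u 0 i - v 0 i)) * (z' - z)) by field.
by rewrite cabsN cabsM ler_wpM2r ?cabs_ge0.
Qed.

Lemma cabs_conj (z : C) : cabs ((z : R[i])^*)%C = cabs z.
Proof. by rewrite !cabs_def; case: z => a b /=; rewrite sqrrN. Qed.

Lemma cabs_real (r : R) : cabs ((r%:C)%C : C) = `|r|.
Proof. by rewrite cabs_def/= expr0n/= addr0 sqrtr_sqr. Qed.

End ComplexCalculus.

(** * The Lie norm *)
Section LieNorm.
Context {R : realType} {M : nat}.
Local Notation C := (cplx R).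
Local Notation Rp := (fun z : C => complex.Re (z : R[i])).
Local Notation Ip := (fun z : C => complex.Im (z : R[i])).
Implicit Types (z w : 'rV[C]_M).

Definition nsq z : R := \sum_i cabs (z 0 i) ^+ 2.
Definition dsq z : C := \sum_i z 0 i ^+ 2.

(** The square of the Lie norm of [C^M]. *)
Definition lie2 z : R := nsq z + Num.sqrt (nsq z ^+ 2 - cabs (dsq z) ^+ 2).

Definition lnlie z : R := ln (lie2 z) / 2.

Lemma nsq_ge0 z : 0 <= nsq z.
Proof. by apply: sumr_ge0 => i _; exact: sqr_ge0. Qed.

Lemma nsq_gt0 z : z != 0 -> 0 < nsq z.
Proof.
move=> z0; rewrite lt_def nsq_ge0 andbT; apply: contra z0 => /eqP.
move=> /psumr_eq0P H; apply/eqP/rowP => i; rewrite mxE.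
have := H (fun i _ => sqr_ge0 _) i isT => /eqP.
by rewrite sqrf_eq0 cabs_eq0 => /eqP.
Qed.

Lemma lie2_gt0 z : z != 0 -> 0 < lie2 z.
Proof. by move=> /nsq_gt0 h; rewrite ltr_pwDl// sqrtr_ge0. Qed.

Lemma nsqZ u z : nsq (u *: z) = cabs u ^+ 2 * nsq z.
Proof.
by rewrite /nsq mulr_sumr; apply: eq_bigr => i _; rewrite mxE cabsM exprMn.
Qed.

Lemma dsqZ u z : dsq (u *: z) = u ^+ 2 * dsq z.
Proof. by rewrite /dsq mulr_sumr; apply: eq_bigr => i _; rewrite mxE exprMn. Qed.

Lemma lie2Z u z : lie2 (u *: z) = cabs u ^+ 2 * lie2 z.
Proof.
rewrite /lie2 nsqZ dsqZ cabsM mulrDr; congr (_ + _).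
have -> : cabs (u ^+ 2) = cabs u ^+ 2 by rewrite !expr2 cabsM.
by rewrite !exprMn -mulrBr sqrtrM ?sqr_ge0// sqrtr_sqr ger0_norm ?sqr_ge0.
Qed.

Lemma lnlieZ u z : u != 0 -> z != 0 -> lnlie (u *: z) = ln (cabs u) + lnlie z.
Proof.
move=> u0 z0; rewrite /lnlie lie2Z lnM ?posrE ?lie2_gt0 ?exprn_gt0 ?cabs_gt0//.
have -> : ln (cabs u ^+ 2) = ln (cabs u) * 2 by rewrite lnXn ?cabs_gt0// mulr_natr.
by field.
Qed.

Let A z := \sum_i Rp (z 0 i) ^+ 2.
Let B z := \sum_i Ip (z 0 i) ^+ 2.
Let X z := \sum_i Rp (z 0 i) * Ip (z 0 i).

Lemma nsqE z : nsq z = A z + B z.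
Proof. by rewrite /A /B -big_split; apply: eq_bigr => i _; rewrite sqr_cabs. Qed.

Lemma Re_sum (I : Type) (r : seq I) (f : I -> C) :
  Rp (\sum_(i <- r) f i) = \sum_(i <- r) Rp (f i).
Proof. by elim/big_rec2: _ => // i x y _ <-; case: (f i); case: y. Qed.

Lemma Im_sum (I : Type) (r : seq I) (f : I -> C) :
  Ip (\sum_(i <- r) f i) = \sum_(i <- r) Ip (f i).
Proof. by elim/big_rec2: _ => // i x y _ <-; case: (f i); case: y. Qed.

Lemma dsqE z : Rp (dsq z) = A z - B z /\ Ip (dsq z) = 2 * X z.
Proof.
split.
  rewrite /dsq Re_sum /A /B -sumrB; apply: eq_bigr => i _.
  by rewrite !expr2 (ReIm_mul _ _).1.
rewrite /dsq Im_sum /X mulr_sumr; apply: eq_bigr => i _.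
by rewrite expr2 (ReIm_mul _ _).2; ring.
Qed.

(** Rotating the phase makes the real and imaginary parts orthogonal; the Lie
    norm is then the sum of their lengths. *)
Lemma lie_align z : exists2 u : C, cabs u = 1 &
  [/\ X (u *: z) = 0, B (u *: z) <= A (u *: z) , dsq (u *: z) = ((cabs (dsq z))%:C)%C &
   lie2 z = (Num.sqrt (A (u *: z)) + Num.sqrt (B (u *: z))) ^+ 2].
Proof.
have [u u1 hu] : exists2 u : C, cabs u = 1 & u ^+ 2 * dsq z = ((cabs (dsq z))%:C)%C.
  have [->|d0] := eqVneq (dsq z) 0.
    by exists 1; rewrite ?cabs1// mulr0 cabs0.
  have c0 : 0 < cabs (dsq z) by rewrite cabs_gt0.
  pose v : C := ((dsq z : R[i])^*)%C * (((cabs (dsq z))^-1)%:C)%C.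
  have v1 : cabs v = 1.
    by rewrite /v cabsM cabs_conj cabs_real ger0_norm ?invr_ge0 ?ltW// divff// gt_eqF.
  exists (sqrtc v).
    apply/eqP; rewrite -(@eqrXn2 _ 2) ?cabs_ge0// expr1n expr2 -cabsM -expr2.
    by rewrite sqr_sqrtc v1.
  rewrite sqr_sqrtc /v mulrAC [_^*%C * _]mulrC.
  have -> : (dsq z : R[i]) * ((dsq z : R[i])^*)%C = ((cabs (dsq z) ^+ 2)%:C)%C.
    rewrite sqr_cabs; case: (dsq z) => p q /=; apply/eqP; rewrite eq_complex/=.
    by apply/andP; split; apply/eqP; ring.
  by rewrite -[LHS](rmorphM (real_complex R)) expr2 mulfK// gt_eqF.
exists u => //.
have E := dsqZ u z; rewrite hu in E.
have [E1 E2] := dsqE (u *: z); rewrite E/= in E1 E2.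
have X0 : X (u *: z) = 0 by move: E2; lra.
have BA : B (u *: z) <= A (u *: z) by rewrite -subr_ge0 -E1 cabs_ge0.
split => //.
have -> : lie2 z = lie2 (u *: z) by rewrite lie2Z u1 expr1n mul1r.
have A0 : 0 <= A (u *: z) by apply: sumr_ge0 => i _; exact: sqr_ge0.
have B0 : 0 <= B (u *: z) by apply: sumr_ge0 => i _; exact: sqr_ge0.
rewrite /lie2 nsqE E.
have -> : cabs ((cabs (dsq z))%:C)%C = A (u *: z) - B (u *: z).
  by rewrite -E1 cabs_def/= expr0n/= addr0 sqrtr_sqr ger0_norm ?cabs_ge0.
set p := Num.sqrt (A _); set q := Num.sqrt (B _).
have p0 : 0 <= p by exact: sqrtr_ge0.
have q0 : 0 <= q by exact: sqrtr_ge0.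
have -> : A (u *: z) = p ^+ 2 by rewrite sqr_sqrtr.
have -> : B (u *: z) = q ^+ 2 by rewrite sqr_sqrtr.
have -> : (p ^+ 2 + q ^+ 2) ^+ 2 - (p ^+ 2 - q ^+ 2) ^+ 2 = (2 * p * q) ^+ 2 by ring.
by rewrite sqrtr_sqr ger0_norm ?mulr_ge0//; ring.
Qed.

Lemma bessel2 (x a b : 'I_M -> R) : \sum_i a i * b i = 0 ->
  \sum_i a i ^+ 2 <= 1 -> \sum_i b i ^+ 2 <= 1 ->
  (\sum_i x i * a i) ^+ 2 + (\sum_i x i * b i) ^+ 2 <= \sum_i x i ^+ 2.
Proof.
move=> ab a1 b1; set p := \sum_i x i * a i; set q := \sum_i x i * b i.
have K p' q' : \sum_i (x i - p' * a i - q' * b i) ^+ 2 = \sum_i x i ^+ 2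
   - 2 * p' * p - 2 * q' * q + p' ^+ 2 * \sum_i a i ^+ 2
   + q' ^+ 2 * \sum_i b i ^+ 2 + 2 * p' * q' * \sum_i a i * b i.
  rewrite /p /q !mulr_sumr -!sumrN -!big_split/=; apply: eq_bigr => i _.
  ring.
have : 0 <= \sum_i (x i - p * a i - q * b i) ^+ 2.
  by apply: sumr_ge0 => i _; exact: sqr_ge0.
rewrite K ab mulr0 addr0; nra.
Qed.

Definition pairing (c : 'I_M -> C) z : C := \sum_i z 0 i * c i.

Lemma pairingZ c u z : pairing c (u *: z) = u * pairing c z.
Proof. by rewrite /pairing mulr_sumr; apply: eq_bigr => i _; rewrite mxE mulrA. Qed.

(** Once the phase is aligned, Bessel's inequality for the orthogonal pair
    [a], [b] bounds the pairings with the real and with the imaginary part of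
    the vector by their lengths, whose sum is the Lie norm. *)
Lemma cabs_pairing_le (a b : 'I_M -> R) z : \sum_i a i * b i = 0 ->
  \sum_i a i ^+ 2 <= 1 -> \sum_i b i ^+ 2 <= 1 ->
  cabs (pairing (fun i => (a i -i* b i)%C) z) ^+ 2 <= lie2 z.
Proof.
move=> ab a1 b1; have [u u1 [_ _ _ ->]] := lie_align z.
rewrite -[cabs _]mul1r -u1 -cabsM -pairingZ; set w := u *: z.
pose x i := Rp (w 0 i); pose y i := Ip (w 0 i).
have U (v : 'I_M -> R) : cabs ((\sum_i v i * a i) -i* (\sum_i v i * b i) : C)%C <=
    Num.sqrt (\sum_i v i ^+ 2).
  by rewrite cabs_def/= sqrrN ler_wsqrtr// bessel2.
have -> : pairing (fun i => (a i -i* b i)%C) w =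
  ((\sum_i x i * a i) -i* (\sum_i x i * b i))%C +
  ((0 +i* 1)%C : C) * ((\sum_i y i * a i) -i* (\sum_i y i * b i))%C.
  rewrite /pairing; apply/eqP; rewrite eq_complex; apply/andP; split; apply/eqP.
    rewrite Re_sum/= mul0r mul1r opprK add0r -big_split/=; apply: eq_bigr => i _.
    by rewrite (ReIm_mul _ _).1/=; rewrite /x /y; ring.
  rewrite Im_sum/= mul0r mul1r add0r -sumrN -big_split/=; apply: eq_bigr => i _.
  by rewrite (ReIm_mul _ _).2/=; rewrite /x /y; ring.
rewrite ler_pXn2r// ?nnegrE ?cabs_ge0 ?addr_ge0 ?sqrtr_ge0//.
apply: le_trans (cabsD _ _) _; apply: lerD; first exact: U.
rewrite cabsM.
have -> : cabs ((0 +i* 1)%C : C) = 1 by rewrite cabs_def/= expr0n/= add0r expr1n sqrtr1.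
by rewrite mul1r; exact: U.
Qed.

(** The pair of normalized real and imaginary parts of the aligned vector is a
    supporting functional: the Lie norm is a maximum of moduli of linear
    forms. *)
Lemma lie_support z : z != 0 -> exists c : 'I_M -> C,
  (forall w, cabs (pairing c w) ^+ 2 <= lie2 w) /\ cabs (pairing c z) ^+ 2 = lie2 z.
Proof.
move=> z0; have [u u1 [X0 BA _ E]] := lie_align z.
set w := u *: z in X0 BA E.
have u0 : u != 0 by rewrite -cabs_gt0 u1.
have w0 : 0 < nsq w by rewrite nsq_gt0// scaler_eq0 negb_or u0.
have B0 : 0 <= B w by apply: sumr_ge0 => i _; exact: sqr_ge0.
have A0 : 0 < A w by move: w0; rewrite nsqE; lra.
set p := Num.sqrt (A w) in E; set q := Num.sqrt (B w) in E.
have p0 : 0 < p by rewrite sqrtr_gt0.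
have pA : A w = p ^+ 2 by rewrite sqr_sqrtr// ltW.
have qB : B w = q ^+ 2 by rewrite sqr_sqrtr.
pose a i := Rp (w 0 i) / p; pose b i := Ip (w 0 i) / q.
exists (fun i => (a i -i* b i)%C).
have ab : \sum_i a i * b i = 0.
  transitivity (X w / (p * q)); last by rewrite X0 mul0r.
  rewrite /X mulr_suml; apply: eq_bigr => i _.
  by rewrite /a /b invfM; ring.
have qq : q ^+ 2 / q = q.
  by have [->|q0] := eqVneq q 0; rewrite ?expr0n ?mul0r// expr2 mulfK.
split.
  move=> v; apply: cabs_pairing_le => //.
    under eq_bigr do rewrite exprMn; rewrite -mulr_suml -/(A w) pA -exprMn.
    by rewrite divff ?gt_eqF// expr1n.
  under eq_bigr do rewrite exprMn; rewrite -mulr_suml -/(B w) qB -exprMn.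
  have [->|q0] := eqVneq q 0; first by rewrite mul0r expr0n.
  by rewrite divff// expr1n.
rewrite -[cabs _]mul1r -u1 -cabsM -pairingZ -/w E; congr (_ ^+ 2).
have -> : pairing (fun i => (a i -i* b i)%C) w = (((p + q)%:C)%C : C).
  rewrite /pairing; apply/eqP; rewrite eq_complex; apply/andP; split; apply/eqP.
    rewrite Re_sum/=.
    have -> : p + q = A w / p + B w / q.
      by rewrite pA qB qq expr2 mulfK// gt_eqF.
    rewrite /A /B !mulr_suml -big_split; apply: eq_bigr => i _.
    by rewrite (ReIm_mul _ _).1/= /a /b /=; ring.
  rewrite Im_sum/=.
  transitivity (X w / p - X w / q); last by rewrite X0 !mul0r subrr.
  rewrite /X !mulr_suml -sumrB; apply: eq_bigr => i _.
  by rewrite (ReIm_mul _ _).2/= /a /b /=; ring.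
by rewrite cabs_real ger0_norm// addr_ge0// ?sqrtr_ge0// ltW.
Qed.

Lemma expR_lnlie z : z != 0 -> expR (lnlie z) ^+ 2 = lie2 z.
Proof.
by move=> z0; rewrite -expRM_natl /lnlie mulrC divfK// lnK// posrE lie2_gt0.
Qed.

Lemma continuous_lnlie (T : topologicalType) (f : T -> 'rV[C]_M) (p : T) :
  f p != 0 ->
  (forall i, {for p, continuous (fun x => Rp (f x 0 i))}) ->
  (forall i, {for p, continuous (fun x => Ip (f x 0 i))}) ->
  {for p, continuous (fun x => lnlie (f x))}.
Proof.
move=> fp cR cI.
have csum (I : finType) (g : I -> T -> R) : (forall i, {for p, continuous (g i)}) ->
    {for p, continuous (fun x => \sum_i g i x)}.
  move=> H; elim: (index_enum I) => [|i r IH].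
    rewrite (_ : (fun x => _) = fun=> 0); first exact: cvg_cst.
    by apply/funext => x; rewrite big_nil.
  rewrite (_ : (fun x => _) = fun x => g i x + \sum_(j <- r) g j x).
    by apply: cvgD => //; exact: H.
  by apply/funext => x; rewrite big_cons.
have csq (g : T -> R) : {for p, continuous g} -> {for p, continuous (fun x => g x ^+ 2)}.
  move=> H; rewrite (_ : (fun x => _) = fun x => g x * g x); first exact: cvgM.
  by apply/funext => x; rewrite expr2.
have cn : {for p, continuous (fun x => nsq (f x))}.
  rewrite (_ : (fun x => _) = fun x => \sum_i (Rp (f x 0 i) ^+ 2 + Ip (f x 0 i) ^+ 2)).
    by apply: (csum _) => i; apply: cvgD; apply: (csq _).
  by apply/funext => x; apply: eq_bigr => i _; rewrite sqr_cabs.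
have cd : {for p, continuous (fun x => cabs (dsq (f x)) ^+ 2)}.
  rewrite (_ : (fun x => _) = fun x => (A (f x) - B (f x)) ^+ 2 + (2 * X (f x)) ^+ 2).
    have cA : {for p, continuous (fun x => A (f x))}.
      by apply: (csum _ (fun i x => Rp (f x 0 i) ^+ 2)) => i; apply: (csq _).
    have cB : {for p, continuous (fun x => B (f x))}.
      by apply: (csum _ (fun i x => Ip (f x 0 i) ^+ 2)) => i; apply: (csq _).
    have cX : {for p, continuous (fun x => X (f x))}.
      by apply: (csum _ (fun i x => Rp (f x 0 i) * Ip (f x 0 i))) => i; apply: cvgM;
        [exact: cR|exact: cI].
    apply: cvgD; apply: (csq _); first exact: cvgB.
    by apply: cvgM => //; exact: cvg_cst.
  by apply/funext => x; rewrite sqr_cabs (dsqE _).1 (dsqE _).2.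
rewrite /lnlie /continuous_at; apply: cvgM; last exact: cvg_cst.
apply: (@continuous_comp _ _ _ (fun x => lie2 (f x)) (@ln R)); last first.
  by apply: continuous_ln; rewrite lie2_gt0.
apply: cvgD => //.
apply: (@continuous_comp _ _ _ (fun x => nsq (f x) ^+ 2 - cabs (dsq (f x)) ^+ 2)
  (@Num.sqrt R)); last exact: sqrt_continuous.
by apply: cvgB => //; apply: (csq _).
Qed.

(** The logarithm of the Lie norm of a holomorphic vector is subharmonic, being
    a supremum of logarithms of holomorphic functions. *)
Lemma lnlie_submean (Z : C -> 'rV[C]_M) :
  (forall i (z : C), cabs z <= 1 -> cderivable (fun x => Z x 0 i) z) ->
  (forall z : C, cabs z <= 1 -> Z z != 0) ->
  2 * pi * lnlie (Z 0) <= iint 0 (2 * pi) (fun t => lnlie (Z (expi t))).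
Proof.
move=> D Z0; have Z00 : Z 0 != 0 by apply: Z0; rewrite cabs0.
have [c [cle ceq]] := lie_support Z00.
pose F x := pairing c (Z x).
have eF : lnlie (Z 0) = ln (cabs (F 0)).
  rewrite /lnlie -ceq lnXn ?cabs_gt0//; first by rewrite -[_ *+ 2]mulr_natr mulfK.
  by rewrite -cabs_eq0 -sqrf_eq0 ceq gt_eqF// lie2_gt0.
rewrite eF; apply: log_submean.
- move=> z hz; apply: cderivable_sum => i; apply: cderivableM; first exact: D.
  exact: cderivable_cst.
- by rewrite -cabs_eq0 -sqrf_eq0 ceq gt_eqF// lie2_gt0.
- move=> t; apply: continuous_lnlie => [|i|i].
  + by apply: Z0; rewrite cabs_expi.
  + by apply: (continuous_expi_comp (F := fun x => Z x 0 i) _).1; apply: D; rewrite cabs_expi.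
  + by apply: (continuous_expi_comp (F := fun x => Z x 0 i) _).2; apply: D; rewrite cabs_expi.
- by move=> t; rewrite expiD expi_2pi mulr1.
- move=> t; rewrite -(@ler_pXn2r _ 2) ?nnegrE ?cabs_ge0 ?expR_ge0//.
  by rewrite expR_lnlie ?cle// Z0// cabs_expi.
Qed.

End LieNorm.

(** * The maximum principle on the disc *)
Section SubharmonicMaximum.
Context {R : realType}.
Local Notation C := (cplx R).
Implicit Types (v : C -> \bar R).

Lemma continuous_expi : continuous (expi : R -> C).
Proof.
move=> t; apply: continuous_cplx; [exact: continuous_cos|exact: continuous_sin].
Qed.

Lemma compact_disc (r : R) : compact [set z : C | cabs z <= r].
Proof.
pose f (p : R * R) : C := (p.1 +i* p.2)%C.
have cf : continuous f.
  move=> p; apply: continuous_cplx; [exact: cvg_fst|exact: cvg_snd].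
pose g (p : R * R) := p.1 ^+ 2 + p.2 ^+ 2.
have cg : continuous g.
  move=> p; rewrite /continuous_at /g.
  by under eq_fun do rewrite !expr2; apply: cvgD; apply: cvgM;
    [exact: cvg_fst|exact: cvg_fst|exact: cvg_snd|exact: cvg_snd].
have [r0|r0] := leP 0 r; last first.
  rewrite (_ : [set _ | _] = set0); first exact: compact0.
  rewrite -subset0 => z /= hz; have := cabs_ge0 z.
  by rewrite leNgt (le_lt_trans hz r0).
pose K := (`[-r, r]%classic `*` `[-r, r]%classic) `&` g @^-1` [set x | x <= r ^+ 2].
have cK : compact K.
  apply: compact_closedI; last by apply: preimage_closed => //; exact: closed_le.
  by apply: compact_setX; exact: segment_compact.
have -> : [set z : C | cabs z <= r] = f @` K.
  apply/seteqP; split => z /=.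
    move=> hz; exists (complex.Re (z : R[i]), complex.Im (z : R[i])); last by case: z {hz}.
    split; last by rewrite /g/= -sqr_cabs ler_pXn2r ?nnegrE ?cabs_ge0.
    by split; rewrite /= in_itv/= -ler_norml; apply: le_trans hz;
      [exact: Re_le_cabs|exact: Im_le_cabs].
  move=> [[x y] [_ /=]]; rewrite /g/= => h <-.
  by rewrite -(@ler_pXn2r _ 2) ?nnegrE ?cabs_ge0// sqr_cabs.
by apply: continuous_compact => //; exact: continuous_subspaceT.
Qed.

Definition usc v := forall z (t : R), (v z < t%:E)%E ->
  \forall z' \near z, (v z' < t%:E)%E.

Lemma between_ereal (x S : \bar R) : (x < S)%E -> exists r : R, (x < r%:E)%E /\ (r%:E < S)%E.
Proof.
case: x => [x| |]; case: S => [s| |]//=.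
- rewrite lte_fin => xs; exists ((x + s) / 2); rewrite !lte_fin.
  by split; rewrite midf_lt.
- by move=> _; exists (x + 1); rewrite lte_fin ltrDl ltry.
- by move=> _; exists (s - 1); rewrite lte_fin ltrBlDr ltrDl ltNyr.
- by move=> _; exists 0; rewrite ltry ltNyr.
Qed.

(** The levels below the supremum form a filter; if the supremum were not
    attained, compactness would provide one such level above all the values. *)
Lemma usc_max v (K : set C) : compact K -> K !=set0 -> usc v ->
  exists2 p, K p & forall z, K z -> (v z <= v p)%E.
Proof.
move=> cK [k0 K0] u; apply: contrapT => no.
set S := ereal_sup (v @` K).
have vS z : K z -> (v z < S)%E.
  move=> Kz; rewrite lt_neqAle; apply/andP; split; last by apply: ereal_sup_ubound; exists z.
  apply/eqP => E; apply: no; exists z => // z' Kz'; rewrite E.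
  by apply: ereal_sup_ubound; exists z'.
pose F : set_system R := [set A | exists2 r : R, (r%:E < S)%E &
  forall t, r < t -> (t%:E < S)%E -> A t].
have FF : Filter F.
  split.
  - by have [r [_ rS]] := between_ereal (vS _ K0); exists r.
  - move=> P Q [r1 h1 H1] [r2 h2 H2]; exists (Num.max r1 r2).
      by rewrite /Num.max; case: ifP.
    by move=> t; rewrite gt_max => /andP[a b] tS; split; [exact: H1|exact: H2].
  - by move=> P Q PQ [r h H]; exists r => // t rt tS; exact/PQ/H.
have /compact_near_coveringP N := cK.
have := N R F (fun t p => (v p < t%:E)%E) FF.
have H0 : forall x, K x -> \forall x' \near x & i \near F, (v x' < i%:E)%E.
  move=> x Kx; have [r [xr rS]] := between_ereal (vS _ Kx).
  exists ([set x' | (v x' < r%:E)%E], [set t | r < t]) => /=.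
    by split; [exact: u|exists r].
  by move=> [x' t] [/= a b]; apply: lt_trans a _; rewrite lte_fin.
move=> /(_ H0) [r rS H].
have [t [rt tS]] := between_ereal rS.
have := H t; rewrite -lte_fin => /(_ rt tS) Kt.
have [s [ts sS]] := between_ereal tS.
move: tS; apply/negP; rewrite -leNgt; apply: ge_ereal_sup => _ [z Kz <-].
exact/ltW/Kt.
Qed.

(** No sign and no integrability are available for subharmonic functions, so
    the positive and negative parts are compared separately. *)
Lemma le_integral_measurable (D : set R) (f g : R -> \bar R) :
  measurable D -> measurable_fun D f -> measurable_fun D g ->
  (forall x, D x -> (f x <= g x)%E) ->
  (\int[@lebesgue_measure R]_(x in D) f x <= \int[@lebesgue_measure R]_(x in D) g x)%E.
Proof.
move=> mD mf mg fg; rewrite integralE [leRHS]integralE.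
have fg' : {in D, forall x, (f x <= g x)%E} by move=> x /set_mem; exact: fg.
apply: leeB; apply: ge0_le_integral => //; try exact: measurable_funepos;
  try exact: measurable_funeneg.
- by move=> x /mem_set; exact: funepos_le.
- by move=> x /mem_set; exact: funeneg_le.
Qed.

Definition circle_submean v := forall a b : C,
  ((2 * pi)%:E * v a <= \int[@lebesgue_measure R]_(t in `[0%R, (2 * pi)%R])
     v (a + expi t * b)%R)%E.

(** At an interior maximum [p] the circle about [p] that touches the unit circle
    meets the region where [v <= M], which contradicts the mean inequality. *)
Lemma disc_maximum v (M : R) : (forall z, v z < +oo)%E -> usc v ->
  circle_submean v -> (forall z, cabs z = 1 -> (v z <= M%:E)%E) ->
  forall z, cabs z <= 1 -> (v z <= M%:E)%E.
Proof.
move=> vfin u sm vM z0 hz0; rewrite leNgt; apply/negP => Mv.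
have [p /= Kp pmax] := @usc_max v _ (@compact_disc 1)
  (ex_intro _ z0 hz0) u.
have Mp : (M%:E < v p)%E by apply: lt_le_trans Mv _; exact: pmax.
have p1 : cabs p < 1.
  rewrite lt_neqAle Kp andbT; apply/eqP => /vM; apply/negP; by rewrite -ltNge.
have [m Em] : exists m : R, v p = m%:E.
  by move: Mp (vfin p); case: (v p) => // m _ _; exists m.
rewrite Em lte_fin in Mp.
pose c := (M + m) / 2.
have [Mc cm] : M < c /\ c < m by rewrite /c; split; lra.
have [w w1 wp] : exists2 w : C, cabs w = 1 & cabs (p + ((1 - cabs p)%:C)%C * w) = 1.
  have [->|pn0] := eqVneq p 0.
    by exists 1; rewrite ?cabs1// cabs0 subr0 add0r mulr1 cabs1.
  have cp : 0 < cabs p by rewrite cabs_gt0.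
  have E : p = ((cabs p)%:C)%C * (p * (((cabs p)^-1)%:C)%C) :> C.
    rewrite mulrCA -(rmorphM (real_complex R)) divff ?gt_eqF// mulr1//.
  exists (p * (((cabs p)^-1)%:C)%C).
    by rewrite cabsM cabs_real ger0_norm ?invr_ge0 ?ltW// divff// gt_eqF.
  rewrite {1}E -mulrDl -(rmorphD (real_complex R)) addrC subrK mul1r.
  by rewrite cabsM cabs_real ger0_norm ?invr_ge0 ?ltW// divff// gt_eqF.
set b : C := ((1 - cabs p)%:C)%C * w.
pose f t := v (p + expi t * b).
have cb : cabs b = 1 - cabs p.
  by rewrite cabsM w1 mulr1 cabs_real ger0_norm// subr_ge0.
have fm t : (f t <= m%:E)%E.
  rewrite -Em; apply: pmax => /=; apply: le_trans (cabsD _ _) _.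
  by rewrite cabsM cabs_expi mul1r cb addrC subrK.
have cc : continuous (fun t => p + expi t * b).
  move=> t; apply: cvgD; first exact: cvg_cst.
  by apply: cvgM; [exact: continuous_expi|exact: cvg_cst].
have uf t (r : R) : (f t < r%:E)%E -> \forall t' \near t, (f t' < r%:E)%E.
  by move=> /u h; exact: (cc t _ h).
have mf : measurable_fun setT f.
  have : measurable_fun setT (fun t => - f t)%E.
    apply: lower_semicontinuous_measurable => t r.
    rewrite lteNr -EFinN => /uf h; exists [set t' | (f t' < (- r)%:E)%E] => // t' /=.
    by rewrite lteNr -EFinN.
  move=> mN; rewrite (_ : f = fun t => - - f t)%E; first exact: measurableT_comp mN.
  by apply/funext => t; rewrite oppeK.
have [d d0 hd] : exists2 d : R, 0 < d & forall t, 0 <= t <= d -> (f t < c%:E)%E.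
  have f0 : (f 0%R < c%:E)%E.
    rewrite /f expi0 mul1r; apply: le_lt_trans (vM _ wp) _.
    by rewrite lte_fin.
  have /nbhs_ballP[d /= d0 hd] := uf _ _ f0.
  exists (d / 2); first by rewrite divr_gt0.
  move=> t ht; apply: hd; rewrite /ball/= sub0r normrN ger0_norm; lra.
pose d' := Num.min d (2 * pi).
have pi0 : 0 < 2 * pi :> R by rewrite mulr_gt0// pi_gt0.
have d'0 : 0 < d' by rewrite lt_min d0.
pose g (t : R) := if t <= d' then c else m.
have mg : measurable_fun setT (EFin \o g).
  apply/measurable_EFinP; apply: measurable_fun_ifT => //.
  exact: measurable_fun_ler.
have fg t : `[0, 2 * pi]%classic t -> (f t <= (EFin \o g) t)%E.
  move=> /=; rewrite in_itv/= /g => /andP[t0 _]; case: ifP => // td.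
  by apply/ltW/hd; rewrite t0 (le_trans td)// ge_min lexx.
have := sm p b; rewrite Em -/f leNgt => /negP; apply.
apply: le_lt_trans (le_integral_measurable _ _ _ fg) _ => //.
- exact: measurable_funTS.
- exact: measurable_funTS.
have i0 : (@lebesgue_measure R).-integrable `[0, 2 * pi] (EFin \o g).
  apply: measurable_bounded_integrable => //.
  - by rewrite /= lebesgue_measure_itv/=; case: ifP => _; rewrite ?ltry.
  - by apply: measurable_funTS; apply/measurable_EFinP.
  - exists (`|c| + `|m|); split; first exact: num_real.
    move=> x hx t _; apply: le_trans (ltW hx); rewrite /g.
    by case: ifP; rewrite ?lerDl ?lerDr.
have ig (D : set R) : measurable D -> D `<=` `[0, 2 * pi]%classic ->
    (@lebesgue_measure R).-integrable D (EFin \o g).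
  by move=> mD sD; apply: integrableS i0.
have -> : (\int[@lebesgue_measure R]_(x in `[0%R, (2 * pi)%R]) (EFin \o g) x)%E =
    (iint 0 (2 * pi) g)%:E.
  by rewrite /iint /Rintegral fineK//; apply: integrable_fin_num => //; exact: ig.
rewrite lte_fin.
have -> : iint 0 (2 * pi) g = iint 0 d' g + iint d' (2 * pi) g.
  have := @Rintegral_itvB R g (BLeft 0) (BRight (2 * pi)) d' (ig _ _ _) _ _.
  rewrite !bnd_simp ltW// ge_min lexx orbT => /(_ _ _ isT isT) H.
  rewrite /iint -[LHS](subrK (\int[lebesgue_measure]_(t in `[0, d']) g t)) H// addrC.
  congr (_ + _); apply: Rintegral_itv_obnd_cbnd; apply: ig => //.
  by move=> t /=; rewrite !in_itv/= => /andP[/ltW h ->]; rewrite (le_trans (ltW d'0)).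
have -> : iint 0 d' g = c * d'.
  rewrite -[X in c * X]subr0 -(iint_cst c (ltW d'0)); apply: eq_Rintegral => t.
  by rewrite inE/= in_itv/= /g => /andP[_ ->].
have : iint d' (2 * pi) g <= m * (2 * pi - d').
  rewrite -(iint_cst m) ?ge_min ?lexx ?orbT//; apply: le_Rintegral => //.
  - by apply: ig => // t /=; rewrite !in_itv/= => /andP[h ->]; rewrite (le_trans (ltW d'0)).
  - exact/cont_on_integrable/cont_on_cst.
  - by move=> t _; rewrite /g; case: ifP => // _; exact: ltW.
move: (iint _ _ _) => I; nra.
Qed.

End SubharmonicMaximum.

(** * The Lie potential on the quadric *)
Section QuadricPotential.
Context {R : realType} {n : nat}.
Local Notation C := (cplx R).
Local Notation Cn := 'rV[C]_n.
Local Notation V := 'rV[C]_(n.+1 + 1).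
Local Notation Rp := (fun z : C => complex.Re (z : R[i])).
Local Notation Ip := (fun z : C => complex.Im (z : R[i])).

Lemma continuous_circle (a b : Cn) : continuous (fun t : R => a + expi t *: b).
Proof.
move=> t; apply: cvgD; first exact: cvg_cst.
by apply: cvgZr_tmp; exact: continuous_expi.
Qed.

Lemma psh_EFin (U : set Cn) (u : Cn -> R) :
  (forall w, U w -> {for w, continuous u}) ->
  (forall a b : Cn, (forall z : C, cabs z <= 1 -> U (a + z *: b)) ->
    2 * pi * u a <= iint 0 (2 * pi) (fun t => u (a + expi t *: b))) ->
  psh U (EFin \o u).
Proof.
move=> cu su; split.
- by move=> w _; exact: ltry.
- move=> w t Uw /=; rewrite lte_fin => h.
  have := cu w Uw => /cvgr_lt/(_ _ h).
  by apply: filterS => w' /=; rewrite lte_fin.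
- move=> a b H.
  have H' z : cabs z <= 1 -> U (a + z *: b) by rewrite -cabs_le1; exact: H.
  have ct : cont_on 0 (2 * pi) (fun t => u (a + expi t *: b)).
    move=> t _; apply: (@continuous_comp _ _ _ (fun t => a + expi t *: b) u).
      exact: continuous_circle.
    by apply: cu; apply: H'; rewrite cabs_expi.
  have -> : (\int[@lebesgue_measure R]_(t in `[0%R, (2 * pi)%R])
      (EFin \o u) (a + expi t *: b)%R)%E =
      (iint 0 (2 * pi) (fun t => u (a + expi t *: b)))%:E.
    by rewrite /iint /Rintegral fineK//; apply: integrable_fin_num => //; exact: cont_on_integrable.
  by rewrite /= -EFinM lee_fin; exact: su.
Qed.

Lemma log_normE (z : V) : log_norm z = ln (Num.sqrt (nsq z)).
Proof.
by rewrite /log_norm /nsq; congr (ln (Num.sqrt _)); apply: eq_bigr => i _; rewrite sqr_cabs.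
Qed.

Lemma log_normZ (u : C) (z : V) : u != 0 -> z != 0 ->
  log_norm (u *: z) = ln (cabs u) + log_norm z.
Proof.
move=> u0 z0; rewrite !log_normE nsqZ sqrtrM ?sqr_ge0// sqrtr_sqr ger0_norm ?cabs_ge0//.
by rewrite lnM ?posrE ?cabs_gt0// sqrtr_gt0 nsq_gt0.
Qed.

Lemma quadric_lsubmx (z : V) : quadric z -> lsubmx z != 0.
Proof.
move=> [z0 E]; apply: contra z0 => /eqP l0; apply/eqP.
rewrite -[z]hsubmxK l0.
have : rsubmx z 0 0 ^+ 2 = 0.
  by rewrite -E l0 big1// => i _; rewrite mxE expr0n.
move=> /eqP; rewrite sqrf_eq0 => /eqP r0.
have -> : rsubmx z = 0 by apply/matrixP => i j; rewrite !ord1 r0 mxE.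
by rewrite row_mx0.
Qed.

Lemma quadricZ (u : C) (z : V) : u != 0 -> quadric z -> quadric (u *: z).
Proof.
move=> u0 [z0 E]; split; first by rewrite scaler_eq0 negb_or u0.
have E' : dsq (lsubmx z) = rsubmx z 0 0 ^+ 2 by [].
rewrite -[LHS]/(dsq (lsubmx (u *: z))) !linearZ/= dsqZ E'.
by rewrite [X in _ = X ^+ 2]mxE exprMn.
Qed.

(** The logarithm of the Lie norm, normalized to vanish on the real sphere once
    [log_norm] is subtracted. *)
Definition lie_potential (z : V) : R := lnlie (lsubmx z) + ln (Num.sqrt 2).

Definition phi0 (z : V) : \bar R := (lie_potential z - log_norm z)%:E.

Lemma phi0_inv : function_on_quadric phi0.
Proof.
move=> z z' Qz [u u0 ->]; rewrite /phi0 /lie_potential linearZ/=.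
rewrite lnlieZ ?quadric_lsubmx// log_normZ//; last by case: Qz.
by congr EFin; ring.
Qed.

Lemma local_potential_phi0 s w :
  local_potential phi0 s w = (lie_potential (s w))%:E.
Proof. by rewrite /local_potential /phi0 -EFinD subrK. Qed.

Lemma iint_addc (f : R -> R) (c : R) : continuous f ->
  iint 0 (2 * pi) (fun t => f t + c) = iint 0 (2 * pi) f + 2 * pi * c.
Proof.
move=> cf; rewrite iintD//; last exact: cont_on_cst.
  by rewrite iint_cst ?mulr_ge0 ?pi_ge0// subr0 [c * _]mulrC.
by move=> t _; exact: cf.
Qed.

(** In a chart [phi0] plus the weight is, up to a constant, the logarithm of
    the Lie norm of a holomorphic vector. *)
Lemma phi0_psh : omega0_psh phi0.
Proof.
split; first exact: phi0_inv.
move=> U s [oU sU _ _].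
have -> : local_potential phi0 s = EFin \o (fun w => lie_potential (s w)).
  by apply/funext => w; rewrite local_potential_phi0.
have cs w : U w -> {for w, continuous s}.
  by move=> /sU[_ ds]; exact: differentiable_continuous.
apply: psh_EFin => [w Uw|a b H].
  suff : {for w, continuous (fun w => lnlie (lsubmx (s w)))}.
    move=> c; apply: (@continuousD _ _ _ (fun w => lnlie (lsubmx (s w)))
      (fun=> ln (Num.sqrt 2))) => //; exact: cst_continuous.
  have [Qs _] := sU w Uw.
  have cc i : {for w, continuous (fun w => (s w) 0 i)}.
    apply: (@continuous_comp _ _ _ s (fun A : V => A 0 i)); first exact: cs.
    exact: coord_continuous.
  apply: continuous_lnlie; first exact: quadric_lsubmx.
    move=> i; rewrite (_ : (fun x => _) = (Rp : C -> R) \o (fun w => s w 0 (lshift 1 i))).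
      by apply: continuous_comp; [exact: cc|exact: continuous_Re].
    by apply/funext => x; rewrite /= mxE.
  move=> i; rewrite (_ : (fun x => _) = (Ip : C -> R) \o (fun w => s w 0 (lshift 1 i))).
    by apply: continuous_comp; [exact: cc|exact: continuous_Im].
  by apply/funext => x; rewrite /= mxE.
have D i z : cabs z <= 1 ->
    cderivable (fun x => lsubmx (s (a + x *: b)) 0 i) z.
  move=> /H/sU[_ ds].
  have db : derivable s (a + z *: b) b by exact: diff_derivable.
  have := derivable_cderivable (lshift 1 i) db.
  rewrite (_ : (fun x => _) = (fun x => lsubmx (s (a + x *: b)) 0 i))//.
  by apply/funext => x; rewrite mxE.
have Z0 z : cabs z <= 1 -> lsubmx (s (a + z *: b)) != 0.
  by move=> /H/sU[Q _]; exact: quadric_lsubmx.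
have := lnlie_submean D Z0; rewrite scale0r addr0 => K.
have cf : continuous (fun t : R => lnlie (lsubmx (s (a + expi t *: b)))).
  move=> t; apply: (continuous_lnlie (f := fun t : R => lsubmx (s (a + expi t *: b)))
    (p := t)) => [|i|i].
  - by apply: Z0; rewrite cabs_expi.
  - apply: (continuous_expi_comp (F := fun x => lsubmx (s (a + x *: b)) 0 i) _).1.
    by apply: D; rewrite cabs_expi.
  - apply: (continuous_expi_comp (F := fun x => lsubmx (s (a + x *: b)) 0 i) _).2.
    by apply: D; rewrite cabs_expi.
rewrite /lie_potential (iint_addc _ cf).
by rewrite [_ * (lnlie _ + _)]mulrDr lerD2r.
Qed.

Lemma nsq_row_mx (M N : nat) (x : 'rV[C]_M) (y : 'rV[C]_N) :
  nsq (row_mx x y) = nsq x + nsq y.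
Proof.
rewrite /nsq big_split_ord/=; congr (_ + _); apply: eq_bigr => i _.
  by rewrite row_mxEl.
by rewrite row_mxEr.
Qed.

Lemma nsq_real (x : 'rV[R]_n.+1) :
  nsq (map_mx (fun t : R => t%:C%C : C) x) = \sum_i x 0 i ^+ 2.
Proof.
by rewrite /nsq; apply: eq_bigr => i _; rewrite mxE cabs_real real_normK ?num_real.
Qed.

Lemma dsq_real (x : 'rV[R]_n.+1) :
  dsq (map_mx (fun t : R => t%:C%C : C) x) = ((\sum_i x 0 i ^+ 2)%:C)%C.
Proof.
rewrite /dsq rmorph_sum; apply: eq_bigr => i _; rewrite mxE.
by rewrite (rmorphXn (real_complex R)).
Qed.

Lemma embed_quadric (x : 'rV[R]_n.+1) : sphere x -> quadric (embed x).
Proof.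
move=> sx; split; last first.
  rewrite row_mxKl row_mxKr mxE expr1n.
  by have := dsq_real x; rewrite /dsq => ->; rewrite sx.
apply/eqP => /(congr1 rsubmx); rewrite row_mxKr => /matrixP/(_ 0 0).
by rewrite !mxE => /eqP; rewrite oner_eq0.
Qed.

Lemma log_norm_embed (x : 'rV[R]_n.+1) : sphere x -> log_norm (embed x) = ln (Num.sqrt 2).
Proof.
move=> sx; rewrite log_normE nsq_row_mx nsq_real sx.
by rewrite /nsq big_ord1 mxE cabs1 expr1n.
Qed.

Lemma phi0_embed (x : 'rV[R]_n.+1) : sphere x -> phi0 (embed x) = 0%E.
Proof.
move=> sx; rewrite /phi0 /lie_potential log_norm_embed// addrK row_mxKl.
rewrite /lnlie /lie2 nsq_real dsq_real sx cabs_real normr1 expr1n subrr sqrtr0 addr0.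
by rewrite ln1 mul0r.
Qed.

Lemma phi0_le_phi_sup z : (phi0 z <= phi_sup z)%E.
Proof.
apply: ereal_sup_ubound; exists phi0 => //; split; first exact: phi0_psh.
by move=> x sx; rewrite phi0_embed.
Qed.

End QuadricPotential.

(** * Orthogonal matrices *)
Section Reflections.
Context {R : realType} {N : nat}.
Implicit Types (x y u : 'rV[R]_N) (h : 'M[R]_N).

Definition dot x y : R := \sum_i x 0 i * y 0 i.

Lemma dotE x y : (x *m y^T) 0 0 = dot x y.
Proof. by rewrite mxE; apply: eq_bigr => i _; rewrite mxE. Qed.

Lemma dotC x y : dot x y = dot y x.
Proof. by apply: eq_bigr => i _; rewrite mulrC. Qed.

Lemma dotBl x y u : dot (x - y) u = dot x u - dot y u.
Proof. by rewrite /dot -sumrB; apply: eq_bigr => i _; rewrite !mxE mulrBl. Qed.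

Lemma dotBr x y u : dot u (x - y) = dot u x - dot u y.
Proof. by rewrite dotC dotBl !(dotC u). Qed.

Lemma dotZl c x y : dot (c *: x) y = c * dot x y.
Proof. by rewrite /dot mulr_sumr; apply: eq_bigr => i _; rewrite mxE mulrA. Qed.

Lemma dotZr c x y : dot x (c *: y) = c * dot x y.
Proof. by rewrite dotC dotZl dotC. Qed.

Lemma dotDl x y u : dot (x + y) u = dot x u + dot y u.
Proof. by rewrite /dot -big_split; apply: eq_bigr => i _; rewrite !mxE mulrDl. Qed.

Lemma dotDr x y u : dot u (x + y) = dot u x + dot u y.
Proof. by rewrite dotC dotDl !(dotC u). Qed.

Lemma dot_sqr x : dot x x = \sum_i x 0 i ^+ 2.
Proof. by apply: eq_bigr => i _; rewrite expr2. Qed.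

Lemma dot_ge0 x : 0 <= dot x x.
Proof. by rewrite dot_sqr; apply: sumr_ge0 => i _; exact: sqr_ge0. Qed.

Lemma dot_eq0 x : (dot x x == 0) = (x == 0).
Proof.
apply/eqP/eqP => [|->]; last by rewrite /dot big1// => i _; rewrite mxE mul0r.
rewrite dot_sqr => /psumr_eq0P H; apply/rowP => i; rewrite mxE.
by have := H (fun i _ => sqr_ge0 _) i isT => /eqP; rewrite sqrf_eq0 => /eqP.
Qed.

Definition ortho h := h *m h^T = 1%:M.

Lemma ortho_tr h : ortho h -> ortho h^T.
Proof. by rewrite /ortho trmxK => /mulmx1C. Qed.

Lemma orthoM h k : ortho h -> ortho k -> ortho (h *m k).
Proof. by rewrite /ortho trmx_mul mulmxA -(mulmxA h) => H ->; rewrite mulmx1. Qed.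

Lemma ortho_dot h x y : ortho h -> dot (x *m h) (y *m h) = dot x y.
Proof. by move=> H; rewrite -!dotE trmx_mul mulmxA -(mulmxA x) H mulmx1. Qed.

Definition refl u : 'M[R]_N := 1%:M - (2 / dot u u) *: (u^T *m u).

Lemma mul_refl u x : x *m refl u = x - (2 * dot x u / dot u u) *: u.
Proof.
rewrite /refl mulmxBr mulmx1 -scalemxAr mulmxA; congr (_ - _).
rewrite [x *m u^T]mx11_scalar dotE mul_scalar_mx scalerA; congr (_ *: _).
by rewrite mulrAC.
Qed.

Lemma refl_tr u : (refl u)^T = refl u.
Proof. by rewrite /refl linearB/= linearZ/= trmx1 trmx_mul trmxK. Qed.

Lemma refl_ortho u : ortho (refl u).
Proof.
rewrite /ortho refl_tr; apply/row_matrixP => i.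
rewrite row_mul mul_refl [row i 1%:M]rowE mulmx1 [row i _]rowE mul_refl.
set x := delta_mx 0 i.
rewrite dotBl dotZl -addrA -opprD -scalerDl.
have [->|u0] := eqVneq (dot u u) 0; first by rewrite invr0 !mulr0 addr0 scale0r subr0.
have -> : 2 * dot x u / dot u u +
    2 * (dot x u - 2 * dot x u / dot u u * dot u u) / dot u u = 0 by field.
by rewrite scale0r subr0.
Qed.

Lemma refl_swap x y : dot x x = dot y y -> x *m refl (x - y) = y.
Proof.
move=> E; rewrite mul_refl.
have [/eqP|u0] := eqVneq (dot (x - y) (x - y)) 0.
  by rewrite dot_eq0 subr_eq0 => /eqP ->; rewrite subrr scaler0 subr0.
rewrite (_ : _ / _ = 1) ?scale1r ?subKr//.
have -> : 2 * dot x (x - y) = dot (x - y) (x - y).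
  by rewrite !dotBr !dotBl -E (dotC y x); ring.
by rewrite divff.
Qed.

Lemma refl_fix x u : dot x u = 0 -> x *m refl u = x.
Proof. by move=> E; rewrite mul_refl E mulr0 mul0r scale0r subr0. Qed.

End Reflections.

Lemma dot_delta (R : realType) (N : nat) (i j : 'I_N) :
  dot (delta_mx 0 i : 'rV[R]_N) (delta_mx 0 j) = (i == j)%:R.
Proof.
rewrite /dot (bigD1 i)//= big1 ?addr0; last first.
  by move=> k ki; rewrite !mxE (negbTE ki) mul0r.
by rewrite !mxE !eqxx mul1r.
Qed.

(** Two successive reflections carry the first two basis vectors to the
    directions of [x] and [y]. *)
Lemma ortho_frame (R : realType) (m : nat) (x y : 'rV[R]_m.+2) : x != 0 -> dot x y = 0 ->
  exists h : 'M[R]_m.+2, [/\ ortho h,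
    x = Num.sqrt (dot x x) *: row ord0 h &
    y = Num.sqrt (dot y y) *: row (lift ord0 ord0) h].
Proof.
move=> x0 xy.
have px : 0 < dot x x by rewrite lt_def dot_ge0 dot_eq0 x0.
set p := Num.sqrt (dot x x).
have p0 : 0 < p by rewrite sqrtr_gt0.
pose e0 : 'rV[R]_m.+2 := delta_mx 0 ord0.
pose e1 : 'rV[R]_m.+2 := delta_mx 0 (lift ord0 ord0).
pose a := p^-1 *: x.
have aa : dot a a = 1.
  rewrite dotZl dotZr; have -> : dot x x = p ^+ 2 by rewrite sqr_sqrtr// ltW.
  by field; rewrite gt_eqF.
have Ex : x = p *: a by rewrite scalerA divff ?gt_eqF// scale1r.
pose H1 := refl (e0 - a).
have E0 : e0 *m H1 = a by apply: refl_swap; rewrite aa dot_delta eqxx.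
have [->|y0] := eqVneq y 0.
  exists H1; split; first exact: refl_ortho.
    by rewrite rowE -/e0 E0.
  have -> : dot (0 : 'rV[R]_m.+2) 0 = 0 by apply/eqP; rewrite dot_eq0.
  by rewrite sqrtr0 scale0r.
have py : 0 < dot y y by rewrite lt_def dot_ge0 dot_eq0 y0.
set q := Num.sqrt (dot y y).
have q0 : 0 < q by rewrite sqrtr_gt0.
pose b := q^-1 *: y.
have bb : dot b b = 1.
  rewrite dotZl dotZr; have -> : dot y y = q ^+ 2 by rewrite sqr_sqrtr// ltW.
  by field; rewrite gt_eqF.
have Ey : y = q *: b by rewrite scalerA divff ?gt_eqF// scale1r.
have ab : dot a b = 0 by rewrite dotZl dotZr xy !mulr0.
pose b1 := b *m H1.
have H11 : H1 *m H1 = 1%:M by have := refl_ortho (e0 - a); rewrite /ortho refl_tr.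
have b1H : b1 *m H1 = b by rewrite -mulmxA H11 mulmx1.
have O1 : ortho H1 by exact: refl_ortho.
have e0b : dot e0 b1 = 0 by rewrite -(ortho_dot _ _ O1) E0 b1H.
pose H2 := refl (e1 - b1).
have F1 : e1 *m H2 = b1.
  by apply: refl_swap; rewrite dot_delta eqxx /b1 ortho_dot// bb.
have F0 : e0 *m H2 = e0 by apply: refl_fix; rewrite dotBr e0b dot_delta subr0.
exists (H2 *m H1); split; first exact: (orthoM (refl_ortho _) O1).
  by rewrite rowE mulmxA -/e0 F0 E0.
by rewrite rowE mulmxA -/e1 F1 b1H.
Qed.

Section RealRotations.
Context {R : realType} {N : nat}.
Local Notation C := (cplx R).
Local Notation Rp := (fun z : C => complex.Re (z : R[i])).
Local Notation Ip := (fun z : C => complex.Im (z : R[i])).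
Implicit Types (h : 'M[R]_N) (z : 'rV[C]_N).

Definition toCmx h : 'M[C]_N := map_mx (fun t : R => t%:C%C : C) h.

Lemma toCmxM h k : toCmx (h *m k) = toCmx h *m toCmx k.
Proof. exact: (map_mxM (real_complex R)). Qed.

Lemma toCmx_ortho h : ortho h -> toCmx h *m toCmx h^T = 1%:M.
Proof. by move=> H; rewrite -toCmxM H; exact: (map_mx1 (real_complex R)). Qed.

Lemma dsq_ortho h z : ortho h -> dsq (z *m toCmx h) = dsq z.
Proof.
move=> H; have E (w : 'rV[C]_N) : dsq w = (w *m w^T) 0 0.
  by rewrite mxE; apply: eq_bigr => i _; rewrite mxE expr2.
rewrite !E trmx_mul mulmxA -(mulmxA z) {2}/toCmx map_trmx.
by rewrite -/(toCmx h^T) (toCmx_ortho H) mulmx1.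
Qed.

Lemma nsq_ReIm z : nsq z = dot (map_mx Rp z) (map_mx Rp z) + dot (map_mx Ip z) (map_mx Ip z).
Proof.
by rewrite nsqE !dot_sqr; congr (_ + _); apply: eq_bigr => i _; rewrite mxE.
Qed.

Lemma nsq_ortho h z : ortho h -> nsq (z *m toCmx h) = nsq z.
Proof.
move=> H; rewrite !nsq_ReIm.
have -> : map_mx Rp (z *m toCmx h) = map_mx Rp z *m h.
  apply/rowP => i; rewrite !mxE Re_sum; apply: eq_bigr => j _.
  by rewrite (ReIm_mul _ _).1 !mxE/= mulr0 subr0.
have -> : map_mx Ip (z *m toCmx h) = map_mx Ip z *m h.
  apply/rowP => i; rewrite !mxE Im_sum; apply: eq_bigr => j _.
  by rewrite (ReIm_mul _ _).2 !mxE/= mulr0 add0r.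
by rewrite !ortho_dot.
Qed.

Lemma lie2_ortho h z : ortho h -> lie2 (z *m toCmx h) = lie2 z.
Proof. by move=> H; rewrite /lie2 nsq_ortho// dsq_ortho. Qed.

Lemma lnlie_ortho h z : ortho h -> lnlie (z *m toCmx h) = lnlie z.
Proof. by move=> H; rewrite /lnlie lie2_ortho. Qed.

End RealRotations.

(** * A polynomial chart *)
Section Chart.
Context {R : realType} {m : nat}.
Local Notation C := (cplx R).
Local Notation W := 'rV[C]_m.+1.
Local Notation V := 'rV[C]_(m.+2 + 1).
Local Notation Rp := (fun z : C => complex.Re (z : R[i])).
Local Notation Ip := (fun z : C => complex.Im (z : R[i])).
Implicit Types (h : 'M[R]_m.+2) (w : W) (z : V).

Let i1 : 'I_m.+2 := lift ord0 ord0.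
Let half : C := ((2^-1 : R)%:C)%C.
Let mi2 : C := (0 +i* (- 2^-1))%C.
Let ii : C := (0 +i* 1)%C.

Definition qform w : C := w 0 0 ^+ 2 - \sum_(k < m) w 0 (lift ord0 k) ^+ 2.

Definition tcoord w (i : 'I_m.+2) : C :=
  if unlift ord0 i is Some j then
    if unlift ord0 j is Some k then w 0 (lift ord0 k) else (qform w - 1) * mi2
  else (qform w + 1) * half.

Definition tvec w : 'rV[C]_m.+2 := \row_i tcoord w i.

(** The chart [w |-> (t h, w_0)] of the quadric, where [t_0 - i t_1 = 1]. *)
Definition qchart h w : V := row_mx (tvec w *m toCmx h) (const_mx (w 0 0)).

Lemma tcoord0 w : tcoord w ord0 = (qform w + 1) * half.
Proof. by rewrite /tcoord unlift_none. Qed.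

Lemma tcoord1 w : tcoord w i1 = (qform w - 1) * mi2.
Proof. by rewrite /tcoord liftK unlift_none. Qed.

Lemma tcoord2 w (k : 'I_m) : tcoord w (lift ord0 (lift ord0 k)) = w 0 (lift ord0 k).
Proof. by rewrite /tcoord !liftK. Qed.

Lemma ord2_ind (P : 'I_m.+2 -> Prop) : P ord0 -> P i1 ->
  (forall k : 'I_m, P (lift ord0 (lift ord0 k))) -> forall i, P i.
Proof.
move=> P0 P1 P2 i; case: (unliftP ord0 i) => [j ->|->] //.
by case: (unliftP ord0 j) => [k ->|->].
Qed.

Lemma sum_tcoord (T : nmodType) (F : C -> T) w :
  \sum_i F (tvec w 0 i) = F ((qform w + 1) * half) +
   (F ((qform w - 1) * mi2) + \sum_(k < m) F (w 0 (lift ord0 k))).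
Proof.
rewrite big_ord_recl big_ord_recl !mxE tcoord0 tcoord1; do 2 congr (_ + _).
by apply: eq_bigr => k _; rewrite mxE tcoord2.
Qed.

Lemma complex_consts : [/\ half + half = 1, ii * mi2 = half, ii * ii = -1 & mi2 * mi2 = - (half * half)].
Proof.
rewrite /half /ii /mi2; split; apply/eqP; rewrite eq_complex/=; apply/andP; split;
  apply/eqP; lra.
Qed.

Lemma dsq_tvec w : dsq (tvec w) = w 0 0 ^+ 2.
Proof.
rewrite /dsq (sum_tcoord (fun x => x ^+ 2)).
have [h1 _ _ h2] := complex_consts.
rewrite !exprMn; have -> : mi2 ^+ 2 = - half ^+ 2 by rewrite !expr2.
set q := qform w; set S := \sum_(k < m) _.
have -> : (q + 1) ^+ 2 * half ^+ 2 + ((q - 1) ^+ 2 * - half ^+ 2 + S) =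
  q * (half + half) ^+ 2 + S by ring.
by rewrite h1 expr1n mulr1 /q /qform subrK.
Qed.

Definition yvec h z : 'rV[C]_m.+2 := lsubmx z *m toCmx h^T.

(** The linear form that is [1] on the image of [qchart h]; dividing a point
    of the cone by it selects the representative parametrized by the chart. *)
Definition ell h z : C := yvec h z 0 ord0 - ii * yvec h z 0 i1.

Definition chart_inv h z : W :=
  \row_j if unlift ord0 j is Some k then yvec h z 0 (lift ord0 (lift ord0 k))
         else rsubmx z 0 0.

Lemma yvec_qchart h w : ortho h -> yvec h (qchart h w) = tvec w.
Proof. by move=> H; rewrite /yvec row_mxKl -mulmxA toCmx_ortho// mulmx1. Qed.

Lemma yvecK h z : ortho h -> yvec h z *m toCmx h = lsubmx z.
Proof.
move=> H; rewrite /yvec -mulmxA; have := toCmx_ortho (ortho_tr H).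
by rewrite trmxK => ->; rewrite mulmx1.
Qed.

Lemma ell_qchart h w : ortho h -> ell h (qchart h w) = 1.
Proof.
move=> H; rewrite /ell yvec_qchart// !mxE tcoord0 tcoord1.
have [h1 h2 _ _] := complex_consts.
rewrite [ii * (_ * _)]mulrCA h2 -mulrBl.
have -> : qform w + 1 - (qform w - 1) = 1 + 1 by ring.
by rewrite mulrDl !mul1r.
Qed.

Lemma chart_invK h w : ortho h -> chart_inv h (qchart h w) = w.
Proof.
move=> H; apply/rowP => j; rewrite mxE.
case: (unliftP ord0 j) => [k ->|->].
  by rewrite yvec_qchart// mxE tcoord2.
by rewrite row_mxKr mxE.
Qed.

Lemma ellZ h c z : ell h (c *: z) = c * ell h z.
Proof. by rewrite /ell /yvec linearZ/= -scalemxAl !mxE; ring. Qed.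

Lemma ellD h z z' : ell h (z + z') = ell h z + ell h z'.
Proof. by rewrite /ell /yvec linearD/= mulmxDl !mxE; ring. Qed.

Lemma quadric_qchart h w : ortho h -> quadric (qchart h w).
Proof.
move=> H; split.
  apply/eqP => E; have := ell_qchart w H; rewrite E.
  rewrite /ell /yvec linear0 mul0mx !mxE mulr0 subr0 => /eqP.
  by rewrite eq_sym oner_eq0.
rewrite -[LHS]/(dsq _) row_mxKl row_mxKr mxE dsq_ortho//; exact: dsq_tvec.
Qed.

Lemma qchart_surj h z : ortho h -> quadric z -> ell h z = 1 ->
  qchart h (chart_inv h z) = z.
Proof.
move=> H [z0 E] e1; have E' : dsq (lsubmx z) = rsubmx z 0 0 ^+ 2 by [].
set w := chart_inv h z.
have w0 : w 0 0 = rsubmx z 0 0 by rewrite /w mxE unlift_none.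
have wk k : w 0 (lift ord0 k) = yvec h z 0 (lift ord0 (lift ord0 k)).
  by rewrite /w mxE liftK.
have [h1 h2 h3 h4] := complex_consts.
set y := yvec h z in wk.
have Ey : dsq y = rsubmx z 0 0 ^+ 2.
  by rewrite /y /yvec dsq_ortho//; exact: ortho_tr.
have Eq : qform w = y 0 ord0 + ii * y 0 i1.
  have : y 0 ord0 ^+ 2 + y 0 i1 ^+ 2 = qform w.
    rewrite /qform w0 -Ey /dsq big_ord_recl big_ord_recl addrA -addrA -[LHS]addr0.
    rewrite -!addrA; congr (_ + (_ + _)); apply/eqP.
    rewrite eq_sym subr_eq0; apply/eqP; apply: eq_bigr => k _; by rewrite wk.
  move=> <-; have : ell h z = y 0 ord0 - ii * y 0 i1 by [].
  rewrite e1 => e2.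
  have -> : y 0 ord0 ^+ 2 + y 0 i1 ^+ 2 =
    (y 0 ord0 - ii * y 0 i1) * (y 0 ord0 + ii * y 0 i1)
     + (1 + ii * ii) * y 0 i1 ^+ 2 by ring.
  by rewrite h3 subrr mul0r addr0 -e2 mul1r.
have e2 : y 0 ord0 = 1 + ii * y 0 i1.
  have : ell h z = y 0 ord0 - ii * y 0 i1 by [].
  by rewrite e1 => ->; rewrite subrK.
have Et : tvec w = y.
  apply/rowP; apply: ord2_ind => [||k]; rewrite mxE.
  - rewrite tcoord0 Eq e2.
    have -> : (1 + ii * y 0 i1 + ii * y 0 i1 + 1) * half =
       (1 + ii * y 0 i1) * (half + half) by ring.
    by rewrite h1 mulr1.
  - rewrite tcoord1 Eq e2.
    have -> : (1 + ii * y 0 i1 + ii * y 0 i1 - 1) * mi2 =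
       (ii * mi2 + ii * mi2) * y 0 i1 by ring.
    by rewrite h2 h1 mul1r.
  - by rewrite tcoord2 wk.
rewrite /qchart Et /y yvecK// w0 -[RHS]hsubmxK; congr row_mx.
by apply/matrixP => i j; rewrite !ord1 mxE.
Qed.

Lemma same_point_qchart h z : ortho h -> quadric z -> ell h z != 0 ->
  same_point (qchart h (chart_inv h ((ell h z)^-1 *: z))) z.
Proof.
move=> H Qz e0; exists (ell h z) => //.
rewrite qchart_surj//; first by rewrite scalerA divff// scale1r.
  by apply: quadricZ => //; rewrite invr_eq0.
by rewrite ellZ mulVf.
Qed.

Lemma differentiable_row (n M : nat) (f : 'rV[C]_n -> 'rV[C]_M) (x : 'rV[C]_n) :
  (forall i, differentiable (fun y => f y 0 i) x) -> differentiable f x.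
Proof.
move=> H.
have -> : f = \sum_(i < M) (fun y => f y 0 i *: (delta_mx 0 i : 'rV[C]_M)).
  apply/funext => y; rewrite {1}[f y]row_sum_delta fct_sumE; apply: eq_bigr => i _ //.
apply: differentiable_sum => i; exact: differentiableZl.
Qed.

Lemma differentiable_fsum (n M : nat) (f : 'I_M -> 'rV[C]_n -> C) (x : 'rV[C]_n) :
  (forall i, differentiable (f i) x) -> differentiable (fun y => \sum_i f i y) x.
Proof.
move=> H; have -> : (fun y => \sum_i f i y) = \sum_i f i.
  by apply/funext => w; rewrite fct_sumE.
exact: differentiable_sum.
Qed.

Lemma differentiable_qchart h w : differentiable (qchart h) w.
Proof.
have dc (j : 'I_m.+1) : differentiable (fun w : W => w 0 j) w by exact: differentiable_coord.
have dsqr (j : 'I_m.+1) : differentiable (fun w : W => w 0 j ^+ 2) w.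
  rewrite (_ : (fun x => _) = (fun w : W => w 0 j * w 0 j)).
    exact: differentiableM.
  by apply/funext => x; rewrite expr2.
have dq : differentiable qform w.
  rewrite /qform; apply: differentiableB => //.
  by apply: differentiable_fsum => k.
have dt i : differentiable (fun w => tcoord w i) w.
  move: i; apply: ord2_ind => [||k].
  - under eq_fun do rewrite tcoord0.
    apply: differentiableM; last exact: differentiable_cst.
    by apply: differentiableD; [exact: dq|exact: differentiable_cst].
  - under eq_fun do rewrite tcoord1.
    apply: differentiableM; last exact: differentiable_cst.
    by apply: differentiableB; [exact: dq|exact: differentiable_cst].
  - by under eq_fun do rewrite tcoord2.
apply: differentiable_row => i; case: (split_ordP i) => j ->.
  rewrite (_ : (fun x => _) = fun w => \sum_l tcoord w l * toCmx h l j).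
    apply: differentiable_fsum => l.
    by apply: differentiableM; [exact: dt|exact: differentiable_cst].
  by apply/funext => x; rewrite row_mxEl mxE; apply: eq_bigr => l _; rewrite mxE.
rewrite (_ : (fun x => _) = fun w : W => w 0 0)//.
by apply/funext => x; rewrite row_mxEr mxE.
Qed.

Lemma continuous_fsum (K : numFieldType) (T : topologicalType) (M : nat)
  (f : 'I_M -> T -> K) (p : T) : (forall i, {for p, continuous (f i)}) ->
  {for p, continuous (fun x => \sum_i f i x)}.
Proof.
move=> H; elim: (index_enum _) => [|i r IH].
  rewrite (_ : (fun x => _) = fun=> 0); first exact: cvg_cst.
  by apply/funext => x; rewrite big_nil.
rewrite (_ : (fun x => _) = fun x => f i x + \sum_(j <- r) f j x).
  by apply: cvgD => //; exact: H.
by apply/funext => x; rewrite big_cons.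
Qed.

(** Derivatives of [qchart] are read off through linear forms [g] along which
    [qchart] is affine. *)
Lemma form_derive h w d (g : V -> C) (k : C) : continuous g ->
  (forall c z, g (c *: z) = c * g z) -> (forall y z, g (y - z) = g y - g z) ->
  (forall t : C, g (qchart h (t *: d + w)) - g (qchart h w) = t * k) ->
  g ('D_d (qchart h) w) = k.
Proof.
move=> cg gZ gB H.
have D : derivable (qchart h) w d by exact: diff_derivable (differentiable_qchart h w).
have L : (fun t : C => t^-1 *: ((qchart h \o shift w) (t *: d) - qchart h w)) @ 0^' -->
    'D_d (qchart h) w by exact: D.
have {L}K := cvg_comp _ _ L (cg _).
have K' : (fun t : C => g (t^-1 *: ((qchart h \o shift w) (t *: d) - qchart h w))) @ 0^' --> k.
  apply: (@cvg_trans _ ((fun=> k) @ (0 : C)^')); last exact: cvg_cst.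
  apply: near_eq_cvg; near=> t.
  rewrite gZ gB H mulrA mulVf ?mul1r//; near: t; exact: nbhs_dnbhs_neq.
exact: cvg_unique K K'.
Unshelve. all: by end_near. Qed.

Lemma qchart_chart h : ortho h -> chart [set: W] (qchart h).
Proof.
move=> H; split; first exact: openT.
- by move=> w _; split; [exact: quadric_qchart|exact: differentiable_qchart].
- move=> w _; apply: inj_row_free => v; rewrite -[v]hsubmxK mul_row_col.
  set a := lsubmx v; set d := rsubmx v.
  have -> : d *m 'J (qchart h) w = 'D_d (qchart h) w.
    by rewrite deriveE ?mul_rV_lin1//; exact: differentiable_qchart.
  rewrite [a]mx11_scalar mul_scalar_mx; set D := 'D_d _ _ => E.
  have cY (i : 'I_m.+2) : continuous (fun z => yvec h z 0 i).
    move=> z; rewrite (_ : (fun z => _) = fun z => \sum_l z 0 (lshift 1 l) * toCmx h^T l i).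
      apply: continuous_fsum => l.
      apply: (@continuousM _ _ (fun z : V => z 0 (lshift 1 l)) (fun=> toCmx h^T l i)).
        exact: coord_continuous.
      exact: cst_continuous.
    by apply/funext => y; rewrite mxE; apply: eq_bigr => l _; rewrite mxE.
  have eD : ell h D = 0.
    apply: form_derive.
    + move=> z; apply: (@continuousB _ _ _ (fun z => yvec h z 0 ord0)
        (fun z => ii * yvec h z 0 i1)); first exact: cY.
      apply: (@continuousM _ _ (fun=> ii) (fun z => yvec h z 0 i1)); last exact: cY.
      exact: cst_continuous.
    + exact: ellZ.
    + by move=> y z; rewrite /ell /yvec linearB/= mulmxBl !mxE; ring.
    + by move=> t; rewrite !ell_qchart// subrr mulr0.
  have yD k : yvec h D 0 (lift ord0 (lift ord0 k)) = d 0 (lift ord0 k).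
    apply: (@form_derive h w d (fun z => yvec h z 0 (lift ord0 (lift ord0 k)))).
    + exact: cY.
    + by move=> c z; rewrite /yvec linearZ/= -scalemxAl mxE.
    + by move=> y z; rewrite /yvec linearB/= mulmxBl !mxE.
    + by move=> t; rewrite !yvec_qchart// !mxE !tcoord2 !mxE addrK.
  have rD : rsubmx D 0 0 = d 0 0.
    apply: (@form_derive h w d (fun z => rsubmx z 0 0)).
    + move=> z; rewrite (_ : (fun z => _) = fun z : V => z 0 (rshift m.+2 0)).
        exact: coord_continuous.
      by apply/funext => y; rewrite mxE.
    + by move=> c z; rewrite linearZ/= mxE.
    + by move=> y z; rewrite linearB/= !mxE.
    + by move=> t; rewrite !row_mxKr !mxE addrK.
  have a0 : a 0 0 = 0.
    have := congr1 (ell h) E.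
    by rewrite ellD ellZ ell_qchart// eD mulr1 addr0 -[0 in RHS](scale0r D) ellZ mul0r.
  have D0 : D = 0 by move: E; rewrite a0 scale0r add0r.
  have -> : d = 0.
    apply/rowP => j; rewrite [RHS]mxE; case: (unliftP ord0 j) => [k ->|->].
      by rewrite -yD D0 /yvec linear0 mul0mx mxE.
    by rewrite -[d 0 ord0]rD D0 linear0 mxE.
  by rewrite a0 raddf0 row_mx0.
- move=> w w' _ _ [c c0 E].
  have c1 : c = 1.
    by have := ell_qchart w' H; rewrite E ellZ ell_qchart// mulr1.
  by rewrite -(chart_invK w H) -(chart_invK w' H) E c1 scale1r.
Qed.

End Chart.

(** * The extremal function *)
Section Extremal.
Context {R : realType} {m : nat}.
Local Notation C := (cplx R).
Local Notation W := 'rV[C]_m.+1.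
Local Notation V := 'rV[C]_(m.+2 + 1).
Local Notation Rp := (fun z : C => complex.Re (z : R[i])).
Local Notation Ip := (fun z : C => complex.Im (z : R[i])).
Implicit Types (h : 'M[R]_m.+2) (w : W) (z : V).

Let i1 : 'I_m.+2 := lift ord0 ord0.
Let e0 : W := delta_mx 0 0.

Lemma qform_line (c : C) : qform (c *: e0) = c ^+ 2.
Proof.
rewrite /qform big1 ?subr0; last by move=> k _; rewrite !mxE mulr0 expr0n.
by rewrite !mxE eqxx mulr1.
Qed.

(** The line [c |-> c e0] of the chart is the complexification of a great circle,
    whose real points are those with [|c| = 1]. *)
Lemma qchart_circle h (c : C) : ortho h -> cabs c = 1 ->
  exists2 x : 'rV[R]_m.+2, sphere x & qchart h (c *: e0) = c *: embed x.
Proof.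
move=> H c1.
pose r : 'rV[R]_m.+2 := Rp c *: delta_mx 0 ord0 + Ip c *: delta_mx 0 i1.
have r0 : r 0 ord0 = Rp c by rewrite !mxE/= mulr1 mulr0 addr0.
have r1 : r 0 i1 = Ip c by rewrite !mxE/= mulr1 mulr0 add0r.
have r2 (k : 'I_m) : r 0 (lift ord0 (lift ord0 k)) = 0 by rewrite !mxE/= !mulr0 addr0.
have E : Rp c ^+ 2 + Ip c ^+ 2 = 1 by rewrite -sqr_cabs c1 expr1n.
have Et : tvec (c *: e0) = c *: map_mx (fun t : R => t%:C%C : C) r.
  apply/rowP; apply: ord2_ind => [||k]; rewrite [LHS]mxE [RHS]mxE [X in _ = c * X]mxE.
  - rewrite tcoord0 qform_line r0; case: (c) E => p q /= E.
    apply/eqP; rewrite eq_complex/=; apply/andP; split; apply/eqP; nra.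
  - rewrite tcoord1 qform_line r1; case: (c) E => p q /= E.
    apply/eqP; rewrite eq_complex/=; apply/andP; split; apply/eqP; nra.
  - by rewrite tcoord2 r2 !mxE/= !mulr0.
exists (r *m h).
  rewrite /sphere/= -dot_sqr ortho_dot// dot_sqr big_ord_recl big_ord_recl r0 r1 big1 ?addr0//.
  by move=> k _; rewrite r2 expr0n.
rewrite /qchart /embed scale_row_mx Et -scalemxAl; congr row_mx.
  by congr (_ *: _); rewrite (map_mxM (real_complex R)).
by apply/matrixP => i j; rewrite !mxE !eqxx.
Qed.

Lemma embed_neq0 (x : 'rV[R]_m.+2) : sphere x -> embed x != 0.
Proof. by move=> /embed_quadric[]. Qed.

(** Along the complexified great circle the potential of a competitor is
    subharmonic on the unit disc, and on the boundary, where the points are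
    real, it is at most [ln (sqrt 2)]. *)
Lemma potential_line_le h (psi : V -> \bar R) (c : C) : ortho h ->
  omega0_psh psi -> (forall x, sphere x -> (psi (embed x) <= 0)%E) -> cabs c <= 1 ->
  (local_potential psi (qchart h) (c *: e0) <= (ln (Num.sqrt 2))%:E)%E.
Proof.
move=> H [pinv ppsh] p0 hc.
have [p1 p2 p3] := ppsh _ _ (qchart_chart H).
apply: (@disc_maximum R (fun c => local_potential psi (qchart h) (c *: e0))) hc.
- by move=> c'; exact: p1.
- move=> c' t ht.
  have := p2 _ _ I ht.
  have cc : {for c', continuous (fun x : C => x *: e0)}.
    have gen (T : topologicalType) (k : T -> C) p : {for p, continuous k} ->
        {for p, continuous (fun x => k x *: e0)} by move=> ck; apply: cvgZr_tmp.
    by apply: (gen C (fun x : C => x) c'); exact: cvg_id.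
  by move=> /cc.
- move=> a b; have := p3 (a *: e0) (b *: e0) (fun _ _ => I).
  by under eq_integral do rewrite scalerA -scalerDl.
- move=> c' hc'; have [x sx E] := qchart_circle H hc'.
  have c0 : c' != 0 by rewrite -cabs_gt0 hc'.
  rewrite /local_potential E log_normZ ?embed_neq0// hc' ln1 add0r log_norm_embed//.
  rewrite (pinv _ _ (embed_quadric sx)); last by exists c'.
  by rewrite -[leRHS]add0e; apply: leeD => //; exact: p0.
Qed.

Lemma row_dot h (i j : 'I_m.+2) : ortho h -> dot (row i h) (row j h) = (i == j)%:R.
Proof. by move=> H; rewrite 2!rowE ortho_dot// dot_delta. Qed.

Lemma yvecE h z i : yvec h z 0 i =
  (dot (map_mx Rp (lsubmx z)) (row i h) +i* dot (map_mx Ip (lsubmx z)) (row i h))%C.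
Proof.
rewrite mxE; apply/eqP; rewrite eq_complex; apply/andP; split; apply/eqP.
  rewrite Re_sum/=; apply: eq_bigr => j _.
  by rewrite (ReIm_mul _ _).1 !mxE/= mulr0 subr0.
rewrite Im_sum/=; apply: eq_bigr => j _.
by rewrite (ReIm_mul _ _).2 !mxE/= mulr0 add0r.
Qed.

(** After alignment of the phase and a rotation the first coordinates of [z]
    become [(p, i q, 0, ..., 0)] with [q <= p]; such a point lies on the disc
    of a complexified great circle, and its Lie norm is the value [p + q] of
    the linear form [ell]. *)
Lemma quadric_on_line z : quadric z -> exists (h : 'M[R]_m.+2) (c : C),
  [/\ ortho h, cabs c <= 1, same_point (qchart h (c *: e0)) z &
      lnlie (tvec (c *: e0)) = 0].
Proof.
move=> Qz; have [u u1 [X0 BA E1 E2]] := lie_align (lsubmx z).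
have u0 : u != 0 by rewrite -cabs_gt0 u1.
set z1 := u *: z; have Qz1 : quadric z1 by exact: quadricZ.
have Ez1 : u *: lsubmx z = lsubmx z1 by rewrite linearZ.
rewrite Ez1 in X0 BA E1 E2.
set x := map_mx Rp (lsubmx z1); set y := map_mx Ip (lsubmx z1).
have Ex : \sum_i Rp (lsubmx z1 0 i) ^+ 2 = dot x x.
  by rewrite dot_sqr; apply: eq_bigr => i _; rewrite [x 0 i]mxE.
have Ey : \sum_i Ip (lsubmx z1 0 i) ^+ 2 = dot y y.
  by rewrite dot_sqr; apply: eq_bigr => i _; rewrite [y 0 i]mxE.
have xy : dot x y = 0.
  by rewrite -X0; apply: eq_bigr => i _; rewrite [x 0 i]mxE [y 0 i]mxE.
rewrite Ex Ey in BA E2.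
set p := Num.sqrt (dot x x) in E2; set q := Num.sqrt (dot y y) in E2.
have n0 : 0 < nsq (lsubmx z1) by apply: nsq_gt0; exact: quadric_lsubmx.
have px : 0 < dot x x.
  rewrite nsq_ReIm -/x -/y in n0; have := dot_ge0 y; lra.
have x0 : x != 0 by rewrite -dot_eq0 gt_eqF.
have p0 : 0 < p by rewrite sqrtr_gt0.
have q0 : 0 <= q by exact: sqrtr_ge0.
have pp : dot x x = p ^+ 2 by rewrite sqr_sqrtr// ltW.
have qq : dot y y = q ^+ 2 by rewrite sqr_sqrtr// dot_ge0.
have [h [H Hx Hy]] := ortho_frame x0 xy.
rewrite -/p in Hx; rewrite -/q in Hy.
have Y i : yvec h z1 0 i = ((p * (ord0 == i)%:R) +i* (q * (i1 == i)%:R))%C.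
  by rewrite yvecE -/x -/y {1}Hx {1}Hy !dotZl !row_dot.
have Y2 (k : 'I_m) : yvec h z1 0 (lift ord0 (lift ord0 k)) = 0.
  by rewrite Y; apply/eqP; rewrite eq_complex/= !mulr0 eqxx.
pose s := p + q; have s0 : 0 < s by rewrite ltr_wpDr.
have el : ell h z1 = (s%:C)%C.
  rewrite /ell !Y !eqxx /= !mulr0 !mulr1; apply/eqP; rewrite eq_complex/=.
  by apply/andP; split; apply/eqP; rewrite /s; ring.
have el0 : ell h z1 != 0 by rewrite el -cabs_gt0 cabs_real gtr0_norm.
set c := (ell h z1)^-1 * rsubmx z1 0 0.
have Ec : chart_inv h ((ell h z1)^-1 *: z1) = c *: e0.
  apply/rowP => j; rewrite mxE; case: (unliftP ord0 j) => [k ->|->].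
    rewrite /yvec linearZ/= -scalemxAl [LHS]mxE -/(yvec h z1) Y2 mulr0.
    by rewrite !mxE/= mulr0.
  by rewrite [RHS]mxE [X in _ = c * X]mxE !eqxx mulr1 /c linearZ/= [LHS]mxE.
have sp := same_point_qchart H Qz1 el0; rewrite Ec in sp.
exists h, c; split => //.
- have [_ Eq] := Qz1; have {}Eq : dsq (lsubmx z1) = rsubmx z1 0 0 ^+ 2 by [].
  have cc : cabs (rsubmx z1 0 0) ^+ 2 = p ^+ 2 - q ^+ 2.
    rewrite expr2 -cabsM -expr2 -Eq -pp -qq -Ex -Ey -(dsqE _).1.
    by rewrite E1 cabs_real/= ger0_norm// cabs_ge0.
  rewrite /c cabsM -[cabs (_^-1)]/(complex.Re `|_|) normfV el cabsE.
  rewrite cabs_real gtr0_norm//.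
  have -> : complex.Re ((s%:C)%C^-1 : R[i]) = s^-1.
    by rewrite /= expr0n addr0 expr2 invfM mulrA divff ?mul1r// gt_eqF.
  rewrite mulrC ler_pdivrMr// mul1r -(@ler_pXn2r _ 2) ?nnegrE ?cabs_ge0 ?(ltW s0)// cc /s.
  by have pq := mulr_ge0 (ltW p0) q0; have q2 := sqr_ge0 q; rewrite sqrrD; lra.
- have [k k0 Ek] := sp; exists (u^-1 * k).
    by rewrite mulf_neq0// invr_eq0.
  by rewrite -scalerA -Ek scalerA mulVf// scale1r.
- have E3 : lsubmx z1 = ell h z1 *: (tvec (c *: e0) *m toCmx h).
    have := qchart_surj H (quadricZ (invr_neq0 el0) Qz1).
    rewrite ellZ mulVf// Ec => /(_ erefl) /(congr1 lsubmx).
    rewrite row_mxKl linearZ/= => ->.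
    by rewrite scalerA divff// scale1r.
  have E4 : lie2 (lsubmx z1) = s ^+ 2 by rewrite -Ez1 lie2Z u1 expr1n mul1r E2.
  have E5 : lie2 (tvec (c *: e0)) = 1.
    move: E4; rewrite E3 lie2Z lie2_ortho// el cabs_real gtr0_norm// => /eqP.
    rewrite -subr_eq0 -{2}[s ^+ 2]mulr1 -mulrBr mulf_eq0 expf_eq0/= gt_eqF//= subr_eq0.
    by move/eqP.
  by rewrite /lnlie E5 ln1 mul0r.
Qed.

Lemma phi_sup_le z : quadric z -> (phi_sup z <= phi0 z)%E.
Proof.
move=> Qz; have [h [c [H hc sp L0]]] := quadric_on_line Qz.
have Qk := quadric_qchart (c *: e0) H.
apply: ge_ereal_sup => _ [psi [Ppsi p0] <-].
have [pinv _] := Ppsi.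
rewrite (pinv _ _ Qk sp) (phi0_inv Qk sp).
have := potential_line_le H Ppsi p0 hc.
rewrite /local_potential /phi0 /lie_potential row_mxKl lnlie_ortho// L0 add0r.
by rewrite EFinB -leeBrDr.
Qed.

Lemma phi_supE z : quadric z -> phi_sup z = phi0 z.
Proof. by move=> Qz; apply/eqP; rewrite eq_le phi_sup_le// phi0_le_phi_sup. Qed.

Lemma continuous_lie_potential z : quadric z ->
  {for z, continuous (fun z => lie_potential z - log_norm z)}.
Proof.
move=> Qz; have [z0 _] := Qz.
have cR i : {for z, continuous (fun z : V => Rp (z 0 i))}.
  apply: (@continuous_comp _ _ _ (fun z : V => z 0 i) Rp); first exact: coord_continuous.
  exact: continuous_Re.
have cI i : {for z, continuous (fun z : V => Ip (z 0 i))}.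
  apply: (@continuous_comp _ _ _ (fun z : V => z 0 i) Ip); first exact: coord_continuous.
  exact: continuous_Im.
have cl : {for z, continuous (fun z : V => lnlie (lsubmx z))}.
  apply: (continuous_lnlie (f := fun z : V => lsubmx z)); first exact: quadric_lsubmx.
    move=> i; rewrite (_ : (fun x => _) = fun z : V => Rp (z 0 (lshift 1 i)))//.
    by apply/funext => y; rewrite mxE.
  move=> i; rewrite (_ : (fun x => _) = fun z : V => Ip (z 0 (lshift 1 i)))//.
  by apply/funext => y; rewrite mxE.
have cn : {for z, continuous (fun z : V => nsq z)}.
  rewrite (_ : (fun x => _) = fun z : V =>
    \sum_i (Rp (z 0 i) * Rp (z 0 i) + Ip (z 0 i) * Ip (z 0 i))).
    apply: continuous_fsum => i; apply: (@continuousD _ _ _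
      (fun z : V => Rp (z 0 i) * Rp (z 0 i)) (fun z : V => Ip (z 0 i) * Ip (z 0 i))).
      by apply: (@continuousM _ _ (fun z : V => Rp (z 0 i)) (fun z : V => Rp (z 0 i))).
    by apply: (@continuousM _ _ (fun z : V => Ip (z 0 i)) (fun z : V => Ip (z 0 i))).
  by apply/funext => y; apply: eq_bigr => i _; rewrite sqr_cabs !expr2.
apply: (@continuousB _ _ _ (fun z : V => lie_potential z) (fun z : V => log_norm z)).
  apply: (@continuousD _ _ _ (fun z : V => lnlie (lsubmx z)) (fun=> ln (Num.sqrt 2))) => //.
  exact: cst_continuous.
rewrite (_ : (fun x => _) = fun z : V => ln (Num.sqrt (nsq z))).
  apply: (@continuous_comp _ _ _ (fun z : V => Num.sqrt (nsq z)) (@ln R)).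
    apply: (@continuous_comp _ _ _ (fun z : V => nsq z) (@Num.sqrt R)) => //.
    exact: sqrt_continuous.
  by apply: continuous_ln; rewrite sqrtr_gt0 nsq_gt0.
by apply/funext => y; rewrite log_normE.
Qed.

(** [phi0] is continuous on the quadric, so that the regularization changes
    nothing. *)
Lemma phi_starE z : quadric z -> phi_star z = phi0 z.
Proof.
move=> Qz; rewrite /phi_star limf_esupE; apply/eqP; rewrite eq_le; apply/andP; split.
  apply/lee_addgt0Pr => e egt0.
  pose A : set V := [set z' | quadric z' /\
    lie_potential z' - log_norm z' < lie_potential z - log_norm z + e].
  have FA : within quadric (nbhs z) A.
    have lt : lie_potential z - log_norm z < lie_potential z - log_norm z + e.
      by rewrite ltrDl.
    have near_lt : \forall z' \near z, lie_potential z' - log_norm z' <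
        lie_potential z - log_norm z + e.
      by have := continuous_lie_potential Qz => /cvgr_lt/(_ _ lt).
    by rewrite /within/=; apply: filterS near_lt => z' hz' Qz'; split.
  apply: le_trans (ereal_inf_lbound _) _; first by exists A.
  apply: ge_ereal_sup => _ [z' [Qz' hz'] <-].
  by rewrite phi_supE// /phi0 -EFinD lee_fin ltW.
apply: le_ereal_inf_tmp => _ [A FA <-].
rewrite -phi_supE//; apply: ereal_sup_ubound; exists z => //.
have nA : nbhs z (fun x => quadric x -> A x) by exact: FA.
have := nbhs_singleton nA; exact.
Qed.

End Extremal.

(** * Smooth approximation of the extremal function *)
Section ElementaryFunctions.
Context {R : realType} {M : nat}.
Local Notation X := 'rV[R]_M.
Implicit Types (f g : X -> R).

(** This class of differentiable functions is closed under directional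
    derivatives, whence derivatives of all orders. *)
Inductive elementary : (X -> R) -> Prop :=
| el_cst c : elementary (fun=> c)
| el_coord i : elementary (fun x => x 0 i)
| el_add f g : elementary f -> elementary g -> elementary (fun x => f x + g x)
| el_mul f g : elementary f -> elementary g -> elementary (fun x => f x * g x)
| el_inv f : (forall x, 0 < f x) -> elementary f -> elementary (fun x => (f x)^-1)
| el_sqrt f : (forall x, 0 < f x) -> elementary f ->
    elementary (fun x => Num.sqrt (f x))
| el_ln f : (forall x, 0 < f x) -> elementary f -> elementary (fun x => ln (f x)).

Lemma diff_comp_real f (phi : R -> R) (x v : X) (d : R) :
  differentiable f x -> is_derive (f x) 1 phi d ->
  differentiable (fun y => phi (f y)) x /\
  'D_v (fun y => phi (f y)) x = d * 'D_v f x.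
Proof.
move=> df [dphi ephi].
have dp : differentiable phi (f x) by apply/derivable1_diffP.
have dc : differentiable (phi \o f) x by exact: differentiable_comp.
split; first exact: dc.
rewrite -[fun y => _]/(phi \o f) deriveE// diff_comp//= deriveE//.
by rewrite deriv1E// derive1E ephi [LHS]mulrC.
Qed.

Lemma derive_coord (i : 'I_M) (x v : X) : 'D_v (fun x : X => x 0 i) x = v 0 i.
Proof.
rewrite /derive; apply: cvg_lim => //.
apply: (@cvg_trans _ ((fun=> v 0 i) @ (0 : R)^')); last exact: cvg_cst.
apply: near_eq_cvg; near=> t.
rewrite /= !mxE addrK /GRing.scale/= mulrA mulVf ?mul1r//; near: t.
exact: nbhs_dnbhs_neq.
Unshelve. all: by end_near. Qed.

Lemma elementary_diff f : elementary f -> (forall x, differentiable f x) /\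
  forall v, elementary ('D_v f).
Proof.
elim=> {f} [c|i|f g _ [df Df] _ [dg Dg]|f g ef [df Df] eg [dg Dg]|f f0 ef [df Df]|
  f f0 ef [df Df]|f f0 ef [df Df]].
- split=> [x|v]; first exact: differentiable_cst.
  rewrite (_ : 'D_v _ = fun=> 0); first exact: el_cst.
  by apply/funext => x; rewrite derive_cst.
- have dc (x : X) : differentiable (fun x : X => x 0 i) x by exact: differentiable_coord.
  split=> [//|v]; rewrite (_ : 'D_v _ = fun=> v 0 i); first exact: el_cst.
  apply/funext => x; exact: derive_coord.
- split=> [x|v]; first exact: differentiableD.
  rewrite (_ : 'D_v _ = fun x => 'D_v f x + 'D_v g x); first exact: el_add.
  by apply/funext => x; apply: deriveD; exact: diff_derivable.
- split=> [x|v]; first exact: differentiableM.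
  rewrite (_ : 'D_v _ = fun x => f x * 'D_v g x + g x * 'D_v f x).
    by apply: el_add; apply: el_mul.
  by apply/funext => x; apply: deriveM; exact: diff_derivable.
- have H x : is_derive (f x) 1 (fun y : R => y^-1) (- (f x) ^- 2 *: 1).
    by apply: (@is_deriveV R id) => //; rewrite gt_eqF.
  split=> [x|v]; first exact: (diff_comp_real 0 (df x) (H x)).1.
  rewrite (_ : 'D_v _ = fun x => (-1 * (f x)^-1) * (f x)^-1 * 'D_v f x).
    apply: el_mul => //; apply: el_mul; last exact: el_inv.
    by apply: el_mul; [exact: el_cst|exact: el_inv].
  apply/funext => x; rewrite (diff_comp_real v (df x) (H x)).2.
  by rewrite [_ *: 1]mulr1 expr2 invfM mulN1r mulNr.
- have H x : is_derive (f x) 1 (@Num.sqrt R) (2 * Num.sqrt (f x))^-1.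
    exact: is_derive1_sqrt.
  split=> [x|v]; first exact: (diff_comp_real 0 (df x) (H x)).1.
  rewrite (_ : 'D_v _ = fun x => 2^-1 * (Num.sqrt (f x))^-1 * 'D_v f x).
    apply: el_mul => //; apply: el_mul; first exact: el_cst.
    apply: (@el_inv (fun x => Num.sqrt (f x))); last exact: el_sqrt.
    by move=> x; rewrite sqrtr_gt0.
  by apply/funext => x; rewrite (diff_comp_real v (df x) (H x)).2 invfM.
- have H x : is_derive (f x) 1 (@ln R) (f x)^-1 by exact: is_derive1_ln.
  split=> [x|v]; first exact: (diff_comp_real 0 (df x) (H x)).1.
  rewrite (_ : 'D_v _ = fun x => (f x)^-1 * 'D_v f x).
    by apply: el_mul => //; exact: el_inv.
  by apply/funext => x; rewrite (diff_comp_real v (df x) (H x)).2.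
Qed.

Lemma elementary_smooth f (U : set X) : elementary f -> smooth_on U f.
Proof.
move=> ef vs /= x _.
suff : elementary (foldr (fun v h => 'D_v h) f vs).
  move=> /elementary_diff[d _]; split; last by move=> v; exact: diff_derivable.
  exact: differentiable_continuous.
by elim: vs => //= v vs /elementary_diff[].
Qed.

Lemma el_sum (I : Type) (r : seq I) (F : I -> X -> R) :
  (forall i, elementary (F i)) -> elementary (fun x => \sum_(i <- r) F i x).
Proof.
move=> H; elim: r => [|i r IH].
  by rewrite (_ : (fun x => _) = fun=> 0);
    [exact: el_cst|apply/funext => x; rewrite big_nil].
rewrite (_ : (fun x => _) = fun x => F i x + \sum_(j <- r) F j x).
  exact: el_add.
by apply/funext => x; rewrite big_cons.
Qed.

Local Notation C := (cplx R).
Local Notation Rp := (fun z : C => complex.Re (z : R[i])).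
Local Notation Ip := (fun z : C => complex.Im (z : R[i])).

Definition celementary (F : X -> C) :=
  elementary (fun x => Rp (F x)) /\ elementary (fun x => Ip (F x)).

Lemma cel_cst c : celementary (fun=> c).
Proof. by split; exact: el_cst. Qed.

Lemma cel_add F G : celementary F -> celementary G -> celementary (fun x => F x + G x).
Proof.
move=> [F1 F2] [G1 G2]; split.
  rewrite (_ : (fun x => _) = fun x => Rp (F x) + Rp (G x)); first exact: el_add.
  by apply/funext => x; case: (F x) => ? ?; case: (G x).
rewrite (_ : (fun x => _) = fun x => Ip (F x) + Ip (G x)); first exact: el_add.
by apply/funext => x; case: (F x) => ? ?; case: (G x).
Qed.

Lemma el_opp f : elementary f -> elementary (fun x => - f x).
Proof.
move=> ef; rewrite (_ : (fun x => _) = fun x => -1 * f x).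
  by apply: el_mul => //; exact: el_cst.
by apply/funext => x; rewrite mulN1r.
Qed.

Lemma cel_mul F G : celementary F -> celementary G -> celementary (fun x => F x * G x).
Proof.
move=> [F1 F2] [G1 G2]; split.
  rewrite (_ : (fun x => _) = fun x => Rp (F x) * Rp (G x) + - (Ip (F x) * Ip (G x))).
    by apply: el_add; [exact: el_mul|apply: el_opp; exact: el_mul].
  by apply/funext => x; rewrite (ReIm_mul _ _).1.
rewrite (_ : (fun x => _) = fun x => Rp (F x) * Ip (G x) + Ip (F x) * Rp (G x)).
  by apply: el_add; exact: el_mul.
by apply/funext => x; rewrite (ReIm_mul _ _).2.
Qed.

Lemma cel_sum (I : Type) (r : seq I) (F : I -> X -> C) :
  (forall i, celementary (F i)) -> celementary (fun x => \sum_(i <- r) F i x).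
Proof.
move=> H; elim: r => [|i r IH].
  by rewrite (_ : (fun x => _) = fun=> 0);
    [exact: cel_cst|apply/funext => x; rewrite big_nil].
rewrite (_ : (fun x => _) = fun x => F i x + \sum_(j <- r) F j x).
  exact: cel_add.
by apply/funext => x; rewrite big_cons.
Qed.

Lemma el_cabs2 F : celementary F -> elementary (fun x => cabs (F x) ^+ 2).
Proof.
move=> [F1 F2]; rewrite (_ : (fun x => _) =
    fun x => Rp (F x) * Rp (F x) + Ip (F x) * Ip (F x)).
  by apply: el_add; exact: el_mul.
by apply/funext => x; rewrite sqr_cabs !expr2.
Qed.

End ElementaryFunctions.

Section Approximation.
Context {R : realType} {m : nat}.
Local Notation C := (cplx R).
Local Notation W := 'rV[C]_m.+1.
Local Notation V := 'rV[C]_(m.+2 + 1).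
Local Notation Rp := (fun z : C => complex.Re (z : R[i])).
Local Notation Ip := (fun z : C => complex.Im (z : R[i])).
Implicit Types (h : 'M[R]_m.+2) (w : W) (al : R).

(** Two more coordinates [al] and [i al] leave the complex quadratic form
    unchanged while making the Lie norm smooth. *)
Definition tail al : 'rV[C]_2 := \row_i (if i == 0 then (al%:C)%C else (0 +i* al)%C).
Definition zvec al w : 'rV[C]_(m.+2 + 2) := row_mx (tvec w) (tail al).
Definition smooth_potential al w : R := lnlie (zvec al w) + ln (Num.sqrt 2).

Lemma nsq_tail al : nsq (tail al) = 2 * al ^+ 2.
Proof.
rewrite /nsq big_ord_recl big_ord1 !mxE/= cabs_real real_normK ?num_real//.
by rewrite sqr_cabs/= expr0n/= add0r; ring.
Qed.

Lemma dsq_tail al : dsq (tail al) = 0.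
Proof.
rewrite /dsq big_ord_recl big_ord1 !mxE/= !expr2; apply/eqP.
by rewrite eq_complex/=; apply/andP; split; apply/eqP; ring.
Qed.

Lemma nsq_zvec al w : nsq (zvec al w) = nsq (tvec w) + 2 * al ^+ 2.
Proof. by rewrite /zvec nsq_row_mx nsq_tail. Qed.

Lemma dsq_zvec al w : dsq (zvec al w) = w 0 0 ^+ 2.
Proof.
rewrite -dsq_tvec -[RHS]addr0 -(dsq_tail al) /dsq big_split_ord/=; congr (_ + _).
  by apply: eq_bigr => i _; rewrite row_mxEl.
by apply: eq_bigr => i _; rewrite row_mxEr.
Qed.

Lemma cabs_dsq_le (M : nat) (z : 'rV[C]_M) : cabs (dsq z) <= nsq z.
Proof.
rewrite /dsq /nsq; elim/big_rec2: _ => [|i y x _ IH]; first by rewrite cabs0.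
by apply: le_trans (cabsD _ _) _; rewrite expr2 cabsM -expr2 lerD2l.
Qed.

Lemma tvec_neq0 w : tvec w != 0.
Proof.
have o1 : ortho (1%:M : 'M[R]_m.+2) by rewrite /ortho trmx1 mulmx1.
have := quadric_lsubmx (quadric_qchart w o1); rewrite row_mxKl.
by apply: contra => /eqP ->; rewrite mul0mx.
Qed.

Lemma zvec_neq0 al w : zvec al w != 0.
Proof. by apply: contra (tvec_neq0 w) => /eqP E; rewrite -(row_mxKl (tvec w) (tail al)) -/(zvec al w) E linear0. Qed.

(** The quantity under the square root stays positive because the auxiliary
    coordinates increase the norm and not the quadratic form. *)
Lemma smooth_potential_smooth al : 0 < al -> csmooth_on setT (smooth_potential al).
Proof.
move=> al0; apply: elementary_smooth.
pose n' := m.+1.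
have cw j : celementary (fun x : 'rV[R]_(n' + n') => toC x 0 j).
  split.
    rewrite (_ : (fun x => _) = fun x : 'rV[R]_(n' + n') => x 0 (lshift n' j)); first exact: el_coord.
    by apply/funext => x; rewrite !mxE/=.
  rewrite (_ : (fun x => _) = fun x : 'rV[R]_(n' + n') => x 0 (rshift n' j)); first exact: el_coord.
  by apply/funext => x; rewrite !mxE/=.
have csqr (F : 'rV[R]_(n' + n') -> C) : celementary F -> celementary (fun x => F x ^+ 2).
  by move=> cF; under eq_fun do rewrite expr2; exact: cel_mul.
have cq : celementary (fun x : 'rV[R]_(n' + n') => qform (toC x)).
  rewrite (_ : (fun x => _) = fun x : 'rV[R]_(n' + n') => toC x 0 0 ^+ 2 +
     (-1) * \sum_(k < m) toC x 0 (lift ord0 k) ^+ 2).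
    apply: cel_add; first exact: csqr.
    by apply: cel_mul; [exact: cel_cst|apply: cel_sum => k; exact: csqr].
  by apply/funext => x; rewrite mulN1r.
have cN : elementary (fun x : 'rV[R]_(n' + n') => nsq (zvec al (toC x))).
  under eq_fun do rewrite nsq_zvec /nsq (sum_tcoord (fun y => cabs y ^+ 2)).
  apply: el_add; last exact: el_cst.
  apply: el_add; first by apply: el_cabs2; apply: cel_mul; [apply: cel_add|]; try exact: cel_cst.
  apply: el_add; first by apply: el_cabs2; apply: cel_mul; [apply: cel_add|]; try exact: cel_cst.
  by apply: el_sum => k; exact: el_cabs2.
have cD : elementary (fun x : 'rV[R]_(n' + n') => cabs (dsq (zvec al (toC x))) ^+ 2).
  by under eq_fun do rewrite dsq_zvec; apply: el_cabs2; exact: csqr.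
have pos (x : 'rV[R]_(n' + n')) :
    0 < nsq (zvec al (toC x)) ^+ 2 - cabs (dsq (zvec al (toC x))) ^+ 2.
  rewrite subr_gt0 ltr_pXn2r ?nnegrE ?cabs_ge0 ?nsq_ge0// dsq_zvec -dsq_tvec nsq_zvec.
  by rewrite (le_lt_trans (cabs_dsq_le _))// ltrDl mulr_gt0// exprn_gt0.
rewrite (_ : smooth_potential al \o toC = fun x : 'rV[R]_(n' + n') =>
  ln (nsq (zvec al (toC x)) +
    Num.sqrt (nsq (zvec al (toC x)) * nsq (zvec al (toC x)) +
      - cabs (dsq (zvec al (toC x))) ^+ 2)) * 2^-1 + ln (Num.sqrt 2)).
  apply: el_add; last exact: el_cst.
  apply: el_mul; last exact: el_cst.
  apply: (@el_ln _ _ (fun x => nsq (zvec al (toC x)) +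
    Num.sqrt (nsq (zvec al (toC x)) * nsq (zvec al (toC x)) +
      - cabs (dsq (zvec al (toC x))) ^+ 2))).
    by move=> x; have := lie2_gt0 (zvec_neq0 al (toC x)); rewrite /lie2 expr2.
  apply: el_add => //.
  apply: (@el_sqrt _ _ (fun x => nsq (zvec al (toC x)) * nsq (zvec al (toC x)) +
      - cabs (dsq (zvec al (toC x))) ^+ 2)).
    by move=> x; have := pos x; rewrite expr2.
  by apply: el_add; [exact: el_mul|exact: el_opp].
by apply/funext => x; rewrite /= /smooth_potential /lnlie /lie2 expr2.
Qed.

Lemma ortho1 : ortho (1%:M : 'M[R]_m.+2).
Proof. by rewrite /ortho trmx1 mulmx1. Qed.

Lemma qchart1_coord w i : tvec w 0 i = qchart 1%:M w 0 (lshift 1 i).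
Proof. by rewrite row_mxEl /toCmx (map_mx1 (real_complex R)) mulmx1. Qed.

Lemma tvec_coord_continuous i : continuous (fun w => tvec w 0 i).
Proof.
move=> w; under eq_fun do rewrite qchart1_coord.
apply: (@continuous_comp _ _ _ (qchart 1%:M) (fun z : V => z 0 (lshift 1 i))).
  exact/differentiable_continuous/differentiable_qchart.
exact: coord_continuous.
Qed.

Lemma tvec_coord_cderivable (a b : W) i (z : C) :
  cderivable (fun x => tvec (a + x *: b) 0 i) z.
Proof.
under eq_fun do rewrite qchart1_coord.
have db : derivable (qchart 1%:M) (a + z *: b) b.
  by apply: diff_derivable; exact: differentiable_qchart.
exact: (derivable_cderivable (lshift 1 i) db).
Qed.

Lemma lnlie_zvec_continuous al : continuous (fun w => lnlie (zvec al w)).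
Proof.
move=> w.
have cc i : {for w, continuous (fun w => zvec al w 0 i)}.
  case: (split_ordP i) => j ->.
    rewrite (_ : (fun w => _) = fun w => tvec w 0 j); first exact: tvec_coord_continuous.
    by apply/funext => x; rewrite row_mxEl.
  rewrite (_ : (fun w => _) = fun=> tail al 0 j); first exact: cst_continuous.
  by apply/funext => x; rewrite row_mxEr.
apply: (continuous_lnlie (f := zvec al)); first exact: zvec_neq0.
  move=> i; apply: (@continuous_comp _ _ _ (fun w => zvec al w 0 i) Rp); first exact: cc.
  exact: continuous_Re.
move=> i; apply: (@continuous_comp _ _ _ (fun w => zvec al w 0 i) Ip); first exact: cc.
exact: continuous_Im.
Qed.

Lemma smooth_potential_continuous al : continuous (smooth_potential al).
Proof.
move=> w; apply: (@continuousD _ _ _ (fun w => lnlie (zvec al w))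
  (fun=> ln (Num.sqrt 2))); last exact: cst_continuous.
exact: lnlie_zvec_continuous.
Qed.

Lemma smooth_potential_psh al : psh setT (EFin \o smooth_potential al).
Proof.
apply: psh_EFin => [w _|a b _]; first exact: smooth_potential_continuous.
have D i z : cabs z <= 1 -> cderivable (fun x => zvec al (a + x *: b) 0 i) z.
  move=> _; case: (split_ordP i) => j ->.
    under eq_fun do rewrite row_mxEl; exact: tvec_coord_cderivable.
  by under eq_fun do rewrite row_mxEr; exact: cderivable_cst.
have K := lnlie_submean D (fun z _ => zvec_neq0 al _).
rewrite scale0r addr0 in K.
rewrite /smooth_potential iint_addc.
  by rewrite [_ * (lnlie _ + _)]mulrDr lerD2r.
move=> t; apply: (@continuous_comp _ _ _ (fun t : R => a + expi t *: b)
  (fun w => lnlie (zvec al w))); first exact: continuous_circle.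
exact: lnlie_zvec_continuous.
Qed.

Lemma smooth_potential_le al be w : 0 <= al <= be ->
  smooth_potential al w <= smooth_potential be w.
Proof.
move=> /andP[al0 ab]; rewrite lerD2r /lnlie ler_pM2r ?invr_gt0//.
rewrite ler_ln ?posrE ?lie2_gt0 ?zvec_neq0//.
have N : nsq (zvec al w) <= nsq (zvec be w).
  rewrite !nsq_zvec lerD2l ler_pM2l// ler_pXn2r// nnegrE //; exact: le_trans ab.
rewrite /lie2 !dsq_zvec; apply: lerD => //; apply: ler_wsqrtr; rewrite lerB//.
by rewrite ler_pXn2r ?nnegrE ?nsq_ge0.
Qed.

Lemma smooth_potential_cvg h w : ortho h ->
  (smooth_potential (j.+1%:R^-1) w)%:E @[j --> \oo] --> local_potential phi_star (qchart h) w.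
Proof.
move=> H; have Q := quadric_qchart w H.
rewrite /local_potential phi_starE// -[X in _ --> X]/(local_potential phi0 (qchart h) w).
rewrite local_potential_phi0 /lie_potential row_mxKl lnlie_ortho//.
apply/cvg_EFin; first by near=> x.
have -> : lnlie (tvec w) + ln (Num.sqrt 2) = smooth_potential 0 w.
  rewrite /smooth_potential /lnlie /lie2 nsq_zvec dsq_zvec -dsq_tvec.
  by rewrite expr0n mulr0 addr0.
have c0 : {for 0, continuous (fun al => smooth_potential al w)}.
  apply: (@continuousD _ _ _ (fun al => lnlie (zvec al w))
    (fun=> ln (Num.sqrt 2))); last exact: cst_continuous.
  apply: (continuous_lnlie (f := fun al => zvec al w)); first exact: zvec_neq0.
    move=> i; case: (split_ordP i) => j ->.
      rewrite (_ : (fun al => _) = fun=> Rp (tvec w 0 j)); first exact: cst_continuous.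
      by apply/funext => x; rewrite row_mxEl.
    rewrite (_ : (fun al => _) = fun al : R => if j == 0 then al else 0 : R).
      by case: (j == 0); [exact: cvg_id|exact: cst_continuous].
    by apply/funext => x; rewrite row_mxEr mxE; case: ifP.
  move=> i; case: (split_ordP i) => j ->.
    rewrite (_ : (fun al => _) = fun=> Ip (tvec w 0 j)); first exact: cst_continuous.
    by apply/funext => x; rewrite row_mxEl.
  rewrite (_ : (fun al => _) = fun al : R => if j == 0 then 0 : R else al).
    by case: (j == 0); [exact: cst_continuous|exact: cvg_id].
  by apply/funext => x; rewrite row_mxEr mxE; case: ifP.
have h0 : (fun j => j.+1%:R^-1 : R) @ \oo --> (0 : R) by exact: cvg_harmonic.
exact: (cvg_comp _ _ h0 c0).
Unshelve. all: by end_near. Qed.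

(** The approximants do not depend on [h], so the Monge-Ampere measure gives the
    same integrals in all the rotated charts. *)
Lemma monge_ampere_rotation (mu : {measure set (@borel_proj R m.+1) -> \bar R}) h
  (chi chi' : V -> R) : monge_ampere phi_star mu -> ortho h ->
  test_function setT (qchart h) chi -> test_function setT (qchart 1%:M) chi' ->
  (forall w, chi (qchart h w) = chi' (qchart 1%:M w)) ->
  \int[mu]_(z in (quadric : set (@borel_proj R m.+1))) chi z =
  \int[mu]_(z in (quadric : set (@borel_proj R m.+1))) chi' z.
Proof.
move=> MA H tc tc' E.
pose u j : W -> R := smooth_potential (j.+1%:R^-1).
have a0 j : 0 < (j.+1%:R^-1 : R) by rewrite invr_gt0.
have dec j : 0 <= (j.+2%:R^-1 : R) <= j.+1%:R^-1.
  by rewrite invr_ge0 ler0n/= lef_pV2 ?posrE ?ltr0n// ler_nat.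
have L k (Hk : ortho k) c (tk : test_function setT (qchart k) c) :=
  MA _ _ (qchart_chart Hk) u (fun j => smooth_potential_smooth (a0 j))
  (fun j => smooth_potential_psh _) (fun j w _ => smooth_potential_le w (dec j))
  (fun w _ => @smooth_potential_cvg k w Hk) c tk.
have L1 := L h H chi tc; have L2 := L 1%:M ortho1 chi' tc'.
have EF j : (fun w : 'rV[R]_(m.+1 + m.+1) => \1_setT (toC w) * chi (qchart h (toC w)) *
    monge_ampere_density (u j) w) = (fun w : 'rV[R]_(m.+1 + m.+1) => \1_setT (toC w) *
     chi' (qchart 1%:M (toC w)) * monge_ampere_density (u j) w).
  by apply/funext => w; rewrite E.
rewrite (_ : (fun j => _) = fun j => lebesgue_rV (fun w : 'rV[R]_(m.+1 + m.+1) =>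
   \1_setT (toC w) * chi' (qchart 1%:M (toC w)) * monge_ampere_density (u j) w)) in L1.
  exact: (cvg_unique _ L1 L2).
by apply/funext => j; rewrite EF.
Qed.

End Approximation.

(** * Integration over the sphere *)
Section SphereIntegral.
Context {R : realType} {n : nat}.
Local Notation X := 'rV[R]_n.+1.
Local Notation S := (@sphere R n : set (borel_rV R n)).
Implicit Types (F G : X -> R).

Lemma sphere_dot (x : X) : sphere x <-> dot x x = 1.
Proof. by rewrite /sphere/= dot_sqr. Qed.

Lemma closed_sphere : closed (@sphere R n).
Proof.
rewrite (_ : sphere = (fun x : X => \sum_i x 0 i * x 0 i) @^-1` [set 1]).
  have cg : continuous (fun x : X => \sum_i x 0 i * x 0 i).
    move=> x; apply: continuous_fsum => i.
    by apply: (@continuousM _ _ (fun x : X => x 0 i) (fun x : X => x 0 i));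
      exact: coord_continuous.
  by apply: preimage_closed => //; exact: closed_eq.
by apply/seteqP; split => x /=; rewrite /sphere/= => <-;
  apply: eq_bigr => i _; rewrite expr2.
Qed.

Lemma sphere_coord (x : X) i : sphere x -> x 0 i ^+ 2 <= 1.
Proof.
rewrite /sphere/= => <-; rewrite (bigD1 i)//= lerDl.
by apply: sumr_ge0 => j _; exact: sqr_ge0.
Qed.

Lemma compact_sphere : compact (@sphere R n).
Proof.
pose K := [set x : X | forall i, `[-1, 1]%classic (x ord0 i)].
have cK : compact K.
  by apply: (@rV_compact R n.+1 (fun=> `[-1, 1]%classic)) => i; exact: segment_compact.
rewrite (_ : sphere = K `&` sphere); first exact: (compact_closedI cK closed_sphere).
apply/seteqP; split => x; last by case.
move=> sx; split => // i; rewrite /= in_itv/= -ler_norml.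
by rewrite -(@expr_le1 _ 2)// real_normK ?num_real//; exact: sphere_coord.
Qed.

Lemma measurable_sphere : measurable S.
Proof.
rewrite -[S]setCK; apply: measurableC; apply: sub_sigma_algebra.
exact: (closed_openC closed_sphere).
Qed.

Lemma continuous_measurable F : continuous F ->
  measurable_fun setT (F : borel_rV R n -> R).
Proof.
move=> cF; apply: (measurability _ (RGenOInfty.measurableE R)) => _ [_ [r ->] <-].
rewrite setTI; apply: sub_sigma_algebra => /=.
have /continuousP H := cF.
by apply: H; exact: interval_open.
Qed.

Lemma continuous_bounded F : continuous F -> exists2 B : R, 0 < B &
  forall x, sphere x -> `|F x| <= B.
Proof.
move=> cF.
have : compact (F @` sphere).
  by apply: continuous_compact; [exact: continuous_subspaceT|exact: compact_sphere].
move=> /compact_bounded[B [Br HB]].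
exists (`|B| + 1); first by rewrite ltr_wpDl.
move=> x sx; apply: (HB (`|B| + 1)); last by exists x.
by rewrite (le_lt_trans (ler_norm B))// ltrDl.
Qed.

Variable sigma : probability (borel_rV R n) R.
Hypothesis sigma1 : sigma sphere = 1%E.

Definition sint F : R := \int[sigma]_(x in S) F x.

Lemma sint_integrable F : continuous F -> sigma.-integrable S (EFin \o F).
Proof.
move=> cF; have [B B0 HB] := continuous_bounded cF.
apply: measurable_bounded_integrable.
- exact: measurable_sphere.
- by apply: le_lt_trans (probability_le1 _ measurable_sphere) _; rewrite ltry.
- by apply: measurable_funTS; exact: continuous_measurable.
- exists B; split; first exact: num_real.
  by move=> M BM x sx; apply: le_trans (HB x sx) _; exact: ltW.
Qed.

Lemma sintD F G : continuous F -> continuous G ->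
  sint (fun x => F x + G x) = sint F + sint G.
Proof.
by move=> cF cG; rewrite /sint RintegralD//; [exact: measurable_sphere|
  exact: sint_integrable|exact: sint_integrable].
Qed.

Lemma sintZ c F : continuous F -> sint (fun x => c * F x) = c * sint F.
Proof.
by move=> cF; rewrite /sint RintegralZl//; [exact: measurable_sphere|exact: sint_integrable].
Qed.

Lemma sint_cst c : sint (fun=> c) = c.
Proof.
transitivity (c * fine (sigma sphere)); last by rewrite sigma1 mulr1.
exact: (Rintegral_cst _ measurable_sphere).
Qed.

Lemma le_sint F G : continuous F -> continuous G ->
  (forall x, sphere x -> F x <= G x) -> sint F <= sint G.
Proof.
by move=> cF cG FG; apply: le_Rintegral => //; [exact: measurable_sphere|
  exact: sint_integrable|exact: sint_integrable].
Qed.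

Lemma eq_sint F G : (forall x, sphere x -> F x = G x) -> sint F = sint G.
Proof. by move=> FG; apply: eq_Rintegral => x /set_mem; exact: FG. Qed.

Lemma sint_sum (I : Type) (r : seq I) (F : I -> X -> R) :
  (forall i, continuous (F i)) ->
  sint (fun x => \sum_(i <- r) F i x) = \sum_(i <- r) sint (F i) /\
  continuous (fun x => \sum_(i <- r) F i x).
Proof.
move=> cF; elim: r => [|i r [IH cr]].
  rewrite (_ : (fun x => _) = fun=> 0); last by apply/funext => x; rewrite big_nil.
  by rewrite big_nil sint_cst; split => // x; exact: cst_continuous.
rewrite (_ : (fun x => _) = fun x => F i x + \sum_(j <- r) F j x); last first.
  by apply/funext => x; rewrite big_cons.
rewrite big_cons sintD// IH; split => // x.
by apply: (@continuousD _ _ _ (F i) (fun x => \sum_(j <- r) F j x)); [exact: cF|exact: cr].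
Qed.

End SphereIntegral.

Section RowContinuity.
Context {K : numFieldType} {M : nat}.

Lemma continuous_row (T : topologicalType) (f : T -> 'rV[K]_M) (p : T) :
  (forall i, {for p, continuous (fun x => f x 0 i)}) -> {for p, continuous f}.
Proof.
move=> H.
have E : f = fun x => \sum_i f x 0 i *: (delta_mx 0 i : 'rV[K]_M).
  by apply/funext => x; rewrite {1}[f x]row_sum_delta.
rewrite E.
elim: (index_enum _) => [|i r IH].
  rewrite (_ : (fun x => _) = fun=> 0); first exact: cvg_cst.
  by apply/funext => x; rewrite big_nil.
rewrite (_ : (fun x => _) = fun x => f x 0 i *: (delta_mx 0 i : 'rV[K]_M) +
   \sum_(j <- r) f x 0 j *: (delta_mx 0 j : 'rV[K]_M)).
  by apply: cvgD => //; apply: cvgZr_tmp; exact: H.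
by apply/funext => x; rewrite big_cons.
Qed.

End RowContinuity.

Lemma continuous_mulmx {R : realType} {N : nat} (h : 'M[R]_N) :
  continuous (fun x : 'rV[R]_N => x *m h).
Proof.
move=> x; apply: continuous_row => j.
rewrite (_ : (fun x => _) = fun x : 'rV[R]_N => \sum_l x 0 l * h l j); last first.
  by apply/funext => y; rewrite mxE.
apply: continuous_fsum => l.
apply: (@continuousM _ _ (fun x : 'rV[R]_N => x 0 l) (fun=> h l j)).
  exact: coord_continuous.
exact: cst_continuous.
Qed.

(** * Rotation invariance of the equilibrium measure *)
Section Transfer.
Context {R : realType} {m : nat}.
Local Notation C := (cplx R).
Local Notation X := 'rV[R]_m.+2.
Local Notation V := 'rV[C]_(m.+2 + 1).
Local Notation Rp := (fun z : C => complex.Re (z : R[i])).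
Local Notation Ip := (fun z : C => complex.Im (z : R[i])).
Local Notation BV := (@borel_proj R m.+1).

Lemma continuous_nsq (N : nat) : continuous (fun z : 'rV[C]_N => nsq z).
Proof.
move=> z; rewrite (_ : (fun x => _) = fun z : 'rV[C]_N =>
    \sum_i (Rp (z 0 i) * Rp (z 0 i) + Ip (z 0 i) * Ip (z 0 i))); last first.
  by apply/funext => y; apply: eq_bigr => i _; rewrite sqr_cabs !expr2.
apply: continuous_fsum => i; apply: (@continuousD _ _ _
  (fun z : 'rV[C]_N => Rp (z 0 i) * Rp (z 0 i)) (fun z : 'rV[C]_N => Ip (z 0 i) * Ip (z 0 i))).
  apply: (@continuousM _ _ (fun z : 'rV[C]_N => Rp (z 0 i)) (fun z : 'rV[C]_N => Rp (z 0 i)));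
  by apply: (@continuous_comp _ _ _ (fun z : 'rV[C]_N => z 0 i) Rp);
    [exact: coord_continuous|exact: continuous_Re].
apply: (@continuousM _ _ (fun z : 'rV[C]_N => Ip (z 0 i)) (fun z : 'rV[C]_N => Ip (z 0 i)));
by apply: (@continuous_comp _ _ _ (fun z : 'rV[C]_N => z 0 i) Ip);
  [exact: coord_continuous|exact: continuous_Im].
Qed.

Lemma nsq_gt0P (N : nat) (z : 'rV[C]_N) : (0 < nsq z) = (z != 0).
Proof.
apply/idP/idP; last exact: nsq_gt0.
apply: contraTN => /eqP ->; rewrite /nsq big1 ?ltxx// => i _.
by rewrite mxE cabs0 expr0n.
Qed.

Lemma continuous_cabs2 (T : topologicalType) (f : T -> C) (p : T) :
  {for p, continuous f} -> {for p, continuous (fun x => cabs (f x) ^+ 2)}.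
Proof.
move=> cf; rewrite (_ : (fun x => _) =
  fun x => Rp (f x) * Rp (f x) + Ip (f x) * Ip (f x)); last first.
  by apply/funext => x; rewrite sqr_cabs !expr2.
have c1 : {for p, continuous (fun x => Rp (f x))}.
  by apply: (@continuous_comp _ _ _ f Rp) => //; exact: continuous_Re.
have c2 : {for p, continuous (fun x => Ip (f x))}.
  by apply: (@continuous_comp _ _ _ f Ip) => //; exact: continuous_Im.
apply: (@continuousD _ _ _ (fun x => Rp (f x) * Rp (f x)) (fun x => Ip (f x) * Ip (f x))).
  exact: (@continuousM _ _ (fun x => Rp (f x)) (fun x => Rp (f x))).
exact: (@continuousM _ _ (fun x => Ip (f x)) (fun x => Ip (f x))).
Qed.

Lemma measurable_quadric : measurable (@quadric R m.+1 : set BV).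
Proof.
pose g (z : V) : C := dsq (lsubmx z) - rsubmx z 0 0 ^+ 2.
have cg : continuous g.
  move=> z; apply: (@continuousB _ _ _ (fun z : V => dsq (lsubmx z))
    (fun z : V => rsubmx z 0 0 ^+ 2)).
    apply: continuous_fsum => i.
    rewrite (_ : (fun x => _) = fun z : V => z 0 (lshift 1 i) * z 0 (lshift 1 i)).
      by apply: (@continuousM _ _ (fun z : V => z 0 (lshift 1 i)) (fun z : V => z 0 (lshift 1 i)));
        exact: coord_continuous.
    by apply/funext => y; rewrite expr2 mxE.
  rewrite (_ : (fun x => _) = fun z : V => z 0 (rshift m.+2 0) * z 0 (rshift m.+2 0)).
    by apply: (@continuousM _ _ (fun z : V => z 0 (rshift m.+2 0))
      (fun z : V => z 0 (rshift m.+2 0))); exact: coord_continuous.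
  by apply/funext => y; rewrite expr2 mxE.
have gZ (c : C) z : g (c *: z) = c ^+ 2 * g z.
  have E : rsubmx (c *: z) 0 0 = c * rsubmx z 0 0 by rewrite !mxE.
  by rewrite /g E linearZ/= dsqZ exprMn mulrBr.
(* Both sets are saturated and open. *)
have -> : quadric = [set z : V | 0 < nsq z] `&` ~` [set z : V | 0 < cabs (g z) ^+ 2].
  apply/seteqP; split => z.
    move=> [z0 E]; split; first by rewrite /= nsq_gt0P.
    move=> /=; have -> : g z = 0 by apply/eqP; rewrite subr_eq0; apply/eqP.
    by rewrite cabs0 expr0n ltxx.
  rewrite /= nsq_gt0P => -[z0 /negP]; rewrite -leNgt => h.
  have : cabs (g z) ^+ 2 == 0 by rewrite eq_le h sqr_ge0.
  by rewrite expf_eq0/= cabs_eq0 subr_eq0 => /eqP E; split.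
have op (f : V -> R) : continuous f -> open [set z | 0 < f z].
  move=> cf; have /continuousP H := cf.
  have := H `]0, +oo[%classic (interval_open _ _).
  by rewrite preimage_itvoy; apply.
apply: (@measurableI _ BV).
  apply: sub_sigma_algebra; split; first by apply: op; exact: continuous_nsq.
  move=> z z' /= h [c c0 ->].
  by rewrite nsqZ mulr_gt0// exprn_gt0// cabs_gt0.
apply: (@measurableC _ BV); apply: sub_sigma_algebra; split.
  by apply: op => z; apply: continuous_cabs2; exact: cg.
move=> z z' /= h [c c0 ->].
by rewrite gZ cabsM exprMn mulr_gt0// exprn_gt0// cabs_gt0 expf_neq0.
Qed.

Lemma measurable_invariant (chi : V -> R) :
  (forall (c : C) z, c != 0 -> chi (c *: z) = chi z) ->
  (forall z, z != 0 -> {for z, continuous chi}) ->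
  measurable_fun (quadric : set BV) (chi : BV -> R).
Proof.
move=> inv cc mD; apply: (measurability _ (RGenOInfty.measurableE R)) => //.
move=> _ [_ [r ->] <-].
have -> : (quadric : set BV) `&` chi @^-1` `]r, +oo[%classic =
    quadric `&` [set z : V | z != 0 /\ r < chi z].
  apply/seteqP; split => z [Q] /=; rewrite ?in_itv/= ?andbT.
    by move=> h; split => //; split => //; case: Q.
  by move=> [_ h]; split.
apply: (@measurableI _ BV) => //; apply: sub_sigma_algebra; split; last first.
  move=> z z' [z0 h] [c c0 ->]; split; last by rewrite inv.
  by rewrite scaler_eq0 negb_or c0.
rewrite openE => z [z0 h].
have n0 : 0 < nsq z by rewrite nsq_gt0P.
have h1 : \forall z' \near z, r < chi z' by have := cc z z0 => /cvgr_gt/(_ _ h).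
have h2 : \forall z' \near z, 0 < nsq z'.
  by have := @continuous_nsq _ z => /cvgr_gt/(_ _ n0).
rewrite /interior; apply: filterS2 h1 h2 => z' a b; split => //.
by rewrite -nsq_gt0P.
Qed.

Lemma fineM_ge0 (k : R) (x : \bar R) : 0 <= k -> fine (k%:E * x) = k * fine x.
Proof.
rewrite le_eqVlt => /predU1P[<-|k0]; first by rewrite mul0e mul0r.
by case: x => [x| |] //=; rewrite ?gt0_muley ?gt0_muleNy ?lte_fin//= mulr0.
Qed.

Lemma continuous_embed : continuous (@embed R m.+1).
Proof.
move=> x; apply: continuous_row => i; case: (split_ordP i) => j ->.
  rewrite (_ : (fun x => _) = fun x : X => ((x 0 j)%:C)%C : C).
    apply: continuous_cplx; first exact: coord_continuous.
    exact: cst_continuous.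
  by apply/funext => y; rewrite row_mxEl mxE.
rewrite (_ : (fun x => _) = fun=> 1 : C); first exact: cst_continuous.
by apply/funext => y; rewrite row_mxEr mxE.
Qed.

Lemma embed_quadricP (x : X) : quadric (embed x) <-> sphere x.
Proof.
split; last exact: embed_quadric.
move=> [_]; rewrite row_mxKl row_mxKr mxE expr1n.
have := dsq_real x; rewrite /dsq => -> /eqP; rewrite eq_complex/= => /andP[/eqP h _].
exact: h.
Qed.

Lemma measurable_embed : measurable_fun setT (@embed R m.+1 : borel_rV R m.+1 -> BV).
Proof.
apply: (@measurability _ _ (borel_rV R m.+1) BV setT (@embed R m.+1) (@saturated_open R m.+1)) => //.
move=> _ [A [oA _] <-]; rewrite setTI; apply: sub_sigma_algebra.
have /continuousP H := continuous_embed; exact: H.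
Qed.

(** The image of the equilibrium measure under the embedding of the sphere is
    a multiple of the Monge-Ampere measure. *)
Lemma equilibrium_transfer (mueq : probability (borel_rV R m.+1) R)
  (mu : {measure set BV -> \bar R}) (k : R) (chi : V -> R) :
  mueq sphere = 1%E -> 0 <= k ->
  (forall A : set BV, measurable A -> A `<=` quadric ->
     mueq (sphere `&` embed @^-1` A) = (mu A * k%:E)%E) ->
  (forall z, 0 <= chi z) ->
  (forall (c : C) z, c != 0 -> chi (c *: z) = chi z) ->
  (forall z, z != 0 -> {for z, continuous chi}) ->
  sint mueq (fun x => chi (embed x)) =
  k * \int[mu]_(z in (quadric : set BV)) chi z.
Proof.
move=> m1 k0 E chi0 inv cc.
have mc := measurable_invariant inv cc.
pose kn : {nonneg R} := NngNum k0.
pose mix := isMeasurableFun.Build _ _ _ _ _ measurable_embed.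
pose phi : {mfun (borel_rV R m.+1) >-> BV} := HB.pack (@embed R m.+1) mix.
have E1 : (\int[pushforward mueq phi]_(z in (quadric : set BV)) (chi z)%:E =
    \int[mscale kn mu]_(z in (quadric : set BV)) (chi z)%:E)%E.
  apply: eq_measure_integral => A mA AQ.
  transitivity (mu A * k%:E)%E; last by rewrite muleC.
  rewrite -E//; congr (mueq _).
  by apply/seteqP; split => x /=; [move=> Ax; split => //; apply/embed_quadricP; exact: AQ|case].
rewrite ge0_integral_pushforward// in E1; first last.
- by move=> z _; rewrite lee_fin.
- exact/measurable_EFinP.
- exact: measurable_quadric.
rewrite ge0_integral_mscale// in E1; first last.
- by move=> z _; rewrite lee_fin.
- exact/measurable_EFinP.
- exact: measurable_quadric.
rewrite /Rintegral -fineM_ge0// -E1 /sint /Rintegral; congr fine.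
have -> : phi @^-1` quadric = sphere.
  by apply/seteqP; split => x /embed_quadricP.
by [].
Qed.

End Transfer.

Section ContinuityRules.
Context {R : realType} {T : topologicalType}.
Implicit Types (f g : T -> R) (p : T).

Lemma ctsM f g p : {for p, continuous f} -> {for p, continuous g} ->
  {for p, continuous (fun x => f x * g x)}.
Proof. by move=> cf cg; exact: cvgM. Qed.

Lemma ctsD f g p : {for p, continuous f} -> {for p, continuous g} ->
  {for p, continuous (fun x => f x + g x)}.
Proof. by move=> cf cg; exact: cvgD. Qed.

Lemma cts_cst (c : R) p : {for p, continuous (fun _ : T => c)}.
Proof. exact: cvg_cst. Qed.

Lemma ctsV f p : f p != 0 -> {for p, continuous f} -> {for p, continuous (fun x => (f x)^-1)}.
Proof. by move=> f0 cf; exact: cvgV. Qed.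

Definition pos_part (a : R) : R := (a + `|a|) / 2.

Lemma pos_part_ge0 a : 0 <= pos_part a.
Proof. by rewrite divr_ge0// -lerBlDl sub0r -normrN ler_norm. Qed.

Lemma le_pos_part a : a <= pos_part a.
Proof. by rewrite ler_pdivlMr// mulr_natr mulr2n lerD2l ler_norm. Qed.

Lemma pos_part_neq0 a : pos_part a != 0 -> 0 < a.
Proof.
rewrite ltNge; apply: contra => a0.
by rewrite /pos_part ler0_norm// subrr mul0r.
Qed.

Lemma cts_pos_part f p : {for p, continuous f} -> {for p, continuous (fun x => pos_part (f x))}.
Proof.
move=> cf; apply: ctsM; last exact: cts_cst.
by apply: ctsD => //; apply: cvg_norm.
Qed.

End ContinuityRules.

Section Invariance.
Context {R : realType} {m : nat}.
Local Notation C := (cplx R).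
Local Notation X := 'rV[R]_m.+2.
Local Notation V := 'rV[C]_(m.+2 + 1).
Local Notation W := 'rV[C]_m.+1.
Local Notation Rp := (fun z : C => complex.Re (z : R[i])).
Local Notation Ip := (fun z : C => complex.Im (z : R[i])).
Local Notation BV := (@borel_proj R m.+1).
Implicit Types (h : 'M[R]_m.+2) (z : V) (F : X -> R).

Let i1 : 'I_m.+2 := lift ord0 ord0.
Let ii : C := (0 +i* 1)%C.
(* Some coordinate of a point of the sphere has square at least [1 / (m + 2)], so a
   threshold below half of this leaves the rotated cutoffs without common zero. *)
Let c0 : R := (4 * m.+2%:R)^-1.

Let c0_gt0 : 0 < c0.
Proof. by rewrite invr_gt0 mulr_gt0// ltr0n. Qed.

Definition act h z : V := row_mx (lsubmx z *m toCmx h) (rsubmx z).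

Definition ell0 z : C := lsubmx z 0 ord0 - ii * lsubmx z 0 i1.

(** A function of the points of the quadric that restricts to the identity on
    the sphere: it extends functions on the sphere to the quadric. *)
Definition xi z : X := \row_i (2 * (Rp (lsubmx z 0 i) * Rp (rsubmx z 0 0) +
  Ip (lsubmx z 0 i) * Ip (rsubmx z 0 0)) / nsq z).

(** A point whose linear form is at least a fixed fraction of its norm has
    bounded chart coordinates, so [cutoff] has compact support in the chart. *)
Definition cutoff z : R := pos_part (cabs (ell0 z) ^+ 2 / nsq z - c0).

Definition bump F z : R := F (xi z) * cutoff z.

Definition cutoffr (x : X) : R := pos_part ((x 0 ord0 ^+ 2 + x 0 i1 ^+ 2) / 2 - c0).

Lemma ell_act h z : ell h z = ell0 (act h^T z).
Proof. by rewrite /ell /ell0 /yvec /act row_mxKl. Qed.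

Lemma actZ h (c : C) z : act h (c *: z) = c *: act h z.
Proof. by rewrite /act scale_row_mx !linearZ/= -scalemxAl. Qed.

Lemma nsq_act h z : ortho h -> nsq (act h z) = nsq z.
Proof. by move=> H; rewrite nsq_row_mx nsq_ortho// -nsq_row_mx hsubmxK. Qed.

Lemma act_qchart h w : ortho h -> act h^T (qchart h w) = qchart 1%:M w.
Proof.
move=> H; rewrite /act /qchart row_mxKl row_mxKr -mulmxA (toCmx_ortho H).
have -> : toCmx 1%:M = 1%:M :> 'M[C]_m.+2; last by [].
by apply/matrixP => i j; rewrite !mxE; case: (i == j).
Qed.

Lemma act_embed h (x : X) : act h (embed x) = embed (x *m h).
Proof.
by rewrite /act /embed row_mxKl row_mxKr; congr row_mx; rewrite (map_mxM (real_complex R)).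
Qed.

Lemma ratio_cancel (k a b : R) : k != 0 -> (k * a) / (k * b) = a / b.
Proof. by move=> k0; rewrite invfM mulrACA divff// mul1r. Qed.

Lemma xiZ (c : C) z : c != 0 -> xi (c *: z) = xi z.
Proof.
move=> cn; apply/rowP => i; rewrite [LHS]mxE [RHS]mxE nsqZ !linearZ/=.
rewrite [(c *: lsubmx z) 0 i]mxE [(c *: rsubmx z) 0 0]mxE.
set a := lsubmx z 0 i; set b := rsubmx z 0 0.
rewrite -(@ratio_cancel (cabs c ^+ 2) _ (nsq z)); last first.
  by rewrite expf_neq0// cabs_eq0.
congr (_ / _); rewrite sqr_cabs !(ReIm_mul _ _).1 !(ReIm_mul _ _).2.
by ring.
Qed.

Lemma cutoffZ (c : C) z : c != 0 -> cutoff (c *: z) = cutoff z.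
Proof.
move=> cn; rewrite /cutoff nsqZ; congr (pos_part (_ - _)).
have -> : ell0 (c *: z) = c * ell0 z.
  by rewrite /ell0 linearZ/= ![(c *: lsubmx z) _ _]mxE; ring.
by rewrite cabsM exprMn ratio_cancel// expf_neq0// cabs_eq0.
Qed.

Lemma bumpZ F (c : C) z : c != 0 -> bump F (c *: z) = bump F z.
Proof. by move=> cn; rewrite /bump xiZ// cutoffZ. Qed.

Let cts_coord (z : V) i : {for z, continuous (fun z : V => lsubmx z 0 i)}.
Proof.
rewrite (_ : (fun x => _) = fun z : V => z 0 (lshift 1 i)); first exact: coord_continuous.
by apply/funext => y; rewrite mxE.
Qed.

Let cts_last (z : V) : {for z, continuous (fun z : V => rsubmx z 0 0)}.
Proof.
rewrite (_ : (fun x => _) = fun z : V => z 0 (rshift m.+2 0)); first exact: coord_continuous.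
by apply/funext => y; rewrite mxE.
Qed.

Let ctsRe (T : topologicalType) (f : T -> C) p : {for p, continuous f} ->
  {for p, continuous (fun x => Rp (f x))}.
Proof. by move=> cf; apply: (@continuous_comp _ _ _ f Rp) => //; exact: continuous_Re. Qed.

Let ctsIm (T : topologicalType) (f : T -> C) p : {for p, continuous f} ->
  {for p, continuous (fun x => Ip (f x))}.
Proof. by move=> cf; apply: (@continuous_comp _ _ _ f Ip) => //; exact: continuous_Im. Qed.

Lemma bump_continuous F z : continuous F -> z != 0 -> {for z, continuous (bump F)}.
Proof.
move=> cF z0; have n0 : nsq z != 0 by rewrite gt_eqF// nsq_gt0P.
have cN : {for z, continuous (fun z : V => (nsq z)^-1)}.
  by apply: ctsV => //; exact: continuous_nsq.
apply: ctsM.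
  apply: (@continuous_comp _ _ _ xi F); last exact: cF.
  apply: continuous_row => i.
  rewrite (_ : (fun x => _) = fun z => 2 * (Rp (lsubmx z 0 i) * Rp (rsubmx z 0 0) +
    Ip (lsubmx z 0 i) * Ip (rsubmx z 0 0)) / nsq z); last first.
    by apply/funext => y; rewrite mxE.
  apply: ctsM cN; apply: ctsM; first exact: cts_cst.
  by apply: ctsD; apply: ctsM; try apply: ctsRe; try apply: ctsIm;
    try exact: cts_coord; exact: cts_last.
apply: cts_pos_part; apply: ctsD; last exact: cts_cst.
apply: ctsM cN; apply: continuous_cabs2.
apply: (@continuousB _ _ _ (fun z : V => lsubmx z 0 ord0)
  (fun z : V => ii * lsubmx z 0 i1)); first exact: cts_coord.
apply: (@continuousM _ _ (fun=> ii) (fun z : V => lsubmx z 0 i1)); last exact: cts_coord.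
exact: cst_continuous.
Qed.

Lemma act_neq0 h z : ortho h -> z != 0 -> act h z != 0.
Proof. by move=> H; rewrite -!nsq_gt0P nsq_act. Qed.

Lemma continuous_act h : continuous (act h).
Proof.
move=> z; apply: continuous_row => i; case: (split_ordP i) => j ->.
  rewrite (_ : (fun x => _) = fun z : V => \sum_l lsubmx z 0 l * toCmx h l j); last first.
    by apply/funext => y; rewrite row_mxEl mxE.
  apply: continuous_fsum => l.
  apply: (@continuousM _ _ (fun z : V => lsubmx z 0 l) (fun=> toCmx h l j)).
    exact: cts_coord.
  exact: cst_continuous.
rewrite (_ : (fun x => _) = fun z : V => rsubmx z 0 0); first exact: cts_last.
by apply/funext => y; rewrite row_mxEr ord1.
Qed.

Lemma bump_act_continuous F h z : continuous F -> ortho h -> z != 0 ->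
  {for z, continuous (fun z => bump F (act h z))}.
Proof.
move=> cF H z0; apply: (@continuous_comp _ _ _ (act h) (bump F)).
  exact: continuous_act.
by apply: bump_continuous => //; exact: act_neq0.
Qed.

Lemma coord_le_nsq (N : nat) (z : 'rV[C]_N) i : cabs (z 0 i) ^+ 2 <= nsq z.
Proof.
by rewrite /nsq (bigD1 i)//= lerDl; apply: sumr_ge0 => j _; exact: sqr_ge0.
Qed.

Lemma bump_test F h : continuous F -> ortho h ->
  test_function setT (qchart h) (fun z => bump F (act h^T z)).
Proof.
move=> cF H; have H' := ortho_tr H; split.
- by move=> z _ _ [c cn ->]; rewrite actZ bumpZ.
- apply: continuous_in_subspaceT => z /set_mem[z0 _].
  exact: bump_act_continuous.
pose r : R := Num.sqrt c0^-1.
exists [set w : W | forall i, [set z : C | cabs z <= r] (w ord0 i)]; split => //.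
  by apply: (@rV_compact C m.+1 (fun=> [set z : C | cabs z <= r])) => i; exact: compact_disc.
move=> z Qz; rewrite mulf_eq0 negb_or => /andP[_ /pos_part_neq0].
rewrite subr_gt0 -ell_act nsq_act// => hl.
have [z0 _] := Qz; have n0 : 0 < nsq z by rewrite nsq_gt0P.
have e0 : ell h z != 0.
  apply: contraTN hl => /eqP ->; rewrite cabs0 expr0n mul0r -leNgt; exact: ltW.
set y := (ell h z)^-1 *: z.
exists (chart_inv h y); last exact: same_point_qchart.
move=> i; rewrite /= -(@ler_pXn2r _ 2) ?nnegrE ?cabs_ge0 ?sqrtr_ge0//.
rewrite sqr_sqrtr ?invr_ge0 ?(ltW c0_gt0)//.
apply: (@le_trans _ _ (nsq (act h^T y))).
  rewrite mxE; case: unliftP => [k _|_].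
    have := coord_le_nsq (act h^T y) (lshift 1 (lift ord0 (lift ord0 k))).
    by rewrite row_mxEl.
  have := coord_le_nsq (act h^T y) (rshift m.+2 0).
  by rewrite row_mxEr.
have e1 : 0 < cabs (ell h z) ^+ 2 by rewrite exprn_gt0// cabs_gt0.
have E : cabs (ell h z)^-1 * cabs (ell h z) = 1 by rewrite -cabsM mulVf// cabs1.
rewrite nsq_act// nsqZ -(ler_pM2l e1) mulrA -exprMn mulrC [cabs (ell h z) * _]mulrC E.
rewrite expr1n mulr1 ler_pdivlMr//.
by move: hl; rewrite ltr_pdivlMr// [c0 * _]mulrC => /ltW.
Qed.

Lemma nsq_embed (x : X) : sphere x -> nsq (embed x) = 2.
Proof.
move=> sx; rewrite nsq_row_mx nsq_real sx.
by rewrite /nsq big_ord1 mxE cabs1 expr1n.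
Qed.

Lemma bump_embed F (x : X) : sphere x -> bump F (embed x) = F x * cutoffr x.
Proof.
move=> sx; rewrite /bump; congr (F _ * _).
  apply/rowP => i; rewrite mxE nsq_embed// row_mxKl row_mxKr !mxE/=.
  by rewrite mulr1 mulr0 addr0 mulrAC divff ?mul1r// pnatr_eq0.
rewrite /cutoff /cutoffr nsq_embed//; congr (pos_part (_ / _ - _)).
rewrite /ell0 row_mxKl !mxE sqr_cabs/=; ring.
Qed.

Lemma sphere_ortho h (x : X) : ortho h -> sphere x -> sphere (x *m h).
Proof. by move=> H /sphere_dot sx; apply/sphere_dot; rewrite ortho_dot. Qed.

(** A function supported in the image of one chart and its rotated copy,
    supported in the image of the rotated chart, have the same expression in
    coordinates. *)
Lemma equilibrium_chart_invariance (mueq : probability (borel_rV R m.+1) R) F h :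
  equilibrium_measure mueq -> continuous F -> (forall x, 0 <= F x) -> ortho h ->
  sint mueq (fun x => F (x *m h) * cutoffr (x *m h)) = sint mueq (fun x => F x * cutoffr x).
Proof.
move=> [m1 [mu [nu [MA _ E]]]] cF F0 H.
have k0 : 0 <= (fine (nu quadric))^-1 by rewrite invr_ge0 fine_ge0.
have key (k : 'M[R]_m.+2) : ortho k ->
    sint mueq (fun x => F (x *m k) * cutoffr (x *m k)) =
    (fine (nu quadric))^-1 * \int[mu]_(z in (quadric : set BV)) bump F (act k z).
  move=> K; rewrite -(equilibrium_transfer m1 k0 E).
  - by apply: eq_sint => x sx; rewrite act_embed bump_embed//; exact: sphere_ortho.
  - by move=> z; rewrite mulr_ge0// pos_part_ge0.
  - by move=> c z cn; rewrite actZ bumpZ.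
  - by move=> z z0; exact: bump_act_continuous.
have k1 := key _ H.
have k2 : sint mueq (fun x => F x * cutoffr x) =
    (fine (nu quadric))^-1 * \int[mu]_(z in (quadric : set BV)) bump F (act 1%:M z).
  by rewrite -(key _ ortho1); apply: eq_sint => x _; rewrite mulmx1.
have Ht := ortho_tr H.
have t1 := bump_test cF Ht; have t2 := bump_test cF ortho1.
rewrite trmxK in t1; rewrite trmx1 in t2.
have k3 : \int[mu]_(z in (quadric : set BV)) bump F (act h z) =
    \int[mu]_(z in (quadric : set BV)) bump F (act 1%:M z).
  apply: (@monge_ampere_rotation _ _ mu h^T _ _ MA Ht t1 t2) => w.
  have a1 := act_qchart w Ht; rewrite trmxK in a1; rewrite a1.
  by have a2 := act_qchart w (ortho1 : ortho (1%:M : 'M[R]_m.+2)); rewrite trmx1 in a2; rewrite a2.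
rewrite k3 in k1.
exact (eq_trans k1 (esym k2)).
Qed.

Lemma continuous_cutoffr : continuous cutoffr.
Proof.
move=> x; apply: (@cts_pos_part _ _ (fun x : X => (x 0 ord0 ^+ 2 + x 0 i1 ^+ 2) / 2 - c0)).
apply: (@ctsD _ _ (fun x : X => (x 0 ord0 ^+ 2 + x 0 i1 ^+ 2) / 2)); last exact: cts_cst.
apply: ctsM; last exact: cts_cst.
rewrite (_ : (fun x => _) = fun x : X => x 0 ord0 * x 0 ord0 + x 0 i1 * x 0 i1).
  by apply: ctsD; apply: ctsM; exact: coord_continuous.
by apply/funext => y; rewrite !expr2.
Qed.

(** A partition of unity by rotated cutoffs upgrades the invariance inside the
    charts to full rotation invariance. *)
Lemma equilibrium_ge0_invariance (mueq : probability (borel_rV R m.+1) R) F g :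
  equilibrium_measure mueq -> continuous F -> (forall x, 0 <= F x) -> ortho g ->
  sint mueq (fun x => F (x *m g)) = sint mueq F.
Proof.
move=> Eq cF F0 G; have [m1 _] := Eq.
pose r (i : 'I_m.+2) : 'M[R]_m.+2 := refl (delta_mx 0 i - delta_mx 0 ord0).
have rO i : ortho (r i) by exact: refl_ortho.
have r0 i (x : X) : (x *m r i) 0 ord0 = x 0 i.
  have d (y : X) j : y 0 j = dot y (delta_mx 0 j).
    rewrite /dot (bigD1 j)//= big1 ?addr0; last first.
      by move=> l lj; rewrite !mxE (negbTE lj) andbF mulr0.
    by rewrite mxE !eqxx mulr1.
  rewrite (d (x *m r i)) (d x) -(ortho_dot x (delta_mx 0 i) (rO i)); congr (dot _ _).
  by rewrite refl_swap// !dot_delta !eqxx.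
pose P (x : X) : R := \sum_i cutoffr (x *m r i).
have cP : continuous P.
  move=> x; apply: continuous_fsum => i.
  apply: (@continuous_comp _ _ _ (fun x : X => x *m r i) cutoffr).
    exact: continuous_mulmx.
  exact: continuous_cutoffr.
pose S (x : X) : R := c0 + pos_part (P x - c0).
have cS : continuous S.
  move=> x; apply: (@ctsD _ _ (fun=> c0) (fun x => pos_part (P x - c0))).
    exact: cts_cst.
  apply: (@cts_pos_part _ _ (fun x => P x - c0)).
  by apply: (@ctsD _ _ P (fun=> - c0)); [exact: cP|exact: cts_cst].
have S0 x : 0 < S x by rewrite ltr_pwDl// pos_part_ge0.
have SE x : sphere x -> S x = P x.
  move=> sx; have ge : c0 <= P x.
    have [i hi] : exists i, m.+2%:R^-1 <= x 0 i ^+ 2.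
      apply: contrapT => /forallNP no.
      have : \sum_(i < m.+2) x 0 i ^+ 2 < \sum_(i < m.+2) (m.+2%:R^-1 : R).
        apply: ltr_sum; first by apply/hasP; exists ord0; rewrite ?mem_index_enum.
        by move=> i _; rewrite ltNge; apply/negP; exact: no.
      rewrite sumr_const card_ord -[_ *+ _]mulr_natl divff ?pnatr_eq0//.
      by move: sx; rewrite /sphere/= => ->; rewrite ltxx.
    rewrite /P (bigD1 i)//= -[leLHS]addr0; apply: lerD; last first.
      by apply: sumr_ge0 => j _; exact: pos_part_ge0.
    apply: le_trans (le_pos_part _); rewrite r0.
    have E4 : m.+2%:R^-1 = 4 * c0 :> R.
      by rewrite /c0 invfM mulrA divff ?mul1r// pnatr_eq0.
    have := sqr_ge0 ((x *m r i) 0 i1); move: hi; rewrite E4; lra.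
  rewrite /S /pos_part ger0_norm ?subr_ge0//.
  by move: (P x) => t; field.
pose Gi i (y : X) := F (y *m (r i)^T) / S (y *m (r i)^T).
have cG i : continuous (Gi i).
  move=> y; apply: (@ctsM _ _ (fun y : X => F (y *m (r i)^T)) (fun y => (S (y *m (r i)^T))^-1)).
    by apply: (@continuous_comp _ _ _ (fun x : X => x *m (r i)^T) F);
      [exact: continuous_mulmx|exact: cF].
  apply: (@ctsV _ _ (fun y : X => S (y *m (r i)^T))); first by rewrite gt_eqF.
  by apply: (@continuous_comp _ _ _ (fun x : X => x *m (r i)^T) S);
    [exact: continuous_mulmx|exact: cS].
have G0 i y : 0 <= Gi i y by rewrite divr_ge0// ltW.
have rK i (x : X) : x *m r i *m (r i)^T = x.
  by rewrite -mulmxA (rO i) mulmx1.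
have dec x : sphere x -> F x = \sum_i Gi i (x *m r i) * cutoffr (x *m r i).
  move=> sx; transitivity (F x / S x * P x).
    by rewrite -SE// divfK// gt_eqF.
  by rewrite mulr_sumr; apply: eq_bigr => i _; rewrite /Gi rK.
have cA (k : 'M[R]_m.+2) i : continuous (fun x : X => Gi i (x *m k) * cutoffr (x *m k)).
  move=> x; apply: (@ctsM _ _ (fun x : X => Gi i (x *m k)) (fun x => cutoffr (x *m k))).
    by apply: (@continuous_comp _ _ _ (fun x : X => x *m k) (Gi i));
      [exact: continuous_mulmx|exact: cG].
  by apply: (@continuous_comp _ _ _ (fun x : X => x *m k) cutoffr);
    [exact: continuous_mulmx|exact: continuous_cutoffr].
have -> : sint mueq F = sint mueq (fun x => \sum_i Gi i (x *m r i) * cutoffr (x *m r i)).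
  by apply: eq_sint => x; exact: dec.
have -> : sint mueq (fun x => F (x *m g)) =
    sint mueq (fun x => \sum_i Gi i (x *m (g *m r i)) * cutoffr (x *m (g *m r i))).
  apply: eq_sint => x sx; rewrite dec; last exact: sphere_ortho.
  by apply: eq_bigr => i _; rewrite !mulmxA.
have s1 := (sint_sum m1 (index_enum 'I_m.+2) (fun i => cA (r i) i)).1.
have s2 := (sint_sum m1 (index_enum 'I_m.+2) (fun i => cA (g *m r i) i)).1.
rewrite s1 s2; apply: eq_bigr => i _.
rewrite (equilibrium_chart_invariance Eq (cG i) (G0 i) (orthoM G (rO i))).
by rewrite (equilibrium_chart_invariance Eq (cG i) (G0 i) (rO i)).
Qed.

(** A continuous function becomes nonnegative on the sphere when a constant is
    added. *)
Theorem equilibrium_invariance (mueq : probability (borel_rV R m.+1) R) F g :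
  equilibrium_measure mueq -> continuous F -> ortho g ->
  sint mueq (fun x => F (x *m g)) = sint mueq F.
Proof.
move=> Eq cF G; have [m1 _] := Eq.
have [B B0 HB] := continuous_bounded cF.
pose F' x := pos_part (F x + B).
have cF' : continuous F'.
  move=> x; apply: (@cts_pos_part _ _ (fun x => F x + B)).
  by apply: (@ctsD _ _ F (fun=> B)); [exact: cF|exact: cts_cst].
have F'E x : sphere x -> F' x = F x + B.
  move=> /HB; rewrite ler_norml => /andP[h _]; rewrite /F' /pos_part ger0_norm; first by field.
  by rewrite -lerBlDr sub0r.
have := equilibrium_ge0_invariance Eq cF' (fun x => pos_part_ge0 _) G.
have -> : sint mueq (fun x => F' (x *m g)) = sint mueq (fun x => F (x *m g)) + B.
  rewrite -[in RHS](sint_cst m1 B) -sintD//; last exact: cst_continuous.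
    by apply: eq_sint => x sx; rewrite F'E//; exact: sphere_ortho.
  move=> x; apply: (@continuous_comp _ _ _ (fun x : X => x *m g) F); last exact: cF.
  exact: continuous_mulmx.
have -> : sint mueq F' = sint mueq F + B.
  rewrite -[in RHS](sint_cst m1 B) -sintD//; last exact: cst_continuous.
  by apply: eq_sint => x sx; rewrite F'E.
by move/addIr.
Qed.

End Invariance.

(** * Rotation-invariant probabilities on the sphere *)
Section InvariantIntegral.
Context {R : realType} {n : nat}.
Local Notation X := 'rV[R]_n.+1.
Variable sigma : probability (borel_rV R n) R.
Hypothesis sigma1 : sigma sphere = 1%E.
Hypothesis sigma_inv : forall (F : X -> R) g, continuous F -> ortho g ->
  sint sigma (fun x => F (x *m g)) = sint sigma F.
Local Notation I := (sint sigma).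

Lemma continuous_rotated (F : X -> R) (g : 'M[R]_n.+1) :
  continuous F -> continuous (fun x : X => F (x *m g)).
Proof.
move=> cF x; apply: (@continuous_comp _ _ _ (fun x : X => x *m g) F); last exact: cF.
exact: continuous_mulmx.
Qed.

(** Finitely many rotated copies of a set where [h] is bounded away from zero
    cover the sphere. *)
Lemma sint_sqr_eq0 (h : X -> R) : continuous h ->
  I (fun x => h x ^+ 2) = 0 -> forall x, sphere x -> h x = 0.
Proof.
move=> ch H0 p sp; apply/eqP; apply: contrapT => /negP hp.
have cH : continuous (fun x => h x ^+ 2).
  rewrite (_ : (fun x => _) = fun x => h x * h x); last by apply/funext => x; rewrite expr2.
  by move=> x; apply: (@continuousM _ _ h h); exact: ch.
pose d := h p ^+ 2 / 2.
have d0 : 0 < d by rewrite divr_gt0// exprn_even_gt0.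
pose g (x : X) : 'M[R]_n.+1 := refl (x - p).
have gE x : sphere x -> x *m g x = p.
  by move=> /sphere_dot sx; apply: refl_swap; rewrite sx; apply/esym/sphere_dot.
pose U (x : X) := (fun y => h (y *m g x) ^+ 2) @^-1` [set t | d < t].
have := @compact_sphere R n; rewrite compact_cover => /(_ X sphere U)[].
- move=> x _; have /continuousP := @continuous_rotated _ (g x) cH; apply.
  exact: open_gt.
- move=> x sx; exists x => //; rewrite /U/= gE// /d; have := d0; rewrite /d; lra.
move=> D' _ cov.
have [S cS] := sint_sum sigma1 (finmap.enum_fset D') (fun x => @continuous_rotated _ (g x) cH).
have : I (fun=> d) <= I (fun y => \sum_(x <- finmap.enum_fset D') h (y *m g x) ^+ 2).
  apply: le_sint => //; first exact: cst_continuous.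
  move=> y sy; have [x xD /ltW dx] := cov y sy.
  rewrite (big_rem x)//=; apply: le_trans dx _; rewrite lerDl.
  by apply: sumr_ge0 => i _; exact: sqr_ge0.
rewrite sint_cst// S big1; last first.
  by move=> x _; rewrite (sigma_inv cH) ?H0//; exact: refl_ortho.
by rewrite leNgt d0.
Qed.

End InvariantIntegral.

(** * Polynomial functions on the sphere *)
Section PolynomialFunctions.
Context {R : realType} {n : nat}.
Local Notation X := 'rV[R]_n.+1.
Implicit Types (f g : X -> R) (x y : X) (a : 'I_n.+1 -> nat) (k l : nat).

Definition polyfun k f := exists2 p : mpoly n.+1 R, (msize p <= k.+1)%N &
  forall x, f x = meval (fun i => x 0 i) p.

Definition mono a x : R := \prod_i x 0 i ^+ a i.

Lemma polyfun_mono k a : (\sum_i a i <= k)%N -> polyfun k (mono a).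
Proof.
move=> ak; exists (mpolyX R (Multinom [tuple a i | i < n.+1])).
  by rewrite msizeX mdegE ltnS; under eq_bigr do rewrite mnmE.
by move=> x; rewrite mevalX; apply: eq_bigr => i _; rewrite mnmE.
Qed.

Lemma polyfunE k f : polyfun k f -> exists (s : seq (multinom n.+1)) (c : multinom n.+1 -> R),
  (forall u, u \in s -> (\sum_i u i <= k)%N) /\
  forall x, f x = \sum_(u <- s) c u * mono u x.
Proof.
move=> [p hp E]; exists (msupp p), (fun u => mcoeff u p); split.
  by move=> u us; rewrite -mdegE -ltnS; apply: leq_trans hp; exact: msize_mdeg_lt.
by move=> x; rewrite E mevalE.
Qed.

Lemma polyfun_le k l f : (k <= l)%N -> polyfun k f -> polyfun l f.
Proof. by move=> kl [p hp E]; exists p => //; apply: leq_trans hp _. Qed.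

Lemma polyfun_cst k (c : R) : polyfun k (fun=> c).
Proof.
exists (mpolyC n.+1 c); last by move=> x; rewrite mevalC.
by rewrite mmeasureC; case: (_ != _).
Qed.

Lemma polyfunD k f g : polyfun k f -> polyfun k g -> polyfun k (fun x => f x + g x).
Proof.
move=> [p hp E] [q hq E']; exists (p + q); last by move=> x; rewrite E E' mevalD.
by apply: leq_trans (@mmeasureD_le n.+1 R (@mdeg _) p q) _; rewrite geq_max hp.
Qed.

Lemma polyfunM k l f g : polyfun k f -> polyfun l g -> polyfun (k + l) (fun x => f x * g x).
Proof.
move=> [p hp E] [q hq E']; exists (p * q); last by move=> x; rewrite E E' mevalM.
have [->|p0] := eqVneq p 0; first by rewrite mul0r mmeasure0.
have [->|q0] := eqVneq q 0; first by rewrite mulr0 mmeasure0.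
by rewrite msizeM// -ltnS prednK ?addn_gt0 ?lt0n ?mmeasure_poly_eq0 ?p0// -addSn -addnS leq_add.
Qed.

Lemma polyfunZ k (c : R) f : polyfun k f -> polyfun k (fun x => c * f x).
Proof. exact: polyfunM (polyfun_cst 0 c). Qed.

Lemma polyfun_sum k (J : Type) (r : seq J) (F : J -> X -> R) :
  (forall j, polyfun k (F j)) -> polyfun k (fun x => \sum_(j <- r) F j x).
Proof.
move=> H; elim: r => [|j r IH].
  by rewrite (_ : (fun x => _) = fun=> 0); [exact: polyfun_cst|apply/funext => x; rewrite big_nil].
rewrite (_ : (fun x => _) = fun x => F j x + \sum_(i <- r) F i x).
  exact: polyfunD.
by apply/funext => x; rewrite big_cons.
Qed.

Lemma polyfun_prod (J : Type) (r : seq J) (d : J -> nat) (F : J -> X -> R) :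
  (forall j, polyfun (d j) (F j)) ->
  polyfun (\sum_(j <- r) d j) (fun x => \prod_(j <- r) F j x).
Proof.
move=> H; elim: r => [|j r IH].
  by rewrite (_ : (fun x => _) = fun=> 1); [exact: polyfun_cst|apply/funext => x; rewrite big_nil].
rewrite (_ : (fun x => _) = fun x => F j x * \prod_(i <- r) F i x).
  by rewrite big_cons; exact: polyfunM.
by apply/funext => x; rewrite big_cons.
Qed.

Lemma polyfunX k m f : polyfun k f -> polyfun (m * k) (fun x => f x ^+ m).
Proof.
move=> H; have := @polyfun_prod _ (index_enum 'I_m) (fun=> k) (fun=> f) (fun=> H).
rewrite sum_nat_const card_ord (_ : (fun x => _) = fun x => f x ^+ m)//.
by apply/funext => x; rewrite prodr_const card_ord.
Qed.

Lemma polyfun_coord i : polyfun 1 (fun x => x 0 i).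
Proof.
exists (mpolyX R (mnm1 i)); first by rewrite msizeX mdeg1.
by move=> x; rewrite mevalXU.
Qed.

Lemma polyfun_dot y : polyfun 1 (fun x => dot x y).
Proof.
apply: polyfun_sum => i; rewrite (_ : (fun x => _) = fun x => y 0 i * x 0 i).
  by apply: polyfunZ; exact: polyfun_coord.
by apply/funext => x; rewrite mulrC.
Qed.

Lemma polyfun_ind (P : (X -> R) -> Prop) k f :
  P (fun=> 0) ->
  (forall f g, P f -> P g -> P (fun x => f x + g x)) ->
  (forall c a, (\sum_i a i <= k)%N -> P (fun x => c * mono a x)) ->
  polyfun k f -> P f.
Proof.
move=> P0 PD PM /polyfunE[s [c [hs E]]]; have -> : f = fun x => \sum_(u <- s) c u * mono u x.
  exact/funext.
elim: s hs {E} => [|u s IH] hs.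
  by rewrite (_ : (fun x => _) = fun=> 0)//; apply/funext => x; rewrite big_nil.
rewrite (_ : (fun x => _) = fun x => c u * mono u x + \sum_(v <- s) c v * mono v x).
  apply: PD; first by apply: PM; apply: hs; rewrite mem_head.
  by apply: IH => v vs; apply: hs; rewrite in_cons vs orbT.
by apply/funext => x; rewrite big_cons.
Qed.

Lemma polyfun_mulmx k f (g : 'M[R]_n.+1) : polyfun k f -> polyfun k (fun x => f (x *m g)).
Proof.
apply: (@polyfun_ind (fun f => polyfun k (fun x => f (x *m g)))).
- exact: polyfun_cst.
- by move=> u v; exact: polyfunD.
move=> c a ak; apply: polyfunZ; apply: polyfun_le ak _.
apply: polyfun_prod => i.
have := @polyfunX 1 (a i) (fun x => (x *m g) 0 i); rewrite muln1; apply.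
rewrite (_ : (fun x => _) = fun x => dot x (\row_l g l i)); first exact: polyfun_dot.
by apply/funext => x; rewrite mxE; apply: eq_bigr => l _; rewrite mxE.
Qed.

Lemma polyfun_continuous k f : polyfun k f -> continuous f.
Proof.
apply: (@polyfun_ind (fun f => continuous f)).
- by move=> x; exact: cst_continuous.
- by move=> u v cu cv x; apply: (@continuousD _ _ _ u v); [exact: cu|exact: cv].
move=> c a _ x; apply: (@continuousM _ _ (fun=> c) (mono a)); first exact: cst_continuous.
rewrite /mono; elim: (index_enum _) => [|i r IH].
  rewrite (_ : (fun x => _) = fun=> 1); first exact: cst_continuous.
  by apply/funext => y; rewrite big_nil.
rewrite (_ : (fun x => _) = fun x => x 0 i ^+ a i * \prod_(j <- r) x 0 j ^+ a j).
  apply: (@continuousM _ _ (fun x : X => x 0 i ^+ a i)) => //.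
  elim: (a i) => [|d IHd].
    rewrite (_ : (fun x => _) = fun=> 1); first exact: cst_continuous.
    by apply/funext => y; rewrite expr0.
  rewrite (_ : (fun x => _) = fun x : X => x 0 i * x 0 i ^+ d).
    by apply: (@continuousM _ _ (fun x : X => x 0 i)) => //; exact: coord_continuous.
  by apply/funext => y; rewrite exprS.
by apply/funext => y; rewrite big_cons.
Qed.

(** Elements of P_k(S^n) are restrictions, so linear relations are tested on
    the sphere only. *)
Definition indep (J : finType) (b : J -> X -> R) := forall c : J -> R,
  (forall x, sphere x -> \sum_j c j * b j x = 0) -> forall j, c j = 0.

Definition in_span (J : finType) (b : J -> X -> R) f := exists c : J -> R,
  forall x, sphere x -> f x = \sum_j c j * b j x.

Lemma indep_card (J L : finType) (b : J -> X -> R) (s : L -> X -> R) :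
  indep b -> (forall j, in_span s (b j)) -> (#|J| <= #|L|)%N.
Proof.
move=> ib sb.
pose c j := sval (cid (sb j)); have cE j x : sphere x -> b j x = \sum_l c j l * s l x.
  exact: (svalP (cid (sb j))).
pose A : 'M[R]_(#|J|, #|L|) := \matrix_(i, l) c (enum_val i) (enum_val l).
have : row_free A.
  apply: inj_row_free => v vA; apply/rowP => i.
  rewrite mxE -(enum_valK i).
  apply: (ib (fun j => v 0 (enum_rank j))) => x sx.
  under eq_bigr do rewrite cE// mulr_sumr.
  rewrite exchange_big/= big1// => l _.
  under eq_bigr do rewrite mulrA.
  rewrite -mulr_suml (_ : \sum_j _ = 0) ?mul0r//.
  have /rowP/(_ (enum_rank l)) := vA; rewrite !mxE => vAl; rewrite -[RHS]vAl.
  rewrite (reindex_onto enum_rank (@enum_val J (mem predT)))/=; last first.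
    by move=> i0 _; exact: enum_valK.
  by apply: eq_big => [j|j _]; rewrite ?enum_rankK ?eqxx// mxE !enum_rankK.
by rewrite /row_free => /eqP <-; exact: rank_leq_col.
Qed.

Lemma in_span0 (J : finType) (b : J -> X -> R) : in_span b (fun=> 0).
Proof. by exists (fun=> 0) => x _; rewrite big1// => j _; rewrite mul0r. Qed.

Lemma in_spanD (J : finType) (b : J -> X -> R) f g :
  in_span b f -> in_span b g -> in_span b (fun x => f x + g x).
Proof.
move=> [c hc] [d hd]; exists (fun j => c j + d j) => x sx.
by rewrite hc// hd// -big_split; apply: eq_bigr => j _; rewrite mulrDl.
Qed.

Lemma in_spanZ (J : finType) (b : J -> X -> R) (u : R) f :
  in_span b f -> in_span b (fun x => u * f x).
Proof.
move=> [c hc]; exists (fun j => u * c j) => x sx.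
by rewrite hc// mulr_sumr; apply: eq_bigr => j _; rewrite mulrA.
Qed.

Lemma in_span_sum (J : finType) (b : J -> X -> R) (L : Type) (r : seq L) (F : L -> X -> R) :
  (forall l : L, in_span b (F l)) -> in_span b (fun x => \sum_(l <- r) F l x).
Proof.
move=> H; elim: r => [|l r IH].
  rewrite (_ : (fun x => _) = fun=> 0); first exact: in_span0.
  by apply/funext => x; rewrite big_nil.
rewrite (_ : (fun x => _) = fun x => F l x + \sum_(i <- r) F i x).
  exact: in_spanD.
by apply/funext => x; rewrite big_cons.
Qed.

Lemma in_span_base (J : finType) (b : J -> X -> R) j : in_span b (b j).
Proof.
exists (fun i => (i == j)%:R) => x _; rewrite (bigD1 j)//= eqxx mul1r big1 ?addr0// => i ij.
by rewrite (negbTE ij) mul0r.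
Qed.

Lemma eq_in_span (J : finType) (b : J -> X -> R) f g :
  (forall x, sphere x -> f x = g x) -> in_span b g -> in_span b f.
Proof. by move=> fg [c hc]; exists c => x sx; rewrite fg// hc. Qed.

End PolynomialFunctions.

(** * The dimension of the space of polynomials on the sphere *)
Section Dimension.
Context {R : realType} {n : nat}.
Local Notation X := 'rV[R]_n.+1.
Implicit Types (f g : X -> R) (x y : X) (a : 'I_n.+1 -> nat) (k l : nat).

(** Bounded tuples of given sum, whose number is a binomial coefficient. *)
Definition exponents k : finType :=
  {t : n.+1.-tuple 'I_k.+1 | (\sum_(i <- t) i == k)%N}.

Definition expo k (t : exponents k) (i : 'I_n.+1) : nat := tnth (sval t) i.

Lemma card_exponents k : #|{: exponents k}| = 'C(n + k, n).
Proof. by rewrite card_sig -card_ord_partitions; apply: eq_card => t; rewrite !inE. Qed.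

Lemma sum_expo k (t : exponents k) : (\sum_i expo t i = k)%N.
Proof.
by case: t => t ht; rewrite /expo/=; move/eqP: (ht); rewrite big_tuple.
Qed.

Lemma expo_of k a : (\sum_i a i = k)%N -> exists t : exponents k, expo t =1 a.
Proof.
move=> ak; have ai i : (a i < k.+1)%N by rewrite ltnS -ak (bigD1 i)//= leq_addr.
have ht : (\sum_(j <- [tuple inord (a i) : 'I_k.+1 | i < n.+1]) j == k)%N.
  rewrite big_tuple; apply/eqP; apply: etrans ak; apply: eq_bigr => i _.
  by rewrite tnth_mktuple inordK.
pose P := fun t : n.+1.-tuple 'I_k.+1 => is_true (\sum_(j <- t) j == k)%N.
by exists (@exist _ P _ ht) => i; rewrite /expo/= tnth_mktuple inordK.
Qed.

(** On the sphere, multiplication by the squared norm raises the degree by two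
    without changing the function; the monomials of the two highest degrees
    therefore suffice. *)
Definition top_mono k (u : exponents k + exponents k.-1) : X -> R :=
  match u with inl t => mono (expo t) | inr t => mono (expo t) end.

Lemma mono_span k j a : (\sum_i a i + j = k)%N -> in_span (@top_mono k) (mono a).
Proof.
elim/ltn_ind: j a => -[|[|j]] IH a ak.
- rewrite addn0 in ak; have [t tE] := expo_of ak.
  have -> : mono a = top_mono (inl t) :> (X -> R).
    by apply/funext => x; apply: eq_bigr => i _; rewrite tE.
  exact: in_span_base.
- rewrite addn1 in ak; have ak' : (\sum_i a i)%N = k.-1 by rewrite -ak.
  have [t tE] := expo_of ak'.
  have -> : mono a = top_mono (inr t) :> (X -> R).
    by apply/funext => x; apply: eq_bigr => i _; rewrite tE.
  exact: in_span_base.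
apply: (@eq_in_span _ _ _ _ _ (fun x => \sum_l mono (fun i => a i + (i == l) * 2)%N x)).
  move=> x sx; rewrite -[LHS]mulr1 -[1 in LHS]sx mulr_sumr; apply: eq_bigr => l _.
  rewrite /mono (bigD1 l)//= [RHS](bigD1 l)//= eqxx mul1n exprD mulrAC; congr (_ * _).
  by apply: eq_bigr => i il; rewrite (negbTE il) mul0n addn0.
apply: in_span_sum => l; apply: (IH j) => //.
rewrite big_split/= -ak -addnA; congr (_ + _)%N.
rewrite (bigD1 l)//= eqxx big1 ?addn0; first by rewrite mul1n add2n.
by move=> i il; rewrite (negbTE il).
Qed.

Lemma polyfun_span k f : polyfun k f -> in_span (@top_mono k) f.
Proof.
apply: polyfun_ind; first exact: in_span0.
  by move=> u v; exact: in_spanD.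
move=> c a ak; apply: in_spanZ; apply: (@mono_span _ (k - \sum_i a i)).
by rewrite subnKC.
Qed.

Lemma monoZ a (c : R) x : mono a (c *: x) = c ^+ (\sum_i a i) * mono a x.
Proof.
rewrite /mono -prodrXr -big_split; apply: eq_bigr => i _.
by rewrite mxE exprMn.
Qed.

Lemma digits_inj (B N : nat) (a b : 'I_N -> nat) :
  (forall i, (a i < B)%N) -> (forall i, (b i < B)%N) ->
  (\sum_i a i * B ^ i = \sum_i b i * B ^ i)%N -> a =1 b.
Proof.
elim: N a b => [|N IH] a b aB bB; first by move=> _ [].
rewrite !big_ord_recl !expn0 !muln1.
have S (c : 'I_N.+1 -> nat) : (\sum_(i < N) c (lift ord0 i) * B ^ lift ord0 i =
    (\sum_(i < N) c (lift ord0 i) * B ^ i) * B)%N.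
  rewrite big_distrl; apply: eq_bigr => i _.
  by rewrite (_ : lift ord0 i = i.+1 :> nat)// expnSr mulnA.
rewrite !S => E.
have E0 : a ord0 = b ord0.
  have := congr1 (modn^~ B) E.
  by rewrite ![(_ + _ * B)%N]addnC !modnMDl !modn_small.
have B0 : (0 < B)%N by apply: leq_ltn_trans (aB ord0).
move: E; rewrite E0 => /addnI/eqP; rewrite eqn_pmul2r// => /eqP E.
have H := IH _ _ (fun i => aB (lift ord0 i)) (fun i => bB (lift ord0 i)) E.
by move=> i; case: (unliftP ord0 i) => [j ->|->].
Qed.

Lemma poly_eq0_pos (p : {poly R}) : (forall s : R, 0 < s -> p.[s] = 0) -> p = 0.
Proof.
move=> H; apply/eqP; apply: contraT => p0.
have := @max_poly_roots _ p [seq i.+1%:R | i <- iota 0 (size p)] p0.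
rewrite size_map size_iota ltnn; apply.
  by apply/allP => _ /mapP[i _ ->]; rewrite /root H// ltr0Sn.
rewrite map_inj_uniq ?iota_uniq// => i j /eqP.
by rewrite eqr_nat => /eqP[].
Qed.

(** A homogeneous polynomial that vanishes on the sphere vanishes everywhere;
    the substitution [x i = s ^ (B ^ i)], with [B] larger than all the
    exponents, then separates the monomials. *)
Lemma exponents_indep k : indep (fun t : exponents k => mono (expo t) : X -> R).
Proof.
move=> c H.
pose e (t : exponents k) := (\sum_(i < n.+1) expo t i * k.+1 ^ i)%N.
have e_inj : injective e.
  move=> t t' /digits_inj E; apply: val_inj; apply: eq_from_tnth => i.
  apply: val_inj; apply: E => j; exact: ltn_ord.
pose p : {poly R} := \sum_t c t *: 'X^(e t).
have p0 : p = 0.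
  apply: poly_eq0_pos => s s0.
  pose y : X := \row_i s ^+ (k.+1 ^ i).
  have yy : 0 < dot y y.
    rewrite lt_def dot_ge0 andbT dot_eq0; apply/eqP => /rowP/(_ ord0).
    by rewrite !mxE => /eqP; rewrite gt_eqF// exprn_gt0.
  pose N := Num.sqrt (dot y y).
  have N0 : N != 0 by rewrite gt_eqF// sqrtr_gt0.
  have sy : sphere (N^-1 *: y).
    apply/sphere_dot; rewrite dotZl dotZr mulrA -invfM -expr2 sqr_sqrtr ?(ltW yy)//.
    by rewrite mulVf// gt_eqF.
  have := H _ sy; under eq_bigr do rewrite monoZ sum_expo mulrCA.
  rewrite -mulr_sumr => /eqP; rewrite mulf_eq0 expf_eq0 invr_eq0 (negbTE N0) andbF/=.
  move=> /eqP <-; rewrite /p horner_sum; apply: eq_bigr => t _.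
  rewrite hornerZ hornerXn; congr (_ * _).
  rewrite /mono /e expr_sum; apply: eq_bigr => i _.
  by rewrite mxE -exprM mulnC.
move=> t; have := congr1 (fun q : {poly R} => q`_(e t)) p0.
rewrite coef0 /p coef_sum (bigD1 t)//= coefZ coefXn eqxx mulr1 big1 ?addr0// => t' tt'.
by rewrite coefZ coefXn eq_sym (inj_eq e_inj) (negbTE tt') mulr0.
Qed.

(** The two degrees have opposite parities, which the antipodal map separates. *)
Lemma top_mono_indep k : (0 < k)%N -> indep (@top_mono k).
Proof.
case: k => // k _ c H.
pose P x := \sum_(t : exponents k.+1) c (inl t) * mono (expo t) x.
pose Q x := \sum_(t : exponents k) c (inr t) * mono (expo t) x.
have PQ x : sphere x -> P x + Q x = 0 by move=> /H; rewrite big_sumType.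
have PN x : P (- x) = (-1) ^+ k.+1 * P x.
  rewrite /P mulr_sumr; apply: eq_bigr => t _.
  by rewrite -scaleN1r monoZ sum_expo mulrCA.
have QN x : Q (- x) = (-1) ^+ k * Q x.
  rewrite /Q mulr_sumr; apply: eq_bigr => t _.
  by rewrite -scaleN1r monoZ sum_expo mulrCA.
have sN x : sphere x -> sphere (- x).
  by move=> /sphere_dot sx; apply/sphere_dot; rewrite -scaleN1r dotZl dotZr sx; ring.
have PmQ x : sphere x -> Q x - P x = 0.
  move=> /sN/PQ; rewrite PN QN exprS -mulrA mulrCA -mulrDr mulN1r addrC => /eqP.
  by rewrite mulf_eq0 signr_eq0 => /eqP.
have P0 x : sphere x -> P x = 0 by move=> sx; have := PQ x sx; have := PmQ x sx; lra.
have Q0 x : sphere x -> Q x = 0 by move=> sx; have := PQ x sx; have := PmQ x sx; lra.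
by case=> t; [exact: (exponents_indep P0)|exact: (exponents_indep Q0)].
Qed.

Definition dimS k : nat := ('C(n + k, n) + 'C(n + k.-1, n))%N.

Lemma card_top_mono k : #|{: exponents k + exponents k.-1}| = dimS k.
Proof. by rewrite card_sum !card_exponents. Qed.

End Dimension.

(** * Orthonormal bases and the reproducing kernel *)
Section GramSchmidt.
Context {R : realType} {n : nat}.
Local Notation X := 'rV[R]_n.+1.
Variable sigma : probability (borel_rV R n) R.
Hypothesis sigma1 : sigma sphere = 1%E.
Hypothesis sigma_inv : forall (F : X -> R) g, continuous F -> ortho g ->
  sint sigma (fun x => F (x *m g)) = sint sigma F.
Variable k : nat.
Implicit Types (f g h u v e : X -> R) (s es : seq (X -> R)).

Definition ip f g : R := sint sigma (fun x => f x * g x).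

Lemma continuousM_fun f g : continuous f -> continuous g -> continuous (fun x => f x * g x).
Proof. by move=> cf cg x; apply: (@continuousM _ _ f g); [exact: cf|exact: cg]. Qed.

Lemma ipC f g : ip f g = ip g f.
Proof. by apply: eq_sint => x _; rewrite mulrC. Qed.

Lemma eq_ipl f g h : (forall x, sphere x -> f x = g x) -> ip f h = ip g h.
Proof. by move=> fg; apply: eq_sint => x sx; rewrite fg. Qed.

Lemma ipDl f g h : continuous f -> continuous g -> continuous h ->
  ip (fun x => f x + g x) h = ip f h + ip g h.
Proof.
move=> cf cg ch; rewrite /ip -sintD//; [|exact: continuousM_fun|exact: continuousM_fun].
by apply: eq_sint => x _; rewrite mulrDl.
Qed.

Lemma ipZl (c : R) f h : continuous f -> continuous h ->
  ip (fun x => c * f x) h = c * ip f h.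
Proof.
move=> cf ch; rewrite /ip -sintZ//; last exact: continuousM_fun.
by apply: eq_sint => x _; rewrite mulrA.
Qed.

Lemma ip0l h : ip (fun=> 0) h = 0.
Proof. by rewrite -[RHS](sint_cst sigma1 0); apply: eq_sint => x _; rewrite mul0r. Qed.

Lemma ip_suml es (c : (X -> R) -> R) h : (forall e, e \in es -> continuous e) -> continuous h ->
  ip (fun x => \sum_(e <- es) c e * e x) h = \sum_(e <- es) c e * ip e h /\
  continuous (fun x => \sum_(e <- es) c e * e x).
Proof.
move=> ces ch; elim: es ces => [|e es IH] ces.
  rewrite (_ : (fun x => _) = fun=> 0); last by apply/funext => x; rewrite big_nil.
  by rewrite big_nil ip0l; split => // x; exact: cst_continuous.
have [E cE] := IH (fun v vs => ces v (mem_behead (s := e :: es) vs)).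
have ce : continuous e by apply: ces; rewrite mem_head.
rewrite (_ : (fun x => _) = fun x => c e * e x + \sum_(v <- es) c v * v x); last first.
  by apply/funext => x; rewrite big_cons.
have cce : continuous (fun x => c e * e x).
  by apply: continuousM_fun => //; move=> x; exact: cst_continuous.
split; first by rewrite big_cons ipDl// E ipZl.
by move=> x; apply: (@continuousD _ _ _ (fun x => c e * e x)); [exact: cce|exact: cE].
Qed.

Lemma ip_ge0 f : continuous f -> 0 <= ip f f.
Proof.
move=> cf; rewrite -[leLHS](sint_cst sigma1 0); apply: le_sint => //.
- by move=> x; exact: cst_continuous.
- exact: continuousM_fun.
- by move=> x _; rewrite -expr2 sqr_ge0.
Qed.

Lemma ip_eq0 f : continuous f -> ip f f = 0 -> forall x, sphere x -> f x = 0.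
Proof.
move=> cf f0; apply: (sint_sqr_eq0 sigma1 sigma_inv cf); rewrite -f0.
by apply: eq_sint => x _; rewrite expr2.
Qed.

Definition proj es u x : R := \sum_(e <- es) ip u e * e x.
Definition resid es u x : R := u x - proj es u x.

(** Residuals that vanish on the sphere are dropped, so the result is
    orthonormal even if the given functions are dependent. *)
Fixpoint gs s : seq (X -> R) :=
  if s is u :: s' then
    let r := resid (gs s') u in
    if ip r r == 0 then gs s' else (fun x => (Num.sqrt (ip r r))^-1 * r x) :: gs s'
  else [::].

Definition rep es u := forall x, sphere x -> u x = proj es u x.

Definition poly_seq es := forall e, e \in es -> polyfun k e.

Lemma poly_seq_proj es u : poly_seq es -> polyfun k (proj es u).
Proof.
elim: es => [|e es IH] pes.
  rewrite /proj (_ : (fun x => _) = fun=> 0); first exact: polyfun_cst.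
  by apply/funext => x; rewrite big_nil.
rewrite /proj (_ : (fun x => _) = fun x => ip u e * e x + proj es u x).
  apply: polyfunD; last by apply: IH => v vs; apply: pes; rewrite in_cons vs orbT.
  by apply: polyfunZ; apply: pes; rewrite mem_head.
by apply/funext => x; rewrite big_cons.
Qed.

Lemma polyfunB k' f g : polyfun k' f -> polyfun k' g -> polyfun k' (fun x => f x - g x).
Proof.
move=> pf pg; rewrite (_ : (fun x => _) = fun x => f x + (-1) * g x).
  by apply: polyfunD => //; exact: polyfunZ.
by apply/funext => x; rewrite mulN1r.
Qed.

Lemma repD es u v : poly_seq es -> continuous u -> continuous v ->
  rep es u -> rep es v -> rep es (fun x => u x + v x).
Proof.
move=> pes cu cv ru rv x sx; rewrite ru// rv// /proj -big_split.
rewrite big_seq [RHS]big_seq; apply: eq_bigr => e /pes/polyfun_continuous ce.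
by rewrite ipDl// mulrDl.
Qed.

Lemma repZ es (c : R) u : poly_seq es -> continuous u ->
  rep es u -> rep es (fun x => c * u x).
Proof.
move=> pes cu ru x sx; rewrite ru// /proj mulr_sumr.
rewrite big_seq [RHS]big_seq; apply: eq_bigr => e /pes/polyfun_continuous ce.
by rewrite ipZl// mulrA.
Qed.

Lemma rep_comb es (L : eqType) (r : seq L) (c : L -> R) (b : L -> X -> R) : poly_seq es ->
  (forall l, l \in r -> continuous (b l) /\ rep es (b l)) ->
  rep es (fun x => \sum_(l <- r) c l * b l x) /\
  continuous (fun x => \sum_(l <- r) c l * b l x).
Proof.
move=> pes; elim: r => [|l r IH] H.
  rewrite (_ : (fun x => _) = fun=> 0); last by apply/funext => x; rewrite big_nil.
  split; last by move=> x; exact: cst_continuous.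
  by move=> x sx; rewrite /proj big1// => e _; rewrite ip0l mul0r.
have [rr cr] : rep es (fun x => \sum_(l <- r) c l * b l x) /\
    continuous (fun x => \sum_(l <- r) c l * b l x).
  by apply: IH => i ir; apply: H; rewrite in_cons ir orbT.
have [cb rb] := H l (mem_head _ _).
rewrite (_ : (fun x => _) = fun x => c l * b l x + \sum_(i <- r) c i * b i x); last first.
  by apply/funext => x; rewrite big_cons.
have ccb : continuous (fun x => c l * b l x).
  by apply: continuousM_fun => //; move=> x; exact: cst_continuous.
split; first by apply: repD => //; exact: repZ.
by move=> x; apply: (@continuousD _ _ _ (fun x => c l * b l x)); [exact: ccb|exact: cr].
Qed.

(** The residual is orthogonal to everything that is already represented. *)
Lemma ip_resid es u v : poly_seq es -> continuous u -> continuous v -> rep es v ->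
  ip v (resid es u) = 0.
Proof.
move=> pes cu cv rv.
have ces e : e \in es -> continuous e by move=> /pes/polyfun_continuous.
have [E1 cP] := ip_suml (ip u) ces cv; have [E2 _] := ip_suml (ip v) ces cu.
rewrite ipC /resid.
rewrite (_ : (fun x => _) = fun x => u x + (-1) * proj es u x); last first.
  by apply/funext => x; rewrite mulN1r.
have cP' : continuous (fun x => - 1 * proj es u x).
  by apply: continuousM_fun => //; move=> x; exact: cst_continuous.
rewrite ipDl// ipZl// E1 ipC (eq_ipl u rv) E2 mulN1r.
apply/eqP; rewrite subr_eq0; apply/eqP; apply: eq_bigr => e _.
by rewrite mulrC (ipC u) (ipC v).
Qed.

Lemma gs_spec s : poly_seq s -> [/\ poly_seq (gs s),
  forall u, u \in s -> rep (gs s) u,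
  forall e, e \in gs s -> rep (gs s) e,
  forall e, e \in gs s -> ip e e = 1
  & pairwise (fun e e' => ip e e' == 0) (gs s)].
Proof.
elim: s => [|u s IH] ps; first by split.
have [|pg rs rg og wg] := IH; first by move=> v vs; apply: ps; rewrite in_cons vs orbT.
have pu : polyfun k u by apply: ps; rewrite mem_head.
have cu := polyfun_continuous pu.
rewrite /=; set es := gs s in pg rs rg og wg *; set r := resid es u.
have pr : polyfun k r by apply: polyfunB => //; exact: poly_seq_proj.
have cr := polyfun_continuous pr.
have pP : polyfun k (proj es u) by exact: poly_seq_proj.
have cP := polyfun_continuous pP.
have ce e : e \in es -> continuous e by move=> /pg/polyfun_continuous.
have r0 e : e \in es -> ip e r = 0.
  by move=> ees; apply: ip_resid => //; [exact: ce|exact: rg].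
have uE : u = fun x => proj es u x + r x by apply/funext => x; rewrite /r /resid addrC subrK.
have [rr|rr] := eqVneq (ip r r) 0.
  have zr := ip_eq0 cr rr.
  split => // v; rewrite in_cons => /orP[/eqP ->|]; last exact: rs.
  by move=> x sx; rewrite {1}uE zr// addr0.
set c := (Num.sqrt (ip r r))^-1; set e0 := fun x => c * r x.
have cc : c * c * ip r r = 1.
  by rewrite -invfM -expr2 sqr_sqrtr ?ip_ge0// mulVf.
have pe0 : polyfun k e0 by exact: polyfunZ.
have ce0 := polyfun_continuous pe0.
have pes : poly_seq (e0 :: es).
  by move=> e; rewrite in_cons => /orP[/eqP ->//|]; exact: pg.
have ve0 v : continuous v -> ip v e0 = c * ip v r by move=> cv; rewrite ipC ipZl// ipC.
have up v : continuous v -> rep es v -> rep (e0 :: es) v.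
  move=> cv rv x sx; rewrite /proj big_cons ve0//.
  by rewrite (ip_resid pg cu cv rv) mulr0 mul0r add0r; exact: rv.
have e0r : rep (e0 :: es) r.
  move=> x sx; rewrite /proj big_cons big1_seq; last first.
    by move=> e /andP[_ ees]; rewrite ipC r0// mul0r.
  by rewrite addr0 ve0// /e0 mulrCA !mulrA cc mul1r.
have eP : rep (e0 :: es) (proj es u).
  have [] // := @rep_comb (e0 :: es) _ es (ip u) id pes _.
  by move=> e ees; split; [exact: ce|apply: up; [exact: ce|exact: rg]].
split => //.
- move=> v; rewrite in_cons => /orP[/eqP ->|vs].
    by rewrite uE; exact: repD.
  apply: up; last exact: rs.
  by apply: (@polyfun_continuous _ _ k); apply: ps; rewrite in_cons vs orbT.
- move=> e; rewrite in_cons => /orP[/eqP ->|ees]; first exact: repZ.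
  by apply: up; [exact: ce|exact: rg].
- move=> e; rewrite in_cons => /orP[/eqP ->|]; last exact: og.
  by rewrite ve0// ipC ve0// mulrA.
- rewrite pairwise_cons wg andbT; apply/allP => e ees.
  by rewrite ipC ve0 ?r0 ?mulr0//; exact: ce.
Qed.

Lemma gs_cat s1 s2 : exists t, gs (s1 ++ s2) = t ++ gs s2.
Proof.
elim: s1 => [|u s1 [t E]]; first by exists [::].
rewrite /= E; case: ifP => _; first by exists t.
by eexists (_ :: t).
Qed.

Lemma cauchy_schwarz_sum (T : Type) (r : seq T) (a b : T -> R) :
  (\sum_(i <- r) a i * b i) ^+ 2 <= (\sum_(i <- r) a i ^+ 2) * (\sum_(i <- r) b i ^+ 2).
Proof.
set P := \sum_(i <- r) a i * b i; set A := \sum_(i <- r) a i ^+ 2.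
set B := \sum_(i <- r) b i ^+ 2.
have B0 : 0 <= B by apply: sumr_ge0 => i _; exact: sqr_ge0.
have Q (u v : R) : 0 <= u ^+ 2 * A - 2 * u * v * P + v ^+ 2 * B.
  have -> : u ^+ 2 * A - 2 * u * v * P + v ^+ 2 * B = \sum_(i <- r) (u * a i - v * b i) ^+ 2.
    rewrite /A /B /P !mulr_sumr -sumrB -big_split; apply: eq_bigr => i _ /=; ring.
  by apply: sumr_ge0 => i _; exact: sqr_ge0.
have [B00|Bn] := eqVneq B 0.
  have [->|Pn] := eqVneq P 0; first by rewrite expr0n/= B00 mulr0.
  have := Q 1 ((A + 1) / (2 * P)); rewrite B00.
  have -> : 2 * 1 * ((A + 1) / (2 * P)) * P = A + 1 by field.
  lra.
have Bp : 0 < B by rewrite lt_def Bn.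
by rewrite -(ler_pM2l Bp); have := Q B P; lra.
Qed.

Definition kern es x : R := \sum_(e <- es) e x ^+ 2.

Lemma ip_rep es h : poly_seq es -> continuous h -> rep es h ->
  ip h h = \sum_(e <- es) ip h e ^+ 2.
Proof.
move=> pes ch rh.
have ces e : e \in es -> continuous e by move=> /pes/polyfun_continuous.
rewrite (eq_ipl h rh) (ip_suml (ip h) ces ch).1.
by apply: eq_bigr => e _; rewrite (ipC e) expr2.
Qed.

Section Kernel.
Variable es : seq (X -> R).
Hypothesis pes : poly_seq es.
Hypothesis full : forall h, polyfun k h -> rep es h.

(** The reproducing property and the Cauchy-Schwarz inequality. *)
Lemma kern_bound h x : polyfun k h -> sphere x -> h x ^+ 2 <= ip h h * kern es x.
Proof.
move=> ph sx; rewrite {1}(full ph sx) (ip_rep pes (polyfun_continuous ph) (full ph)).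
exact: cauchy_schwarz_sum.
Qed.

(** [kern es x] is the largest value at [x] of the square of a normalized
    polynomial, and rotations permute the normalized polynomials. *)
Lemma kern_le x (g : 'M[R]_n.+1) : ortho g -> sphere x -> kern es (x *m g) <= kern es x.
Proof.
move=> og sx; have sxg : sphere (x *m g).
  by apply/sphere_dot; rewrite ortho_dot//; apply/sphere_dot.
have ces e : e \in es -> continuous e by move=> /pes/polyfun_continuous.
pose h y := \sum_(e <- es) e (x *m g) * e y.
have ch : continuous h.
  exact: (ip_suml (fun e => e (x *m g)) ces (@cst_continuous _ _ (0 : R))).2.
have ph : polyfun k h.
  have aux es' : poly_seq es' -> polyfun k (fun y => \sum_(e <- es') e (x *m g) * e y).
    elim: es' => [|e es' IH] pes'.
      rewrite (_ : (fun x => _) = fun=> 0); first exact: polyfun_cst.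
      by apply/funext => y; rewrite big_nil.
    rewrite (_ : (fun x => _) = fun y => e (x *m g) * e y +
        \sum_(e <- es') e (x *m g) * e y); last by apply/funext => y; rewrite big_cons.
    apply: polyfunD; last by apply: IH => v vs; apply: pes'; rewrite in_cons vs orbT.
    by apply: polyfunZ; apply: pes'; rewrite mem_head.
  exact: aux.
have ipeh e : e \in es -> ip e h = e (x *m g).
  move=> ees; rewrite ipC (ip_suml (fun e => e (x *m g)) ces (ces e ees)).1.
  rewrite (full (pes ees) sxg) /proj; apply: eq_bigr => v _.
  by rewrite (ipC v) mulrC.
have hh : ip h h = kern es (x *m g).
  rewrite (ip_suml (fun e => e (x *m g)) ces ch).1 /kern big_seq [RHS]big_seq.
  by apply: eq_bigr => e ees; rewrite ipeh// expr2.
pose h' y := h (y *m g).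
have hh' : ip h' h' = kern es (x *m g).
  rewrite -hh; exact: (sigma_inv (continuousM_fun ch ch) og).
have K0 y : 0 <= kern es y by apply: sumr_ge0 => e _; exact: sqr_ge0.
have := @kern_bound h' x (polyfun_mulmx g ph) sx; rewrite hh'.
have -> : h' x = kern es (x *m g).
  by rewrite /h' /h /kern; apply: eq_bigr => e _; rewrite expr2.
have [->|Kn] := eqVneq (kern es (x *m g)) 0; first by rewrite K0.
by rewrite expr2 ler_pM2l// lt_def Kn K0.
Qed.

(** The sphere is homogeneous, so the kernel is constant on the diagonal; its
    integral is the number of elements of the orthonormal family. *)
Lemma kern_const x : (forall e, e \in es -> ip e e = 1) -> sphere x ->
  kern es x = (size es)%:R.
Proof.
move=> on sx.
have eqK y z : sphere y -> sphere z -> kern es y <= kern es z.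
  move=> sy sz; rewrite -(@refl_swap _ _ z y); last first.
    by move: sy sz => /sphere_dot -> /sphere_dot ->.
  by apply: kern_le => //; exact: refl_ortho.
have aux es' : {subset es' <= es} -> sint sigma (kern es') = (size es')%:R /\
    continuous (kern es').
  elim: es' => [|e es' IH] sub.
    rewrite /kern (_ : (fun x => _) = fun=> 0); last by apply/funext => y; rewrite big_nil.
    by rewrite sint_cst//; split => // y; exact: cst_continuous.
  have [E cE] := IH (fun v vs => sub v (mem_behead (s := e :: es') vs)).
  have ce : continuous e by apply: (@polyfun_continuous _ _ k); apply: pes; apply: sub; rewrite mem_head.
  rewrite (_ : kern _ = fun x => e x * e x + kern es' x); last first.
    by apply/funext => y; rewrite /kern big_cons expr2.
  have cee := continuousM_fun ce ce.
  rewrite sintD// E /= -natr1 addrC; split.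
    by congr (_ + _); apply: on; apply: sub; rewrite mem_head.
  by move=> y; apply: (@continuousD _ _ _ (fun x => e x * e x)); [exact: cee|exact: cE].
have [<- _] := aux es (fun _ H => H).
rewrite -[LHS](sint_cst sigma1); apply: eq_sint => y sy.
by apply/eqP; rewrite eq_le !eqK.
Qed.

End Kernel.

Lemma size_onb es (J : finType) (b : J -> X -> R) : poly_seq es ->
  (forall e, e \in es -> ip e e = 1) ->
  pairwise (fun e e' => ip e e' == 0) es ->
  (forall e, e \in es -> in_span b e) -> (size es <= #|J|)%N.
Proof.
move=> pes on pw sp; rewrite -[size es]card_ord.
pose ei (i : 'I_(size es)) : X -> R := nth (fun=> 0) es i.
have eiE i : ei i \in es by exact: mem_nth.
apply: (@indep_card _ _ _ _ ei b); last by move=> i; apply: sp.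
move=> c H j.
have cei i : continuous (ei i) by apply: (@polyfun_continuous _ _ k); exact: pes.
have orth i : i != j -> ip (ei i) (ei j) = 0.
  move=> ij; have /(pairwiseP (fun=> 0)) pw' := pw.
  have [lt|lt|/val_inj eq] := ltngtP i j; last by rewrite eq eqxx in ij.
    by apply/eqP; apply: pw'; rewrite ?inE.
  by rewrite ipC; apply/eqP; apply: pw'; rewrite ?inE.
have : ip (fun x => \sum_i c i * ei i x) (ei j) = 0.
  by apply: etrans (ip0l (ei j)); apply: eq_ipl.
have [S _] := sint_sum sigma1 (index_enum 'I_(size es))
  (fun i => continuousM_fun (continuousM_fun (@cst_continuous _ _ (c i)) (cei i)) (cei j)).
rewrite /ip; under eq_sint do rewrite mulr_suml.
rewrite S (bigD1 j)//= big1 ?addr0.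
  have -> : sint sigma (fun x => c j * ei j x * ei j x) = c j * ip (ei j) (ei j).
    by rewrite -ipZl.
  by rewrite on// mulr1.
move=> i ij; have -> : sint sigma (fun x => c i * ei i x * ei j x) = c i * ip (ei i) (ei j).
  by rewrite -ipZl.
by rewrite orth// mulr0.
Qed.

End GramSchmidt.

(** * Lagrange polynomials of a Fekete point *)
Section Lagrange.
Context {R : realType} {n : nat}.
Local Notation X := 'rV[R]_n.+1.
Implicit Types (x y : X).

(** The expansion of the determinant along the column of a new point is a
    nontrivial combination of the functions, with coefficients that depend on
    the other points only. *)
Lemma exists_det_neq0 N (s : 'I_N -> X -> R) : indep s ->
  exists2 y : 'I_N -> X, (forall l, sphere (y l)) & detS s y != 0.
Proof.
elim: N s => [|N IH] s is_.
  by exists (fun=> 0) => [[]|]; rewrite // /detS det_mx00 oner_eq0.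
have is' : indep (fun j : 'I_N => s (lift ord0 j)).
  move=> c H j; pose c' i := if unlift ord0 i is Some j then c j else 0.
  have := is_ c' _ (lift ord0 j); rewrite /c' liftK; apply => x sx.
  rewrite big_ord_recl unlift_none mul0r add0r -[RHS](H x sx).
  by apply: eq_bigr => i _; rewrite liftK.
have [y sy dy] := IH _ is'.
pose y' z i := if unlift ord0 i is Some j then y j else z.
pose A z : 'M[R]_N.+1 := \matrix_(j, l) s j (y' z l).
have cof z z' j : cofactor (A z) j 0 = cofactor (A z') j 0.
  rewrite /cofactor; congr (_ * \det _); apply/matrixP => i l.
  by rewrite !mxE /y' liftK.
have dA z : detS s (y' z) = \sum_j cofactor (A 0) j 0 * s j z.
  rewrite /detS (expand_det_col _ 0); apply: eq_bigr => j _.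
  by rewrite (cof 0 z) mulrC mxE /y' unlift_none.
have [z sz dz] : exists2 z, sphere z & detS s (y' z) != 0.
  apply: contrapT => no.
  have := is_ (fun j => cofactor (A 0) j 0).
  have H x : sphere x -> \sum_j cofactor (A 0) j 0 * s j x = 0.
    by move=> sx; rewrite -dA; apply/eqP; apply: contrapT => /negP h; apply: no; exists x.
  move=> /(_ H ord0)/eqP; rewrite /cofactor/= expr0 mul1r => h.
  move/negP: dy; apply; move: h; rewrite /detS; set B := \matrix_(_, _) _; set C := row' _ _.
  rewrite (_ : B = C)//; apply/matrixP => i l.
  by rewrite !mxE /y' liftK.
by exists (y' z) => // l; rewrite /y'; case: unliftP.
Qed.

(** The value at [z] of the [j]-th Lagrange polynomial is the quotient of two
    determinants, for the points with [x j] replaced by [z] and for the Fekete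
    points; maximality bounds it by [1]. *)
Lemma lagrange_poly k N (x : 'I_N -> X) : fekete_point k x ->
  exists g : 'I_N -> X -> R, [/\ forall j, polyfun k (g j),
    forall i j, g j (x i) = (i == j)%:R
    & forall j z, sphere z -> `|g j z| <= 1].
Proof.
move=> [sx [s [sp is_ _] mx]].
have dx : detS s x != 0.
  have [y sy dy] := exists_det_neq0 is_.
  by rewrite -normr_gt0 (lt_le_trans _ (mx y sy))// normr_gt0.
pose p j := s2val (cid2 (sp j)).
have pE j z : sphere z -> s j z = meval (fun i => z 0 i) (p j).
  exact: (s2valP' (cid2 (sp j))).
have pd j : (msize (p j) <= k.+1)%N by exact: (s2valP (cid2 (sp j))).
pose A : 'M[R]_N := \matrix_(j, l) s j (x l).
pose g (j : 'I_N) (z : X) := \sum_i (detS s x)^-1 * cofactor A i j * meval (fun i => z 0 i) (p i).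
pose x' (j : 'I_N) (z : X) (l : 'I_N) := if l == j then z else x l.
have gE j z : sphere z -> g j z = detS s (x' j z) / detS s x.
  move=> sz; rewrite mulrC {2}/detS (expand_det_col _ j) mulr_sumr.
  apply: eq_bigr => i _; rewrite [in RHS]mxE /x' eqxx pE// -mulrA; congr (_ * _).
  rewrite [RHS]mulrC; congr (_ * _); rewrite /cofactor; congr (_ * \det _).
  apply/matrixP => u v; rewrite !mxE; case: eqP => // e.
  by have := neq_lift j v; rewrite e eqxx.
exists g; split.
- move=> j; apply: polyfun_sum => i; apply: polyfunZ.
  by exists (p i).
- move=> i j; rewrite gE//; have [->|ij] := eqVneq i j.
    rewrite (_ : x' j (x j) = x) ?divff//.
    by apply/funext => l; rewrite /x'; case: eqP => // ->.
  rewrite /detS -det_tr (@determinant_alternate _ _ _ i j) ?mul0r//.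
  by move=> l; rewrite !mxE /x' eqxx (negbTE ij).
- move=> j z sz; rewrite gE// normrM normfV ler_pdivrMr ?normr_gt0// mul1r.
  by apply: mx => l; rewrite /x'; case: eqP.
Qed.

End Lagrange.

(** * Lipschitz estimates along great circles *)
Section Lipschitz.
Context {R : realType}.

(** The supremum of the times up to which the bound holds is attained and
    cannot be smaller than [t]. *)
Lemma local_lipschitz_bound (psi : R -> R) (t L : R) : 0 <= t ->
  (forall s, 0 <= s <= t -> exists2 r : R, 0 < r & forall s', 0 <= s' <= t ->
     `|s' - s| < r -> `|psi s' - psi s| <= L * `|s' - s|) ->
  `|psi t - psi 0| <= L * t.
Proof.
move=> t0 H.
pose A := [set s : R | 0 <= s <= t /\ `|psi s - psi 0| <= L * s].
have A0 : A 0 by rewrite /A/= lexx t0 subrr normr0 mulr0.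
have hsA : has_sup A by split; [exists 0|exists t => s [/andP[]]].
set c := sup A.
have c0 : 0 <= c by apply: ub_le_sup => //; case: hsA.
have ct : c <= t by apply: ge_sup; [exists 0|move=> s [/andP[]]].
have [r r0 Hr] := H c ltac:(by rewrite c0 ct).
have tri a b d : `|psi a - psi d| <= `|psi a - psi b| + `|psi b - psi d|.
  by rewrite -[psi a - psi d](subrKA (psi b)) ler_normD.
have Ac : A c.
  have [s [/andP[s0 st] As] cs] := sup_adherent r0 hsA.
  have sc : s <= c by apply: ub_le_sup; [case: hsA|split; rewrite ?s0].
  split; first by rewrite c0 ct.
  apply: le_trans (tri c s 0) _; rewrite distrC.
  have csr : `|s - c| < r by rewrite distrC ger0_norm ?subr_ge0// ltrBlDr -ltrBlDl.
  have := Hr s ltac:(by rewrite s0 st) csr; rewrite [`|s - c|]distrC [`|c - s|]ger0_norm ?subr_ge0// => h; apply: le_trans (lerD h As) _.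
  by rewrite -mulrDr subrK.
have [<-|cnt] := eqVneq c t; first by case: Ac.
have ct' : c < t by rewrite lt_neqAle cnt.
pose s := Num.min t (c + r / 2).
have cs : c < s by rewrite lt_min ct' ltrDl divr_gt0.
have st : s <= t by rewrite ge_min lexx.
have sr : s - c < r.
  rewrite ltrBlDl (@le_lt_trans _ _ (c + r / 2))// ?ge_min ?lexx ?orbT//.
  by rewrite ltrD2l ltr_pdivrMr// ltr_pMr// ltr1n.
have s0 : 0 <= s by apply: le_trans c0 _; exact: ltW.
have : A s.
  split; first by rewrite s0 st.
  apply: le_trans (tri s c 0) _.
  have := Hr s ltac:(by rewrite s0 st); rewrite [`|s - c|]gtr0_norm ?subr_gt0// => /(_ sr) h.
  by case: Ac => _ Ac; apply: le_trans (lerD h Ac) _; rewrite -mulrDr subrK.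
move=> /(ub_le_sup hsA.2); rewrite -/c leNgt cs //.
Qed.

Context {m : nat}.
Local Notation X := 'rV[R]_m.
Implicit Types (f : X -> R) (p q T x y : X).

Lemma is_derive_line f q T (b : R) : derivable f (q + b *: T) T ->
  is_derive b 1 (fun b : R => f (q + b *: T)) ('D_T f (q + b *: T)).
Proof.
move=> df.
have E : (fun h : R => h^-1 *: (((fun b : R => f (q + b *: T)) \o shift b) (h *: 1) - f (q + b *: T))) =
    (fun h : R => h^-1 *: ((f \o shift (q + b *: T)) (h *: T) - f (q + b *: T))).
  apply/funext => h; congr (_ *: (f _ - _)) => /=.
  by rewrite [h *: 1]mulr1 scalerDl addrCA.
by split; rewrite /derivable /derive E.
Qed.

Lemma line_bound f q T (b K : R) : (forall x, derivable f x T) -> continuous f ->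
  (forall c : R, `|c| <= `|b| -> `|'D_T f (q + c *: T)| <= K) ->
  `|f (q + b *: T) - f q| <= K * `|b|.
Proof.
move=> df cf HK; pose g (c : R) := f (q + c *: T).
have cg : continuous g.
  move=> c; apply/differentiable_continuous/derivable1_diffP.
  by have [] := @is_derive_line f q T c (df _).
have g0 : g 0 = f q by rewrite /g scale0r addr0.
rewrite -[f (q + _)]/(g b) -g0.
have dg (c : R) : is_derive c 1 g ('D_T f (q + c *: T)) by exact: is_derive_line.
have [b0|b0] := leP 0 b.
  have [c cI ->] := MVT_segment b0 (fun c _ => dg c) (continuous_subspaceT cg).
  rewrite subr0 normrM ler_wpM2r// HK//.
  by move: cI; rewrite in_itv/= => /andP[c0 cb]; rewrite !ger0_norm.
have [c cI] := MVT_segment (ltW b0) (fun c _ => dg c) (continuous_subspaceT cg).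
rewrite distrC => ->; rewrite sub0r normrM normrN ler_wpM2r// HK//.
move: cI; rewrite in_itv/= => /andP[bc c0].
by rewrite !ler0_norm ?lerN2// ltW.
Qed.

End Lipschitz.

Section SphereLipschitz.
Context {R : realType} {m : nat}.
Local Notation X := 'rV[R]_m.+2.
Implicit Types (f : X -> R) (p q T x y : X).

Lemma sphere_tangent x : sphere x -> exists2 T, sphere T & dot x T = 0.
Proof.
move=> sx; have dx : dot x x = 1 by apply/sphere_dot.
have [i xi] : exists i, x 0 i ^+ 2 < 1.
  apply: contrapT => /forallNP no.
  have h i : 1 <= x 0 i ^+ 2 by rewrite leNgt; apply/negP; exact: no.
  have := sx; rewrite /sphere/= big_ord_recl (bigD1 ord0)//=.
  have := h ord0; have := h (lift ord0 ord0).
  have : 0 <= \sum_(i < m.+1 | i != ord0) x 0 (lift ord0 i) ^+ 2.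
    by apply: sumr_ge0 => j _; exact: sqr_ge0.
  lra.
have de : dot x (delta_mx 0 i) = x 0 i.
  rewrite /dot (bigD1 i)//= big1 ?addr0; last first.
    by move=> l lj; rewrite !mxE (negbTE lj) andbF mulr0.
  by rewrite mxE !eqxx mulr1.
pose T0 : X := delta_mx 0 i - x 0 i *: x.
have n0 : dot T0 T0 = 1 - x 0 i ^+ 2.
  rewrite /T0 dotBl !dotBr !dotZl !dotZr dx de (dotC _ x) de dot_delta eqxx.
  have -> : (true : bool)%:R = 1 :> R by [].
  ring.
have s0 : 0 < 1 - x 0 i ^+ 2 by rewrite subr_gt0.
exists ((Num.sqrt (1 - x 0 i ^+ 2))^-1 *: T0).
  apply/sphere_dot; rewrite dotZl dotZr n0 mulrA -invfM -expr2 sqr_sqrtr ?(ltW s0)//.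
  by rewrite mulVf// gt_eqF.
by rewrite dotZr /T0 dotBr dotZr dx de mulr1 subrr mulr0.
Qed.

Lemma C1norm_bounds f : (C1norm f <= 1)%E ->
  (forall x, sphere x -> `|f x| <= 1) /\
  (forall x T, sphere x -> sphere T -> dot x T = 0 -> `|'D_T f x| <= 1).
Proof.
rewrite /C1norm; set A := ereal_sup _; set B := ereal_sup _ => AB.
have hA x : sphere x -> (`|f x|%:E <= A)%E by move=> sx; apply: ereal_sup_ubound; exists x.
have hB x T : sphere x -> sphere T -> dot x T = 0 -> (`|'D_T f x|%:E <= B)%E.
  move=> sx sT xT; apply: ereal_sup_ubound; exists `|'D_T f x| => //.
  by exists x, T; split.
split => [x sx|x T sx sT xT].
  have [T sT xT] := sphere_tangent sx.
  have := leeD (hA x sx) (hB x T sx sT xT) => /le_trans/(_ AB).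
  by rewrite -EFinD lee_fin; apply: le_trans; rewrite lerDl.
have := leeD (hA x sx) (hB x T sx sT xT) => /le_trans/(_ AB).
by rewrite -EFinD lee_fin; apply: le_trans; rewrite lerDr.
Qed.

(** Rational parametrization of the unit circle by [s = tan (theta / 2)]. *)
Definition arcx (s : R) : R := (1 - s ^+ 2) / (1 + s ^+ 2).
Definition arcy (s : R) : R := 2 * s / (1 + s ^+ 2).

Let den (s : R) : 0 < 1 + s ^+ 2.
Proof. by rewrite ltr_wpDr// sqr_ge0. Qed.

Lemma sphere_arc p T (s : R) : sphere p -> sphere T -> dot p T = 0 ->
  sphere (arcx s *: p + arcy s *: T).
Proof.
move=> /sphere_dot sp /sphere_dot sT pT; apply/sphere_dot.
rewrite dotDl !dotDr !dotZl !dotZr sp sT (dotC T) pT /arcx /arcy.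
by field; rewrite gt_eqF.
Qed.

(** The arc is followed first along [p], where the displacement is quadratic
    in [s], and then along [T]; only the continuity of two directional
    derivatives enters. *)
Lemma arc_local f p T (e : R) : smooth_on setT f -> 0 < e ->
  `|'D_T f p| <= 1 -> exists2 r : R, 0 < r & forall s, `|s| < r ->
  `|f (arcx s *: p + arcy s *: T) - f p| <= (2 + e) * `|s|.
Proof.
move=> sf e0 D1.
have cf : continuous f by move=> x; have [] := sf [::] x I.
have df v x : derivable f x v by have [_ H] := sf [::] x I; exact: H.
have cD v : continuous ('D_v f) by move=> x; have [] := sf [:: v] x I.
pose B := `|'D_p f p| + 1.
have B0 : 0 < B by rewrite ltr_wpDl.
pose Q (a b : R) := `|'D_T f (p + a *: p + b *: T)| <= 1 + e / 4 /\
  `|'D_p f (p + a *: p + b *: T)| <= B.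
have [d d0 Hd] : exists2 d : R, 0 < d & forall a b : R, `|a| < d -> `|b| < d -> Q a b.
  have N : \forall y \near p, `|'D_T f y| < 1 + e / 4 /\ `|'D_p f y| < B.
    have cn v : {for p, continuous (fun y => `|'D_v f y|)} 
      by apply: (@continuous_comp _ _ _ ('D_v f) Num.norm); [exact: cD|exact: norm_continuous].
    near=> y; split; near: y.
      by apply: (cvgr_lt _ (cn T)); rewrite (le_lt_trans D1)// ltrDl divr_gt0.
    by apply: (cvgr_lt _ (cn p)); rewrite /B ltrDl.
  have [d0 dp Hd] := (@nbhs_normP _ _ _ _).1 N.
  have K0 : 0 < 1 + (`|p| + `|T|) by rewrite ltr_wpDr// addr_ge0.
  exists (d0 / (1 + (`|p| + `|T|))); first by rewrite divr_gt0.
  move=> a b ha hb; have [|h1 h2] := Hd (p + a *: p + b *: T); last first.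
    by split; exact: ltW.
  rewrite /ball_/= opprD opprD !addrA subrr add0r -opprD normrN.
  apply: le_lt_trans (ler_normD _ _) _; rewrite !normrZ.
  rewrite ltr_pdivlMr// in ha; rewrite ltr_pdivlMr// in hb.
  move: (normr_ge0 p) (normr_ge0 T) (normr_ge0 a) (normr_ge0 b) ha hb.
  move: (`|p|) (`|T|) (`|a|) (`|b|) => P S u v P0 S0 u0 v0 hu hv.
  have [uv|/ltW uv] := leP u v.
    have := ler_wpM2r P0 uv; lra.
  have := ler_wpM2r S0 uv; lra.
pose r := Num.min 1 (Num.min (d / 4) (e / 4 / B)).
exists r; first by rewrite !lt_min ltr01 !divr_gt0.
move=> s; rewrite !lt_min => /andP[s1 /andP[sd se]].
have -> : arcx s = 1 + (arcx s - 1) by rewrite addrC subrK.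
set a := arcx s - 1; set b := arcy s.
have ss : 0 <= s ^+ 2 by exact: sqr_ge0.
have sn : s ^+ 2 = `|s| * `|s| by rewrite -expr2 real_normK ?num_real.
have ha : `|a| <= 2 * `|s| * `|s|.
  rewrite /a /arcx; have -> : (1 - s ^+ 2) / (1 + s ^+ 2) - 1 = - (2 * s ^+ 2 / (1 + s ^+ 2)).
    by field; rewrite gt_eqF.
  rewrite normrN ger0_norm; last first.
    by apply: divr_ge0; [exact: mulr_ge0|exact: ltW].
  have -> : 2 * `|s| * `|s| = 2 * s ^+ 2 by rewrite sn mulrA.
  rewrite ler_pdivrMr//.
  by apply: ler_peMr; [exact: mulr_ge0|rewrite lerDl].
have hb : `|b| <= 2 * `|s|.
  rewrite /b /arcy !normrM normfV (gtr0_norm (den s)) (@ger0_norm _ 2)//.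
  rewrite ler_pdivrMr//.
  by apply: ler_peMr; [exact: mulr_ge0|rewrite lerDl].
have ha2 : `|a| <= 2 * `|s|.
  by apply: le_trans ha _; rewrite ler_piMr ?mulr_ge0// ltW.
have b1 (c : R) : `|c| <= `|b| -> `|'D_T f (p + a *: p + c *: T)| <= 1 + e / 4.
  move=> cb; have := @Hd a c; rewrite /Q; case => //; first by lra.
  by apply: le_lt_trans cb _; lra.
have b2 (c : R) : `|c| <= `|a| -> `|'D_p f (p + c *: p)| <= B.
  move=> ca; have := @Hd c 0; rewrite /Q normr0 scale0r addr0; case => //.
  by apply: le_lt_trans ca _; lra.
have l1 := line_bound (df T) cf b1.
have l2 := line_bound (df p) cf b2.
rewrite scalerDl scale1r -[_ - f p](subrKA (f (p + a *: p))).
apply: le_trans (ler_normD _ _) _; apply: le_trans (lerD l1 l2) _.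
have t1 : (1 + e / 4) * `|b| <= (1 + e / 4) * (2 * `|s|).
  by rewrite ler_wpM2l// addr_ge0// divr_ge0// ltW.
have t2 : B * `|a| <= B * (2 * `|s| * `|s|) by rewrite ler_wpM2l// ltW.
have t3 : B * (2 * `|s| * `|s|) <= e / 2 * `|s|.
  rewrite mulrA ler_wpM2r//; move: se; rewrite ltr_pdivlMr//; lra.
lra.
Unshelve. all: by end_near. Qed.

(** The subtraction formula of the tangent. *)
Lemma arc_add (s s' : R) : 0 <= s -> 0 <= s' -> let u := (s' - s) / (1 + s * s') in
  arcx s' = arcx u * arcx s - arcy u * arcy s /\
  arcy s' = arcx u * arcy s + arcy u * arcx s.
Proof.
move=> s0 s0' u.
have q0 : 1 + s * s' != 0 by rewrite gt_eqF// ltr_wpDr// mulr_ge0.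
have n1 : 1 + s ^+ 2 != 0 by rewrite gt_eqF.
have n2 : 1 + s' ^+ 2 != 0 by rewrite gt_eqF.
have n3 : (1 + s * s') ^+ 2 + (s' - s) ^+ 2 != 0.
  have -> : (1 + s * s') ^+ 2 + (s' - s) ^+ 2 = (1 + s ^+ 2) * (1 + s' ^+ 2) by ring.
  by rewrite mulf_neq0.
by rewrite /arcx /arcy /u; split; field; rewrite ?n1 ?n2 ?n3 ?q0.
Qed.

Lemma arc_lipschitz f x T (t : R) : smooth_on setT f -> (C1norm f <= 1)%E ->
  sphere x -> sphere T -> dot x T = 0 -> 0 <= t ->
  `|f (arcx t *: x + arcy t *: T) - f x| <= 2 * t.
Proof.
move=> sf f1 sx sT xT t0; have [_ D1] := C1norm_bounds f1.
have [dx dT] : dot x x = 1 /\ dot T T = 1 by split; apply/sphere_dot.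
pose psi s := f (arcx s *: x + arcy s *: T).
have a0 : arcx 0 = 1 by rewrite /arcx expr0n subr0 addr0 divff// oner_eq0.
have b0 : arcy 0 = 0 by rewrite /arcy mulr0 mul0r.
have -> : f x = psi 0 by rewrite /psi a0 b0 scale1r scale0r addr0.
apply/ler_addgt0Pr => e e0.
have e1 : 0 < e / (1 + t) by rewrite divr_gt0// ltr_wpDr.
apply: (@le_trans _ _ ((2 + e / (1 + t)) * t)); last first.
  by rewrite mulrDl lerD2l mulrAC ler_pdivrMr ?ltr_wpDr// ler_wpM2l ?(ltW e0)// lerDr.
apply: (@local_lipschitz_bound _ psi) => // s /andP[s0 st].
pose p := arcx s *: x + arcy s *: T; pose T' := - arcy s *: x + arcx s *: T.
have cs : arcx s ^+ 2 + arcy s ^+ 2 = 1 by rewrite /arcx /arcy; field; rewrite gt_eqF.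
have pT : dot p T' = 0.
  by rewrite /p /T' dotDl !dotDr !dotZl !dotZr dx dT (dotC T) xT; ring.
have sT' : sphere T'.
  apply/sphere_dot; rewrite /T' dotDl !dotDr !dotZl !dotZr dx dT (dotC T) xT -[RHS]cs; ring.
have [r r0 H] := arc_local sf e1 (D1 _ _ (sphere_arc s sx sT xT) sT' pT).
exists r => // s' /andP[s0' _] hs.
have [E1 E2] := arc_add s0 s0'.
set u := (s' - s) / (1 + s * s') in E1 E2.
have us : `|u| <= `|s' - s|.
  have q0 : 0 <= s * s' by exact: mulr_ge0.
  rewrite normrM normfV (@ger0_norm _ (1 + s * s')) ?addr_ge0// ler_pdivrMr ?ltr_wpDr//.
  by apply: ler_peMr => //; rewrite lerDl.
have := H u (le_lt_trans us hs).
have -> : arcx u *: p + arcy u *: T' = arcx s' *: x + arcy s' *: T.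
  rewrite /p /T' E1 E2; apply/rowP => i; rewrite !mxE; ring.
by move=> /le_trans; apply; apply: ler_wpM2l => //; apply: addr_ge0 => //; exact: ltW.
Qed.

(** Along an arc of angle [theta] the function varies by at most [2 * tan
    (theta / 2)], and [(1 + cos theta) / 2 = (1 + tan (theta / 2) ^ 2)^-1]. *)
Lemma sphere_lipschitz f x y (e : R) : smooth_on setT f -> (C1norm f <= 1)%E ->
  sphere x -> sphere y -> 0 < e -> e < `|f x - f y| ->
  (1 + dot x y) / 2 <= (1 + e ^+ 2 / 4)^-1.
Proof.
move=> sf f1 sx sy e0 he.
have [dx dy] : dot x x = 1 /\ dot y y = 1 by split; apply/sphere_dot.
set c := dot x y.
have c1 : 0 <= 1 + c.
  have := dot_ge0 (x + y); rewrite dotDl !dotDr dx dy (dotC y) -/c; lra.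
have c2 : 0 <= 1 - c.
  have := dot_ge0 (x - y); rewrite dotBl !dotBr dx dy (dotC y) -/c; lra.
have q0 : 0 < 1 + e ^+ 2 / 4 by rewrite ltr_wpDr// divr_ge0// sqr_ge0.
have [c10|c10] := eqVneq (1 + c) 0; first by rewrite c10 mul0r invr_ge0 ltW.
have c1p : 0 < 1 + c by rewrite lt_def c10.
pose w := y - c *: x.
have ww : dot w w = (1 - c) * (1 + c).
  by rewrite /w dotBl !dotBr !dotZl !dotZr dx dy (dotC y) -/c; ring.
have [c20|c20] := eqVneq (1 - c) 0.
  move: ww; rewrite c20 mul0r => /eqP; rewrite dot_eq0 subr_eq0 => /eqP yx.
  by move: he; rewrite yx (_ : c = 1) ?scale1r ?subrr ?normr0 ?ltNge ?(ltW e0)//; move: c20; lra.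
have c2p : 0 < 1 - c by rewrite lt_def c20.
pose a := Num.sqrt (1 - c); pose b := Num.sqrt (1 + c).
have ap : 0 < a by rewrite sqrtr_gt0.
have bp : 0 < b by rewrite sqrtr_gt0.
have a2 : a ^+ 2 = 1 - c by rewrite sqr_sqrtr.
have b2 : b ^+ 2 = 1 + c by rewrite sqr_sqrtr.
have ab : a ^+ 2 + b ^+ 2 = 2 by rewrite a2 b2; ring.
have [an bn] : a != 0 /\ b != 0 by rewrite !gt_eqF.
pose T := (a * b)^-1 *: w; pose t := a / b.
have sT : sphere T.
  apply/sphere_dot; rewrite dotZl dotZr ww -a2 -b2.
  by field; rewrite an bn.
have xT : dot x T = 0 by rewrite dotZr /w dotBr dotZr dx -/c mulr1 subrr mulr0.
have n2 : b ^+ 2 + a ^+ 2 != 0 by rewrite addrC ab.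
have E : y = arcx t *: x + arcy t *: T.
  have -> : arcx t = c.
    have -> : arcx t = (b ^+ 2 - a ^+ 2) / (b ^+ 2 + a ^+ 2).
      by rewrite /arcx /t; field; rewrite bn n2.
    by rewrite (addrC (b ^+ 2) (a ^+ 2)) ab a2 b2; field.
  have tT : arcy t * (a * b)^-1 = 1.
    have -> : arcy t = 2 * a * b / (b ^+ 2 + a ^+ 2).
      by rewrite /arcy /t; field; rewrite bn n2.
    by rewrite (addrC (b ^+ 2) (a ^+ 2)) ab; field; rewrite an bn.
  by rewrite scalerA tT scale1r /w addrC subrK.
have := arc_lipschitz sf f1 sx sT xT (ltW (divr_gt0 ap bp) : 0 <= t).
rewrite -E distrC => /(lt_le_trans he) et.
have -> : (1 + c) / 2 = (1 + t ^+ 2)^-1.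
  by rewrite -b2 -ab /t; field; rewrite ?bn ?n2 ?ab ?pnatr_eq0.
rewrite lef_pV2 ?posrE// ?ltr_wpDr ?sqr_ge0//.
rewrite lerD2l ler_pdivrMr//.
have : e ^+ 2 <= (2 * t) ^+ 2 by rewrite ler_pXn2r ?nnegrE ?ltW// (lt_trans e0 et).
by rewrite exprMn; lra.
Qed.

End SphereLipschitz.

(** * Comparison of Fekete means with the invariant integral *)
Section MeanBound.
Context {R : realType} {n : nat}.
Local Notation X := 'rV[R]_n.+1.
Variable sigma : probability (borel_rV R n) R.
Hypothesis sigma1 : sigma sphere = 1%E.
Hypothesis sigma_inv : forall (F : X -> R) g, continuous F -> ortho g ->
  sint sigma (fun x => F (x *m g)) = sint sigma F.
Local Notation I := (sint sigma).
Local Notation ip := (ip sigma).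
Local Notation gs := (gs sigma).
Local Notation dimS := (@dimS n).

Lemma eq_rep es (u v : X -> R) : (forall x, sphere x -> u x = v x) ->
  rep sigma es v -> rep sigma es u.
Proof.
move=> uv rv x sx; rewrite uv// rv//; apply: eq_bigr => e _.
by rewrite (eq_ipl sigma e uv).
Qed.

Definition mono_seq k : seq (X -> R) := [seq @top_mono R n k u | u : (@exponents n k + @exponents n k.-1)%type].

Lemma mono_seq_poly k u : polyfun k (@top_mono R n k u).
Proof.
by case: u => t; apply: polyfun_mono; rewrite sum_expo ?leq_pred.
Qed.

Lemma onb k t : poly_seq k t -> let es := gs (mono_seq k ++ t) in
  [/\ poly_seq k es, forall h, polyfun k h -> rep sigma es h,
      forall e, e \in es -> ip e e = 1 & (size es <= dimS k)%N].
Proof.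
move=> pt es.
have ps : poly_seq k (mono_seq k ++ t).
  move=> e; rewrite mem_cat => /orP[/mapP[u _ ->]|]; [exact: mono_seq_poly|exact: pt].
have [pes rs _ on pw] := gs_spec sigma1 sigma_inv ps.
split => //.
  move=> h /polyfun_span[c hc]; apply: (@eq_rep _ _ _ hc).
  have [] // := @rep_comb _ _ sigma sigma1 k es _
    (index_enum (@exponents n k + @exponents n k.-1)%type) c (@top_mono R n k) pes _.
  move=> u _; split; first exact: polyfun_continuous (mono_seq_poly u).
  by apply: rs; rewrite mem_cat; apply/orP; left; apply: map_f; rewrite mem_enum.
rewrite -(card_top_mono k).
apply: (size_onb sigma1 (pes : poly_seq k es) on pw) => e ees.
by apply: polyfun_span; exact: pes.
Qed.

Variables (k m N : nat) (x : 'I_N -> X) (f : X -> R) (eps q : R).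
Hypothesis k_gt0 : (0 < k)%N.
Hypothesis fekete : fekete_point k x.
Hypothesis cf : continuous f.
Hypothesis f1 : forall y, sphere y -> `|f y| <= 1.
Hypothesis eps_gt0 : 0 < eps.
Hypothesis q_ge0 : 0 <= q.
Hypothesis f_lip : forall y z, sphere y -> sphere z -> eps < `|f y - f z| ->
  (1 + dot y z) / 2 <= q.

Let sx i : sphere (x i). Proof. by case: fekete. Qed.

(** The factor [((1 + dot z (x j)) / 2) ^+ m] is [1] at the node and at most
    [q ^+ m] at the points where the value of [f] differs from the one at the
    node by more than [eps]. *)
Lemma localized_lagrange : exists G : 'I_N -> X -> R, [/\ forall j, polyfun (k + m) (G j),
  forall i j, G j (x i) = (i == j)%:R
  & forall j z, sphere z -> eps < `|f z - f (x j)| -> `|G j z| <= q ^+ m].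
Proof.
have [g [pg gx g1]] := lagrange_poly fekete.
exists (fun j z => g j z * ((1 + dot z (x j)) / 2) ^+ m); split.
- move=> j; apply: polyfunM => //; rewrite -[m in polyfun m]muln1; apply: polyfunX.
  rewrite (_ : (fun x => _) = fun z => 2^-1 * (1 + dot z (x j))).
    by apply: polyfunZ; apply: polyfunD; [exact: polyfun_cst|exact: polyfun_dot].
  by apply/funext => z; rewrite mulrC.
- move=> i j; rewrite gx; have [->|ij] := eqVneq i j; last by rewrite mul0r.
  have /sphere_dot -> := sx j.
  by rewrite (_ : (1 + 1) / 2 = 1 :> R) ?expr1n ?mulr1//; field.
- move=> j z sz lip; rewrite normrM normrX -[leRHS]mul1r.
  have d0 : 0 <= (1 + dot z (x j)) / 2.
    have := dot_ge0 (z + x j); rewrite dotDl !dotDr (dotC (x j) z).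
    have /sphere_dot -> := sx j; have /sphere_dot -> := sz; lra.
  apply: ler_pM => //; first exact: g1.
  by apply: lerXn2r; rewrite ?nnegrE// ger0_norm//; exact: f_lip.
Qed.

Section Flag.
Variables (G : 'I_N -> X -> R) (M : R).
Hypothesis pG : forall j, polyfun (k + m) (G j).
Hypothesis Gx : forall i j, G j (x i) = (i == j)%:R.
Hypothesis Gq : forall j z, sphere z -> eps < `|f z - f (x j)| -> `|G j z| <= q ^+ m.
Hypothesis M_ge0 : 0 <= M.

Definition far_error : R := 2 * (N%:R * (Num.sqrt M * q ^+ m)) ^+ 2.

(** [h] lies in the span of the [G i] with [i] in [l]. *)
Definition flag (l : seq 'I_N) (h : X -> R) :=
  (forall z, h z = \sum_i h (x i) * G i z) /\ forall i, i \notin l -> h (x i) = 0.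

(** A normalized element of the flag is negligible wherever [f] exceeds all the
    values at the nodes by more than [eps]. *)
Lemma flag_bound (l : seq 'I_N) h (A : R) : flag l h -> -1 <= A ->
  (forall i, i \in l -> f (x i) <= A) ->
  (forall z, sphere z -> h z ^+ 2 <= M) ->
  forall z, sphere z -> f z * h z ^+ 2 <= (A + eps) * h z ^+ 2 + far_error.
Proof.
move=> [hE h0] A1 lA hM z sz.
have t0 : 0 <= far_error by rewrite mulr_ge0// sqr_ge0.
have s0 := sqr_ge0 (h z).
have [fz|fz] := leP (f z) (A + eps).
  by apply: le_trans (ler_wpM2r s0 fz) _; rewrite lerDl.
have hz : `|h z| <= N%:R * (Num.sqrt M * q ^+ m).
  rewrite hE; apply: le_trans (ler_norm_sum _ _ _) _.
  apply: (@le_trans _ _ (\sum_(i < N) (Num.sqrt M * q ^+ m))); last first.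
    by rewrite sumr_const card_ord mulr_natl.
  apply: ler_sum => i _; rewrite normrM.
  have [il|/h0 ->] := boolP (i \in l); last first.
    by rewrite normr0 mul0r mulr_ge0 ?sqrtr_ge0 ?exprn_ge0.
  apply: ler_pM => //.
    by rewrite -sqrtr_sqr ler_sqrt//; exact: hM.
  apply: Gq => //; apply: lt_le_trans (ler_norm _).
  by have := lA i il; lra.
have hz2 : h z ^+ 2 <= (N%:R * (Num.sqrt M * q ^+ m)) ^+ 2.
  rewrite -(real_normK (num_real (h z))) ler_pXn2r ?nnegrE//.
  by rewrite mulr_ge0// mulr_ge0 ?sqrtr_ge0 ?exprn_ge0.
have fz1 : f z <= 1 by apply: le_trans (ler_norm _) (f1 sz).
have : (f z - (A + eps)) * h z ^+ 2 <= 2 * h z ^+ 2.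
  apply: ler_wpM2r => //; move: eps_gt0 A1 fz1; lra.
by rewrite /far_error; lra.
Qed.

Lemma flagB l u v : flag l u -> flag l v -> flag l (fun z => u z - v z).
Proof.
move=> [uE u0] [vE v0]; split => [z|i il]; last by rewrite u0// v0// subrr.
by rewrite {1}uE {1}vE -sumrB; apply: eq_bigr => i _; rewrite mulrBl.
Qed.

Lemma flagZ l (c : R) u : flag l u -> flag l (fun z => c * u z).
Proof.
move=> [uE u0]; split => [z|i il]; last by rewrite u0// mulr0.
by rewrite {1}uE mulr_sumr; apply: eq_bigr => i _; rewrite mulrA.
Qed.

Lemma flag_proj l es u : (forall e, e \in es -> flag l e) -> flag l (proj sigma es u).
Proof.
elim: es => [|e es IH] H.
  rewrite /proj (_ : (fun x => _) = fun=> 0); last by apply/funext => z; rewrite big_nil.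
  by split => // z; rewrite big1// => i _; rewrite mul0r.
rewrite /proj (_ : (fun x => _) = fun z => ip u e * e z - (-1) * proj sigma es u z).
  apply: flagB; apply: flagZ; first by apply: H; rewrite mem_head.
  by apply: IH => v vs; apply: H; rewrite in_cons vs orbT.
by apply/funext => z; rewrite big_cons mulN1r opprK.
Qed.

(** Orthonormalizing in the order of increasing values of [f] makes the
    element attached to a node a combination of functions attached to nodes
    where [f] is not larger, to which [flag_bound] applies. *)
Lemma flag_gs (l : seq 'I_N) : uniq l -> pairwise (fun i j => f (x j) <= f (x i)) l ->
  let es := gs (map G l) in
  [/\ size es = size l, forall e, e \in es -> flag l e
    & (forall e, e \in es -> forall z, sphere z -> e z ^+ 2 <= M) ->
      \sum_(e <- es) I (fun z => f z * (e z * e z)) <= \sum_(i <- l) (f (x i) + (eps + far_error))].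
Proof.
elim: l => [|j l IH]; first by move=> _ _; split; rewrite // !big_nil.
rewrite [uniq _]/= pairwise_cons => /andP[jl ul] /andP[/allP dj dl].
have [sz fl bd] := IH ul dl.
have pml : poly_seq (k + m) (map G (j :: l)) by move=> e /mapP[i _ ->].
have [pes _ _ on _] := gs_spec sigma1 sigma_inv pml.
rewrite /= in pes on *; set es := gs (map G l) in sz fl bd pes on *.
set r := resid sigma es (G j) in pes on *.
have wk e : flag l e -> flag (j :: l) e.
  by move=> [eE e0]; split => // i; rewrite in_cons negb_or => /andP[_ /e0].
have fG : flag (j :: l) (G j).
  split => [z|i]; last by rewrite in_cons negb_or Gx => /andP[/negbTE ->].
  rewrite (bigD1 j)//= Gx eqxx mul1r big1 ?addr0// => i ij.
  by rewrite Gx (negbTE ij) mul0r.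
have fr : flag (j :: l) r by apply: flagB => //; apply: flag_proj => e /fl/wk.
have rj : r (x j) = 1.
  rewrite /r /resid Gx eqxx (flag_proj (G j) fl).2//; exact: subr0.
have pr : polyfun (k + m) r.
  apply: polyfunB => //; apply: poly_seq_proj => e ees; apply: pes.
  by case: ifP => // _; rewrite in_cons ees orbT.
have rr : ip r r != 0.
  apply/eqP => H.
  have := @ip_eq0 _ _ sigma sigma1 sigma_inv r (polyfun_continuous pr) H _ (sx j).
  by rewrite rj => /eqP; rewrite oner_eq0.
rewrite (negbTE rr) in pes on *; set e0 := fun z => _.
have fe0 : flag (j :: l) e0 by exact: flagZ.
split; first by rewrite /= sz.
  by move=> e; rewrite in_cons => /orP[/eqP ->//|/fl/wk].
move=> HM; rewrite !big_cons; apply: lerD; last first.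
  by apply: bd => e ees; apply: HM; rewrite in_cons ees orbT.
have ce0 : continuous e0.
  by apply: (@polyfun_continuous _ _ (k + m)); apply: pes; rewrite mem_head.
have cee := continuousM_fun ce0 ce0.
have -> : f (x j) + (eps + far_error) = I (fun z => (f (x j) + eps) * (e0 z * e0 z) + far_error).
  rewrite sintD//; [|by apply: continuousM_fun => // z; exact: cst_continuous
    |by move=> z; exact: cst_continuous].
  rewrite sintZ// sint_cst// -[I _]/(ip e0 e0) on ?mem_head// mulr1; ring.
apply: le_sint => //.
- exact: continuousM_fun.
- move=> z; apply: (@continuousD _ _ _ (fun z => (f (x j) + eps) * (e0 z * e0 z))).
    by apply: continuousM_fun => // y; exact: cst_continuous.
  exact: cst_continuous.
move=> z sz'; rewrite -expr2; apply: (flag_bound fe0) => //.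
- by have := f1 (sx j); rewrite ler_norml => /andP[].
- by move=> i; rewrite in_cons => /orP[/eqP ->|/dj].
by apply: HM; rewrite mem_head.
Qed.

End Flag.

Lemma dim_le_nodes : (dimS k <= N)%N.
Proof.
have [_ [s [_ _ sp] _]] := fekete.
rewrite -(card_top_mono k) -[N in (_ <= N)%N]card_ord.
apply: (indep_card (@top_mono_indep R n k k_gt0)) => u; apply: sp.
by have [p hp E] := mono_seq_poly u; exists p => // y _.
Qed.

(** The sum of the integrals of [f * e ^+ 2] over an orthonormal basis of the
    polynomials of degree [k + m] is the integral of [f] times the dimension,
    because the kernel is constant. The basis starts with the elements
    attached to the nodes, which contribute little more than the values of [f]
    there; the other elements contribute at most [1] each, and they are few. *)
Lemma mean_upper (D : R) : D = (dimS (k + m))%:R ->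
  I f <= N%:R^-1 * (\sum_i f (x i)) +
    (eps + 2 * D ^+ 3 * (q ^+ m) ^+ 2 + 2 * (1 - (dimS k)%:R / D)).
Proof.
move=> DE.
have [G [pG Gx Gq]] := localized_lagrange.
(* [gs] processes lists from the right, so the nodes are listed by decreasing [f]. *)
pose rel i j := f (x j) <= f (x i).
pose l := sort rel (enum 'I_N).
have rel_tr : transitive rel by move=> a b c ba ac; exact: le_trans ac ba.
have rel_tot : total rel by move=> a b; exact: le_total.
have pl : pairwise rel l.
  by rewrite -(sorted_pairwise rel_tr); exact: sort_sorted.
have ul : uniq l by rewrite sort_uniq enum_uniq.
have sl : size l = N by rewrite size_sort size_enum_ord.
have pmG : poly_seq (k + m) (map G l) by move=> e /mapP[i _ ->].
have [pes full on szD] := onb pmG.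
have [t Et] := gs_cat sigma (mono_seq (k + m)) (map G l).
set es := gs (mono_seq (k + m) ++ map G l) in pes full on szD Et.
pose M : R := (size es)%:R.
have ces e : e \in es -> continuous e by move=> /pes/polyfun_continuous.
have hM e : e \in es -> forall z, sphere z -> e z ^+ 2 <= M.
  move=> ees z sz; have := @kern_bound _ _ sigma sigma1 _ es pes full e z (pes _ ees) sz.
  by rewrite on// mul1r (@kern_const _ _ sigma sigma1 sigma_inv _ es pes full z on sz).
have [szg _ bd] := flag_gs pG Gx Gq (ler0n _ _ : 0 <= M) ul pl.
set gl := gs (map G l) in szg bd Et.
have Mt : M = (size t)%:R + N%:R by rewrite /M Et size_cat szg sl natrD.
have E1 : M * I f = \sum_(e <- es) I (fun z => f z * (e z * e z)).
  pose ei (i : 'I_(size es)) : X -> R := nth (fun=> 0) es i.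
  have cei i : continuous (ei i) by apply: ces; exact: mem_nth.
  have [S _] := sint_sum sigma1 (index_enum 'I_(size es))
    (fun i => continuousM_fun cf (continuousM_fun (cei i) (cei i))).
  rewrite (big_nth (fun=> 0)) big_mkord -[RHS]S -sintZ//.
  apply: eq_sint => z sz; rewrite -mulr_sumr mulrC; congr (_ * _).
  rewrite /M -(@kern_const _ _ sigma sigma1 sigma_inv _ es pes full z on sz).
  by rewrite /kern (big_nth (fun=> 0)) big_mkord; apply: eq_bigr => i _; rewrite expr2.
have E2 : M * I f <= (size t)%:R + \sum_(i <- l) (f (x i) + (eps + far_error M)).
  rewrite E1 Et big_cat; apply: lerD; last first.
    by apply: bd => e eg; apply: hM; rewrite Et mem_cat eg orbT.
  rewrite -sum1_size natr_sum big_seq [leRHS]big_seq; apply: ler_sum => e et.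
  have ees : e \in es by rewrite Et mem_cat et.
  have ce := ces e ees; have cee := continuousM_fun ce ce.
  rewrite -[leRHS](on e ees); apply: le_sint => //; first exact: continuousM_fun.
  move=> z sz; rewrite -expr2 ler_piMl ?sqr_ge0//.
  by apply: le_trans (ler_norm _) (f1 sz).
have E3 : \sum_(i <- l) (f (x i) + (eps + far_error M)) = \sum_i f (x i) + N%:R * (eps + far_error M).
  have perm : perm_eq l (enum 'I_N) by rewrite perm_sort.
  by rewrite (perm_big _ perm) big_enum/= big_split/= sumr_const card_ord mulr_natl.
have dk : 0 < (dimS k)%:R :> R by rewrite ltr0n addn_gt0 bin_gt0 leq_addr.
have kN : (dimS k)%:R <= N%:R :> R by rewrite ler_nat; exact: dim_le_nodes.
have N0 : 0 < N%:R :> R by apply: lt_le_trans dk kN.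
have NM : N%:R <= M by rewrite Mt lerDr.
have M0 : 0 < M by apply: lt_le_trans N0 NM.
have MD : M <= D by rewrite DE ler_nat.
have D0 : 0 < D by apply: lt_le_trans M0 MD.
have S1 : - N%:R <= \sum_i f (x i).
  have -> : - N%:R = \sum_(i < N) (-1 : R) by rewrite sumr_const card_ord mulNrn.
  by apply: ler_sum => i _; have := f1 (sx i); rewrite ler_norml => /andP[].
have tD : far_error M <= 2 * D ^+ 3 * (q ^+ m) ^+ 2.
  rewrite /far_error !exprMn sqr_sqrtr ?(ltW M0)// -mulrA ler_wpM2l//.
  rewrite mulrA; apply: ler_wpM2r; first exact: sqr_ge0.
  rewrite (exprSr D 2); apply: ler_pM; [exact: sqr_ge0|exact: ltW| |exact: MD].
  by apply: lerXn2r; rewrite ?nnegrE ?(ltW D0)//; exact: le_trans NM MD.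
move: E2; rewrite E3; set S := \sum_i f (x i) in S1 *; set T := far_error M in tD *.
have -> : (size t)%:R = M - N%:R :> R by rewrite Mt addrK.
move=> E2.
have T0 : 0 <= T by rewrite mulr_ge0// sqr_ge0.
have c1 : 1 - N%:R / M <= 1 - (dimS k)%:R / D.
  rewrite lerD2l lerN2; apply: ler_pM => //; first by rewrite invr_ge0 ltW.
  by rewrite lef_pV2 ?posrE.
have c2 : I f <= 2 * (1 - N%:R / M) + N%:R^-1 * S + (eps + T).
  rewrite -(ler_pM2l M0); apply: le_trans E2 _.
  have -> : M * (2 * (1 - N%:R / M) + N%:R^-1 * S + (eps + T)) =
     2 * (M - N%:R) + M / N%:R * S + M * (eps + T).
    by field; rewrite !gt_eqF.
  have h1 : N%:R * (eps + T) <= M * (eps + T).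
    by rewrite ler_wpM2r// addr_ge0// ltW.
  have h2 : S - (M - N%:R) <= M / N%:R * S.
    rewrite -(ler_pM2l N0).
    have -> : N%:R * (M / N%:R * S) = M * S by field; rewrite gt_eqF.
    have : 0 <= (S + N%:R) * (M - N%:R) by rewrite mulr_ge0 ?subr_ge0// -lerBlDr sub0r.
    lra.
  lra.
lra.
Qed.

End MeanBound.

(** * The choice of parameters *)
Section ErrorBounds.
Context {R : realType}.
Implicit Types (n k m a r : nat).

Lemma leq_expl m1 m2 e : (m1 <= m2)%N -> (m1 ^ e <= m2 ^ e)%N.
Proof. by move=> h; case: e => // e; rewrite leq_exp2r. Qed.

Lemma bin_ratio n k m b : (n + k <= b.+1)%N ->
  ('C(b + m, n) * k ^ n <= 'C(b, n) * (k + m) ^ n)%N.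
Proof.
move=> hb; rewrite -(leq_pmul2r (fact_gt0 n)).
rewrite mulnAC [leqRHS]mulnAC !bin_ffact !ffact_prod.
have E (c : nat) : (c ^ n = \prod_(i < n) c)%N by rewrite prod_nat_const card_ord.
rewrite !E -!big_split/=; apply: leq_prod => -[i /= hi] _.
have ikb : (i + k <= b)%N by rewrite -ltnS (leq_trans _ hb)// -addSn leq_add2r.
have ib : (i <= b)%N := leq_trans (leq_addr _ _) ikb.
rewrite -addnBAC// mulnDl mulnDr leq_add2l mulnC leq_mul2r leq_subRL//.
by rewrite ikb orbT.
Qed.

Lemma dimS_ratio n k m : (0 < k)%N ->
  (@dimS n (k + m) * k ^ n <= @dimS n k * (k + m) ^ n)%N.
Proof.
case: k => // k _; rewrite /dimS !mulnDl; apply: leq_add.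
  by rewrite addnA; apply: bin_ratio; rewrite leqnSn.
by rewrite addSn/= addnA; apply: bin_ratio; rewrite addnS.
Qed.

Lemma bin_le_exp b n : ('C(b, n) <= b ^ n)%N.
Proof.
apply: (@leq_trans ('C(b, n) * n`!)); first by rewrite leq_pmulr// fact_gt0.
rewrite bin_ffact ffact_prod.
have -> : (b ^ n = \prod_(i < n) b)%N by rewrite prod_nat_const card_ord.
by apply: leq_prod => i _; exact: leq_subr.
Qed.

Lemma dimS_le n k : (@dimS n k <= 2 * (n + k) ^ n)%N.
Proof.
rewrite mul2n -addnn; apply: leq_add; first exact: bin_le_exp.
apply: leq_trans (bin_le_exp _ _) _; apply: leq_expl => //.
by rewrite leq_add2l leq_pred.
Qed.

Lemma bernoulli_le1 (t : R) n : 0 <= t <= 1 -> 1 - n%:R * t <= (1 - t) ^+ n.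
Proof.
move=> /andP[t0 t1]; elim: n => [|n IH]; first by rewrite mul0r subr0 expr0.
rewrite exprSr -natr1; have u0 : 0 <= 1 - t by rewrite subr_ge0.
have := ler_wpM2r u0 IH; have : 0 <= n%:R * t * t by rewrite !mulr_ge0.
by move: (n%:R : R) ((1 - t) ^+ n * (1 - t)) => u v; lra.
Qed.

Lemma bernoulli (t : R) n : 0 <= t -> 1 + n%:R * t <= (1 + t) ^+ n.
Proof.
move=> t0; elim: n => [|n IH]; first by rewrite mul0r addr0 expr0.
rewrite exprSr -natr1; have u0 : 0 <= 1 + t by rewrite addr_ge0.
have := ler_wpM2r u0 IH; have : 0 <= n%:R * t * t by rewrite !mulr_ge0.
by move: (n%:R : R) ((1 + t) ^+ n * (1 + t)) => u v; lra.
Qed.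

Lemma dimS_ratio_ge n k m : (0 < k)%N ->
  1 - (@dimS n k)%:R / (@dimS n (k + m))%:R <= n%:R * (m%:R / k%:R) :> R.
Proof.
move=> k0; have kR : 0 < k%:R :> R by rewrite ltr0n.
have kmR : 0 < (k + m)%:R :> R by rewrite ltr0n addn_gt0 k0.
have D0 : 0 < (@dimS n (k + m))%:R :> R by rewrite ltr0n addn_gt0 bin_gt0 leq_addr.
have h : (k%:R / (k + m)%:R) ^+ n <= (@dimS n k)%:R / (@dimS n (k + m))%:R :> R.
  rewrite ler_pdivlMr// expr_div_n mulrAC ler_pdivrMr ?exprn_gt0//.
  by rewrite mulrC -!natrX -!natrM ler_nat; exact: dimS_ratio.
have t1 : 0 <= (m%:R / (k + m)%:R : R) <= 1.
  by rewrite divr_ge0//= ler_pdivrMr// mul1r ler_nat leq_addl.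
have := bernoulli_le1 n t1.
have -> : 1 - m%:R / (k + m)%:R = k%:R / (k + m)%:R :> R.
  by rewrite natrD in kmR *; field; rewrite gt_eqF.
have : n%:R * (m%:R / (k + m)%:R) <= n%:R * (m%:R / k%:R) :> R.
  rewrite ler_wpM2l// ler_wpM2l// lef_pV2 ?posrE// ler_nat leq_addr//.
lra.
Qed.

Lemma exists_root (p k : nat) : (0 < p)%N -> (0 < k)%N ->
  exists a, [/\ (0 < a)%N, (a ^ p <= k)%N & (k < a.+1 ^ p)%N].
Proof.
move=> p0 k0.
have ex : exists a, (a ^ p <= k)%N by exists 1%N; rewrite exp1n.
have bd a : (a ^ p <= k)%N -> (a <= k)%N.
  by apply: leq_trans; case: a => // a; rewrite -{1}[a.+1]expn1 leq_pexp2l.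
have [a ak amax] := ex_maxnP ex bd.
exists a; split => //; first by apply: amax; rewrite exp1n.
by rewrite ltnNge; apply/negP => /amax; rewrite ltnn.
Qed.

(** With [m = 4 * err_exp n * a ^ 3] the factor [q ^+ m] is at most [(a + 1)
    ^- (err_exp n)], whose square times the cube of the dimension, of order
    [(a + 1) ^ (108 n)], is at most of order [(a + 1) ^- 2]. *)
Definition err_exp n : nat := (54 * n).+1.
Definition err_base n : nat := (n + 1 + 4 * err_exp n)%N.
Definition err_const n : R :=
  1 + 16 * (err_base n)%:R ^+ (3 * n) + 2 * (n%:R * (4 * err_exp n)%:R).

Lemma err_const_gt0 n : 0 < err_const n.
Proof.
have b0 : 0 <= (err_base n)%:R ^+ (3 * n) :> R by rewrite exprn_ge0.
have c0 : 0 <= n%:R * (4 * err_exp n)%:R :> R by rewrite mulr_ge0.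
rewrite /err_const; move: b0 c0; move: (_ ^+ _) (n%:R * _) => u w; lra.
Qed.

(** [(1 + 1 / (4 a ^ 2)) ^ (4 a ^ 2) >= 2] and [2 ^ a >= a + 1]. *)
Lemma localization_decay a r : (0 < a)%N ->
  ((1 + (a%:R^-1 : R) ^+ 2 / 4)^-1) ^+ (4 * r * a ^ 3) <= (a.+1%:R ^- r).
Proof.
move=> a0; have aR : 0 < a%:R :> R by rewrite ltr0n.
set t : R := _ ^+ 2 / 4; have t0 : 0 <= t by rewrite divr_ge0// sqr_ge0.
rewrite exprVn lef_pV2 ?posrE ?exprn_gt0 ?ltr0n// ?ltr_wpDr//.
have -> : (4 * r * a ^ 3 = (4 * a ^ 2) * (a * r))%N by ring.
rewrite exprM exprM; apply: lerXn2r; rewrite ?nnegrE// ?exprn_ge0 ?addr_ge0//.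
have h2 : 2 <= (1 + t) ^+ (4 * a ^ 2).
  apply: le_trans (bernoulli _ t0).
  rewrite (_ : (4 * a ^ 2)%:R * t = 1)//.
  by rewrite /t natrM natrX; field; rewrite gt_eqF.
have h3 : a.+1%:R <= 2 ^+ a :> R.
  by rewrite -natrX ler_nat; exact: ltn_expl.
by apply: le_trans h3 _; apply: lerXn2r; rewrite ?nnegrE// (le_trans _ h2).
Qed.

Lemma error_bound n k a m : (0 < a)%N -> (a ^ 36 <= k)%N -> (k < a.+1 ^ 36)%N ->
  m = (4 * err_exp n * a ^ 3)%N ->
  a%:R^-1 + 2 * (@dimS n (k + m))%:R ^+ 3 * (((1 + (a%:R^-1) ^+ 2 / 4)^-1) ^+ m) ^+ 2
    + 2 * (1 - (@dimS n k)%:R / (@dimS n (k + m))%:R) <= err_const n / a%:R.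
Proof.
move=> a0 ak ka; set r := err_exp n => mE.
have aR : 0 < a%:R :> R by rewrite ltr0n.
have k0 : (0 < k)%N by apply: leq_trans ak; rewrite expn_gt0 a0.
have h1 : 1 - (@dimS n k)%:R / (@dimS n (k + m))%:R <= n%:R * (4 * r)%:R / a%:R :> R.
  apply: le_trans (dimS_ratio_ge n m k0) _; rewrite -mulrA ler_wpM2l//.
  rewrite ler_pdivrMr ?ltr0n// mulrAC ler_pdivlMr// -!natrM ler_nat mE -mulnA leq_mul2l.
  apply/orP; right; apply: leq_trans ak; rewrite -expnSr.
  by apply: leq_pexp2l.
set q : R := (1 + _)^-1.
have q0 : 0 <= q by rewrite invr_ge0 addr_ge0// divr_ge0// sqr_ge0.
set A : R := a.+1%:R; have A1 : 1 <= A by rewrite ler1n.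
have A0 : 0 < A by apply: lt_le_trans A1.
have hq : q ^+ m <= A ^- r by rewrite mE; exact: localization_decay.
have hD : (@dimS n (k + m) <= 2 * (err_base n * a.+1 ^ 36) ^ n)%N.
  apply: leq_trans (dimS_le _ _) _; rewrite leq_mul2l/=; apply: leq_expl => //.
  have p1 : (1 <= a.+1 ^ 36)%N by rewrite expn_gt0.
  have p2 : (a ^ 3 <= a.+1 ^ 36)%N.
    apply: (@leq_trans (a.+1 ^ 3)%N); first exact: leq_expl.
    by apply: leq_pexp2l.
  rewrite /err_base mE -/r !mulnDl mul1n -addnA; apply: leq_add; first exact: leq_pmulr.
  by apply: leq_add; [exact: ltnW|rewrite leq_mul2l p2 orbT].
have hD3 : (@dimS n (k + m))%:R ^+ 3 <= 8 * (err_base n)%:R ^+ (3 * n) * A ^+ (108 * n).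
  have hP : ((a.+1 ^ 36)%N%:R ^+ n) ^+ 3 = A ^+ (108 * n).
    by rewrite natrX -exprM -exprM (mulnC n 3) mulnA.
  move: hP hD; move: (a.+1 ^ 36)%N (@dimS n (k + m)) (err_base n) => P d b hP hd.
  have d0 : 0 <= d%:R :> R by [].
  have dR : d%:R <= ((2 * (b * P) ^ n)%N%:R : R) by rewrite ler_nat.
  apply: le_trans (lerXn2r 3 d0 (le_trans d0 dR) dR) _.
  rewrite natrM natrX natrM !exprMn hP.
  have -> : (b%:R ^+ n) ^+ 3 = b%:R ^+ (3 * n) :> R by rewrite -exprM mulnC.
  have -> : 2 ^+ 3 = 8 :> R by ring.
  by rewrite mulrA.
have hq2 : (q ^+ m) ^+ 2 <= (A ^- r) ^+ 2.
  by apply: lerXn2r; rewrite ?nnegrE ?exprn_ge0 ?invr_ge0 ?exprn_ge0 ?(ltW A0).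
set D := (@dimS n (k + m))%:R in hD3 h1 *; set B := (err_base n)%:R ^+ (3 * n) in hD3.
have B0 : 0 <= B by rewrite exprn_ge0.
have h2 : D ^+ 3 * (q ^+ m) ^+ 2 <= 8 * B / a%:R.
  apply: (@le_trans _ _ (8 * B * A ^+ (108 * n) * (A ^- r) ^+ 2)).
    by apply: ler_pM => //; rewrite exprn_ge0// exprn_ge0.
  rewrite -mulrA ler_wpM2l ?mulr_ge0//.
  have -> : (A ^- r) ^+ 2 = A ^- (108 * n) * A ^- 2.
    have er : (r * 2 = 108 * n + 2)%N by rewrite /r /err_exp mulSn mulnAC addnC.
    by rewrite exprVn -exprM er exprD invfM.
  rewrite mulrA divff ?mul1r ?expf_neq0 ?gt_eqF//.
  rewrite lef_pV2 ?posrE ?exprn_gt0// expr2.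
  apply: (@le_trans _ _ A); first by rewrite ler_nat.
  by rewrite ler_peMl// ltW.
rewrite /err_const -/r -/B !mulrDl div1r; move: h1 h2.
move: (n%:R : R) ((4 * r)%:R : R) (a%:R^-1) ((q ^+ m) ^+ 2) (_ / D) => u v w x y; lra.
Qed.

End ErrorBounds.

(** * Proof of the theorem *)
Section FeketeIntegral.
Context {R : realType} {n : nat}.
Local Notation X := 'rV[R]_n.+1.
Local Notation S := (@sphere R n : set (borel_rV R n)).

(** A constant is added to make the integrand nonnegative. *)
Lemma fekete_sint (muk : probability (borel_rV R n) R) N (x : 'I_N -> X) (v : X -> R) :
  (0 < N)%N -> (forall j, sphere (x j)) ->
  (forall A : set (borel_rV R n), measurable A ->
     muk A = ((N%:R^-1)%:E * \sum_(j < N) \d_(x j : borel_rV R n) A)%E) ->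
  continuous v -> sint muk v = N%:R^-1 * \sum_j v (x j).
Proof.
case: N x => // N x _ sx muE cv.
pose xn (j : nat) : borel_rV R n := x (inord j).
have c0 : 0 <= N.+1%:R^-1 :> R by [].
pose nu := mscale (NngNum c0) (msum (fun j => \d_(xn j) : {measure set _ -> \bar R}) N.+1).
have nuE (F : X -> R) : continuous F -> (forall y, sphere y -> 0 <= F y) ->
    sint muk F = N.+1%:R^-1 * \sum_j F (x j).
  move=> cF F0; rewrite /sint /Rintegral.
  have mF : measurable_fun S (EFin \o F).
    by apply/measurable_EFinP; apply: measurable_funTS; exact: continuous_measurable.
  have F0' y : S y -> (0%R <= (EFin \o F) y)%E by move=> sy; rewrite lee_fin F0.
  have -> : (\int[muk]_(y in S) (F y)%:E = \int[nu]_(y in S) (EFin \o F) y)%E.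
    apply: eq_measure_integral => A mA _; apply: eq_trans (muE A mA) _.
    rewrite /nu /mscale/= /msum.
    by congr (_ * _)%E; apply: eq_bigr => j _; rewrite /xn inord_val.
  rewrite ge0_integral_mscale//; [|exact: measurable_sphere].
  rewrite ge0_integral_measure_sum//; [|exact: measurable_sphere].
  have -> : (\sum_(j < N.+1) \int[\d_(xn j)]_(y in S) (EFin \o F) y =
      (\sum_j F (x j))%:E)%E.
    rewrite -sumEFin; apply: eq_bigr => j _.
    rewrite integral_dirac//; [|exact: measurable_sphere].
    by rewrite /xn inord_val diracE mem_set ?mul1e//; exact: sx.
  by [].
have mu1 : muk sphere = 1%E.
  rewrite (muE _ measurable_sphere).
  rewrite (eq_bigr (fun=> (1%R)%:E)); last first.
    by move=> j _; rewrite diracE mem_set//; exact: sx.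
  by rewrite sumEFin sumr_const card_ord -EFinM mulVf// pnatr_eq0.
have [B B0 HB] := continuous_bounded cv.
have cB : continuous (fun _ : X => B) by move=> y; exact: cst_continuous.
have := nuE (fun y => v y + B).
rewrite (sintD muk cv cB) (sint_cst mu1) big_split/= sumr_const card_ord.
rewrite mulrDr -(mulr_natl B) mulKf ?pnatr_eq0// => H.
apply: (@addIr _ B); apply: H => [y|y sy].
  by apply: (@continuousD _ _ _ v (fun=> B)); [exact: cv|exact: cB].
by have := HB y sy; rewrite ler_norml => /andP[h _]; rewrite -lerBlDr sub0r.
Qed.

End FeketeIntegral.

Lemma rate_bound (R : realType) (k a : nat) (eps : R) : (0 < a)%N -> (1 <= k)%N ->
  0 < eps -> (k < a.+1 ^ 36)%N -> a%:R^-1 <= 2 * k%:R `^ (- 36^-1 + eps).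
Proof.
move=> a0 k1 e0 ka; have aR : 0 < a%:R :> R by rewrite ltr0n.
have k1R : 1 <= k%:R :> R by rewrite ler1n.
have kp : k%:R `^ (36^-1) <= a.+1%:R :> R.
  have -> : a.+1%:R = (a.+1%:R ^+ 36) `^ (36^-1) :> R.
    by rewrite -powR_mulrn// -powRrM divff ?powRr1// pnatr_eq0.
  apply: ge0_ler_powR; rewrite ?nnegrE ?invr_ge0 ?exprn_ge0//.
  by rewrite -natrX ler_nat ltnW.
have k0 : 0 < k%:R `^ (36^-1) :> R by rewrite powR_gt0// (lt_le_trans ltr01).
apply: (@le_trans _ _ (2 * k%:R `^ (- 36^-1))); last first.
  by rewrite ler_wpM2l//; apply: ler_powR => //; rewrite lerDl ltW.
rewrite powRN -[leLHS]div1r ler_pdivrMr// mulrAC ler_pdivlMr// mul1r.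
apply: le_trans kp _; rewrite -natr1.
have : 1 <= a%:R :> R by rewrite ler1n.
lra.
Qed.

Theorem theorem1p2 (R : realType) (n : nat) (hn : (1 <= n)%N)
    (eps : R) (heps0 : 0 < eps) (heps1 : eps < 1) :
  exists2 c : R, 0 < c &
    forall mueq : probability (borel_rV R n) R, equilibrium_measure mueq ->
    forall (k : nat) (muk : probability (borel_rV R n) R),
      (1 <= k)%N -> fekete_measure k muk ->
      (dist1 muk mueq <= (c * k%:R `^ (- 36^-1 + eps))%:E)%E.
Proof.
case: n hn => // n _; exists (2 * err_const n.+1).
  by apply: mulr_gt0 => //; exact: err_const_gt0.
move=> mueq eqm k muk k1 [N [x [fek muE]]].
have [m1 _] := eqm.
have inv (F : 'rV[R]_n.+2 -> R) g : continuous F -> ortho g ->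
    sint mueq (fun x => F (x *m g)) = sint mueq F.
  by move=> cF og; exact: (equilibrium_invariance eqm).
have [sx _] := fek.
have N0 : (0 < N)%N.
  apply: leq_trans (dim_le_nodes k1 fek).
  by rewrite addn_gt0 bin_gt0 leq_addr.
(* [a] is the integer part of [k ^ (1 / 36)]; the scale of the localization is [1 / a]. *)
have [a [a0 ak ka]] := exists_root (isT : (0 < 36)%N) k1.
set m := (4 * err_exp n.+1 * a ^ 3)%N.
have aR : 0 < a%:R^-1 :> R by rewrite invr_gt0 ltr0n.
have q0 : 0 <= (1 + (a%:R^-1 : R) ^+ 2 / 4)^-1.
  by rewrite invr_ge0 addr_ge0// divr_ge0// sqr_ge0.
apply: ge_ereal_sup => _ [v [sv v1] <-]; rewrite lee_fin.
have [b1 _] := C1norm_bounds v1.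
have cv : continuous v by move=> y; have [] := sv [::] y I.
rewrite -[Rintegral muk _ _]/(sint muk v) -[Rintegral mueq _ _]/(sint mueq v).
rewrite (fekete_sint N0 sx muE cv).
have err := @error_bound R n.+1 k a m a0 ak ka erefl.
have lip y z : sphere y -> sphere z -> a%:R^-1 < `|v y - v z| ->
    (1 + dot y z) / 2 <= (1 + (a%:R^-1) ^+ 2 / 4)^-1.
  by move=> sy sz; exact: (sphere_lipschitz sv v1).
have up1 := mean_upper m1 inv (m := m) k1 fek cv b1 aR q0 lip erefl.
(* The opposite inequality is the same bound for [- v]. *)
pose w y := - v y.
have cw : continuous w by move=> y; apply: continuousN; exact: cv.
have wb y : sphere y -> `|w y| <= 1 by move=> sy; rewrite normrN b1.
have lipw y z : sphere y -> sphere z -> a%:R^-1 < `|w y - w z| ->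
    (1 + dot y z) / 2 <= (1 + (a%:R^-1) ^+ 2 / 4)^-1.
  by move=> sy sz; rewrite /w opprK addrC distrC; exact: lip.
have up2 := mean_upper m1 inv (m := m) k1 fek cw wb aR q0 lipw erefl.
have wE : sint mueq w = - sint mueq v.
  by rewrite -mulN1r -(sintZ mueq)//; apply: eq_sint => y _; rewrite mulN1r.
rewrite wE /w sumrN mulrN in up2.
apply: (@le_trans _ _ (err_const n.+1 / a%:R)).
  apply: le_trans err; rewrite ler_norml; apply/andP; split; first by lra.
  by lra.
rewrite -mulrA mulrCA; apply: ler_wpM2l; first exact: ltW (err_const_gt0 _).
exact: (rate_bound a0 k1 heps0 ka).
Qed.
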